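(* Let $G$ be a compact connected semi-simple Lie group and $\widetilde F$ a Minkowski norm on its Lie algebra $\mathfrak g$. Then each orbit $G(X)=\{\mathrm{Ad}(g)X\mid g\in G\}$, $X\in\mathfrak g\setminus\{0\}$, of the adjoint action $\mathrm{Ad}:G\times\mathfrak g\to\mathfrak g$ contains at least two geodesic vectors (of the left-invariant Finsler metric on $G$ induced by $\widetilde F$).
   Context: A Minkowski norm on $\mathfrak g$ is a continuous function $\widetilde F:\mathfrak g\to[0,\infty)$ that is $C^\infty$ on $\mathfrak g\setminus\{0\}$, satisfies $\widetilde F(tZ)=t\widetilde F(Z)$ for $t\ge0$ (reversibility is not assumed), and is such that for every $y\in\mathfrak g\setminus\{0\}$ the symmetric bilinear form $g_y(u,v)=\frac12\frac{\partial^2}{\partial s\,\partial t}[\widetilde F^2(y+su+tv)]|_{s=t=0}$ is positive definite. It induces the left-invariant Finsler metric $F(x,W)=\widetilde F(dL_{x^{-1}}W)$, $x\in G$, $W\in T_xG$, where $L_x$ is left translation by $x$. Geodesics of $F$ are parametrized with constant speed: a curve $\sigma$ with nonzero velocity is a geodesic if in local coordinates $\ddot\sigma^i+\dot\sigma^j\dot\sigma^k\,\Gamma^i_{jk}(\sigma,\dot\sigma)=0$, where $\Gamma^i_{jk}(x,y)$ are the Chern connection coefficients of $F$. A vector $Y\in\mathfrak g\setminus\{0\}$ is a geodesic vector if $t\mapsto\exp(tY)$, $t\in\mathbb R_+=[0,\infty)$, is a geodesic of $F$. *)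

(* Defs.v *)
From HB Require Import structures.
From mathcomp Require Import all_boot all_order all_algebra.
From mathcomp Require Import all_classical all_reals all_analysis.

Set Implicit Arguments.
Unset Strict Implicit.
Unset Printing Implicit Defensive.

Import Order.TTheory GRing.Theory Num.Theory.
Import numFieldNormedType.Exports.

Local Open Scope classical_set_scope.
Local Open Scope ring_scope.

(** ** Smooth maps *)

Section Smooth.
Context {R : realType} {V W : normedModType R}.

Definition iter_derive (vs : seq V) (f : V -> W) : V -> W :=
  foldr (fun v g x => 'D_v g x) f vs.

(* [C^oo] on an open set [U]: the iterated directional derivatives of all
   orders exist and are continuous at the points of [U].  Since [U] is open,
   the values of [f] outside [U] are irrelevant. *)
Definition smooth_on (U : set V) (f : V -> W) : Prop :=
  forall vs x, U x ->
    {for x, continuous (iter_derive vs f)} /\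
    forall v, derivable (iter_derive vs f) x v.

End Smooth.

(** ** Lie groups *)

(* [cinv] is a total function, but only its values on the open set
   [cmap @` cdom] are meaningful. *)
Record chart (R : realType) (n : nat) (M : topologicalType) := Chart {
  cdom : set M;
  cmap : M -> 'rV[R]_n;
  cinv : 'rV[R]_n -> M;
  open_cdom : open cdom;
  open_cimg : open (cmap @` cdom);
  cmapK : forall x, cdom x -> cinv (cmap x) = x;
  continuous_cmap : forall x, cdom x -> {for x, continuous cmap};
  continuous_cinv : forall u, (cmap @` cdom) u -> {for u, continuous cinv}
}.

#[short(type="topologicalGroupCarrierType")]
HB.structure Definition TopologicalGroupCarrier :=
  {G of Group G & Topological G}.

(* [chart1] is an arbitrary chart around the unit; it is used to identify the
   tangent space [T_1 G] with ['rV[R]_n]. *)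
HB.mixin Record isLieGroup (R : realType) (n : nat) G
    of TopologicalGroupCarrier G := {
  lie_hausdorff : hausdorff_space G;
  lie_second_countable : @second_countable G;
  mulg_continuous : continuous (fun p : G * G => (p.1 * p.2)%g);
  invg_continuous : continuous (fun x : G => x^-1%g);
  atlas : set (chart R n G);
  atlas_cover : forall x : G, exists2 c, atlas c & cdom c x;
  chart1 : chart R n G;
  chart1_atlas : atlas chart1;
  chart1_unit : cdom chart1 1%g;
  transition_smooth : forall c c', atlas c -> atlas c' ->
    smooth_on (cmap c @` (cdom c `&` cdom c')) (fun u => cmap c' (cinv c u));
  mulg_smooth : forall a b c, atlas a -> atlas b -> atlas c ->
    smooth_on
      [set p : 'rV[R]_n * 'rV[R]_n |
        [/\ (cmap a @` cdom a) p.1, (cmap b @` cdom b) p.2 &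
            cdom c (cinv a p.1 * cinv b p.2)%g]]
      (fun p => cmap c (cinv a p.1 * cinv b p.2)%g);
  invg_smooth : forall a b, atlas a -> atlas b ->
    smooth_on
      [set u | (cmap a @` cdom a) u /\ cdom b (cinv a u)^-1%g]
      (fun u => cmap b (cinv a u)^-1%g)
}.

#[short(type="lieGroupType")]
HB.structure Definition LieGroup (R : realType) (n : nat) :=
  {G of isLieGroup R n G & TopologicalGroupCarrier G}.

Section LieAlgebra.
Context {R : realType} {n : nat} (G : lieGroupType R n).

Local Notation phi := (cmap (chart1 : chart R n G)).
Local Notation psi := (cinv (chart1 : chart R n G)).

(* The left-invariant vector field [x |-> dL_x X], read in [chart1]. *)
Definition left_invariant_field (X u : 'rV[R]_n) : 'rV[R]_n :=
  'D_X (fun v => phi (psi u * psi v)%g) (phi 1%g).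

(* The value at the unit of the bracket of left-invariant vector fields. *)
Definition lie_bracket (X Y : 'rV[R]_n) : 'rV[R]_n :=
  'D_X (left_invariant_field Y) (phi 1%g)
  - 'D_Y (left_invariant_field X) (phi 1%g).

Definition Ad (g : G) (X : 'rV[R]_n) : 'rV[R]_n :=
  'D_X (fun v => phi (g * psi v * g^-1)%g) (phi 1%g).

Definition adjoint_orbit (X : 'rV[R]_n) : set 'rV[R]_n :=
  [set Ad g X | g in [set: G]].

Definition lie_ideal (I : {vspace 'rV[R]_n}) : Prop :=
  forall X Y, Y \in I -> lie_bracket X Y \in I.

(* [[U, U]], spanned by the brackets of basis vectors by bilinearity. *)
Definition derived_algebra (U : {vspace 'rV[R]_n}) : {vspace 'rV[R]_n} :=
  <<[seq lie_bracket x y | x <- vbasis U, y <- vbasis U]>>%VS.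

Definition lie_solvable (U : {vspace 'rV[R]_n}) : Prop :=
  exists k, iter k derived_algebra U = 0%VS.

Definition semisimple : Prop :=
  forall I, lie_ideal I -> lie_solvable I -> I = 0%VS.

Definition smooth_curve (s : R -> G) : Prop :=
  continuous s /\
  forall c : chart R n G, atlas c ->
    smooth_on (s @^-1` cdom c) (fun t : R => cmap c (s t)).

Definition one_parameter_subgroup (X : 'rV[R]_n) (s : R -> G) : Prop :=
  [/\ smooth_curve s, forall a b, s (a + b) = (s a * s b)%g &
      derive1 (fun t => phi (s t)) 0 = X].

Definition lie_exp (X : 'rV[R]_n) : G :=
  xget (fun=> 1%g) (one_parameter_subgroup X) 1.

End LieAlgebra.

(** ** Minkowski norms and Finsler metrics *)

Section Finsler.
Context {R : realType} {n : nat}.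
Implicit Types (i j k : 'I_n) (x y u v : 'rV[R]_n).

Definition fundamental_tensor (F : 'rV[R]_n -> R) y u v : R :=
  2^-1 * derive1 (fun s : R =>
           derive1 (fun t : R => F (y + s *: u + t *: v) ^+ 2) 0) 0.

Definition minkowski_norm (F : 'rV[R]_n -> R) : Prop :=
  [/\ continuous F,
      forall y, 0 <= F y,
      smooth_on [set y | y != 0] F,
      forall (t : R) y, 0 <= t -> F (t *: y) = t * F y &
      forall y u, y != 0 -> u != 0 -> 0 < fundamental_tensor F y u u].

(* Below, [F x y] is a Finsler metric in local coordinates: [x] is the position
   and [y] the components of the tangent vector. *)
Variable F : 'rV[R]_n -> 'rV[R]_n -> R.

Local Notation e i := (delta_mx 0 i : 'rV[R]_n).

Definition metric_mx x y : 'M[R]_n :=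
  \matrix_(i, j) fundamental_tensor (F x) y (e i) (e j).

Local Notation ginv x y := (invmx (metric_mx x y)).

Definition metric_dx x y k i j : R :=
  'D_(e k) (fun x' => metric_mx x' y i j : R) x.

Definition metric_dy x y k i j : R :=
  'D_(e k) (fun y' => metric_mx x y' i j : R) y.

(* gamma^i_jk = 1/2 g^il (d_k g_lj + d_j g_lk - d_l g_jk) *)
Definition formal_christoffel x y i j k : R :=
  2^-1 * \sum_l ginv x y i l *
    (metric_dx x y k l j + metric_dx x y j l k - metric_dx x y l j k).

Definition cartan_tensor x y i j k : R := 2^-1 * metric_dy x y k i j.

(* N^i_j = gamma^i_jk y^k - g^il C_ljk gamma^k_rs y^r y^s *)
Definition nonlinear_connection x y i j : R :=
  \sum_k formal_christoffel x y i j k * y 0 k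
  - \sum_l \sum_k \sum_r \sum_s
      ginv x y i l * cartan_tensor x y l j k *
      formal_christoffel x y k r s * y 0 r * y 0 s.

(* delta g_ij / delta x^k, with delta/delta x^k = d/dx^k - N^s_k d/dy^s *)
Definition metric_delta x y k i j : R :=
  metric_dx x y k i j
  - \sum_s nonlinear_connection x y s k * metric_dy x y s i j.

(* Coefficients Gamma^i_jk of the Chern connection: the formula for gamma^i_jk
   with d/dx replaced by delta/delta x (see Bao-Chern-Shen, An Introduction to
   Riemann-Finsler Geometry, section 2.4). *)
Definition chern_connection x y i j k : R :=
  2^-1 * \sum_l ginv x y i l *
    (metric_delta x y k l j + metric_delta x y j l k - metric_delta x y l j k).

End Finsler.

Section Geodesics.
Context {R : realType} {n : nat} (G : lieGroupType R n).
Variable F : 'rV[R]_n -> R.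

(* The left-invariant metric F(x, W) = F (dL_{x^-1} W) in the chart [c], at the
   point of coordinates [u] and the tangent vector of components [y]. *)
Definition left_invariant_metric (c : chart R n G) (u y : 'rV[R]_n) : R :=
  F ('D_y (fun v => cmap (chart1 : chart R n G)
                      ((cinv c u)^-1 * cinv c v)%g) u).

(* A curve on [J] is given by a function on the whole of [R], defined beyond
   the end points of [J], so that its derivatives are two-sided ones. *)
Definition geodesic_on (J : set R) (s : R -> G) : Prop :=
  forall t, J t -> {for t, continuous s} /\
    forall c : chart R n G, atlas c -> cdom c (s t) ->
      let x := fun t' : R => cmap c (s t') in
      let y := derive1 x t in
      [/\ \forall t' \near t, derivable x t' 1,
          derivable (derive1 x) t 1,
          y != 0 &
          forall i, derive1 (derive1 x) t 0 i
            + \sum_j \sum_k y 0 j * y 0 k *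
                chern_connection (left_invariant_metric c) (x t) y i j k = 0].

Definition geodesic_vector (Y : 'rV[R]_n) : Prop :=
  Y != 0 /\ geodesic_on `[0, +oo[ (fun t : R => lie_exp G (t *: Y)).

End Geodesics.

(* Main.v *)
Require Import Defs.
From HB Require Import structures.
From mathcomp Require Import all_boot all_order all_algebra.
From mathcomp Require Import all_classical all_reals all_analysis.
From mathcomp Require Import ring lra.

(** Read in the left trivialisation of the tangent bundle, the velocity of the
    curve [t |-> exp (t Y)] is the constant [Y].  Along such a curve the
    Euler-Lagrange equation of the left-invariant energy becomes a condition on
    [Y] alone: the differential of the norm at [Y] has to vanish on all brackets
    [[Z, Y]].  These brackets are the vectors tangent at [Y] to the adjoint
    orbit of [Y] ([derive_Ad]), so every critical point of the restriction of
    the norm to an adjoint orbit is a geodesic vector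
    ([critical_geodesic_vector]).  By compactness the norm has a maximum and a
    minimum on the orbit of [X].  If they are attained at different vectors,
    these two vectors will do.  Otherwise the norm is constant on the orbit, all
    vectors of the orbit are critical, and there are at least two of them
    because no nonzero vector of a semisimple Lie algebra is fixed by the
    adjoint action ([semisimple_Ad_moves]).

    Three bodies of material support this argument.

    The first is the calculus of smooth maps at a point ([smooth]), with the
    chain rule in several variables, the symmetry of second derivatives
    ([schwarz]) and a Lipschitz form of the first-order expansion ([taylor1]).

    The second is the exponential map.  It is constructed as the limit of the
    powers of exponent [2 ^ k] of the points of coordinates [e + Z / 2 ^ k] in
    the chart at the unit.  A curve with [s (2 t) = s t * s t] is determined by
    its velocity at the unit ([doubling_unique]), because [k] squarings expand
    distances by a factor of order [2 ^ k] only ([iter_sq]); this uniqueness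
    gives the homomorphism property and identifies the limit with [lie_exp],
    without existence or uniqueness theorems for differential equations.

    The third is the geodesic equation.  Contracted twice with the velocity, the
    coefficients of the Chern connection lose their Cartan tensor terms by
    homogeneity, and what remains is the Euler-Lagrange expression
    ([chern_contraction]).  For a left-invariant metric, which is the norm of
    the Maurer-Cartan form, the terms of this expression that do not contain the
    acceleration are brackets by the structure equation ([maurer_cartan]). *)

Set Implicit Arguments.
Unset Strict Implicit.
Unset Printing Implicit Defensive.

Import Order.TTheory GRing.Theory Num.Theory.
Import numFieldNormedType.Exports.

Local Open Scope classical_set_scope.
Local Open Scope ring_scope.

(** * Derivatives along lines and the total differential *)

Section Lines.
Context {R : realType} {V W : normedModType R}.
Implicit Types (f : V -> W) (x v : V).

Lemma growth_lineE f x v (t : R) :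
  (fun h : R => h^-1 *: ((f \o shift (x + t *: v)) (h *: v) - f (x + t *: v))) =
  (fun h : R => h^-1 *: (((fun s : R => f (x + s *: v)) \o shift t) (h *: 1)
                 - f (x + t *: v))).
Proof.
apply/funext => h /=; congr (_ *: (f _ - _)).
by rewrite [h *: 1]mulr1 scalerDl addrCA addrC -addrA; congr (_ + _); rewrite addrC.
Qed.

Lemma derivable_line f x v (t : R) :
  derivable f (x + t *: v) v <-> derivable (fun s : R => f (x + s *: v)) t 1.
Proof. by rewrite /derivable growth_lineE. Qed.

Lemma derive_line f x v (t : R) :
  'D_v f (x + t *: v) = 'D_1 (fun s : R => f (x + s *: v)) t.
Proof. by rewrite /derive growth_lineE. Qed.

Lemma derivable_diff_line f x v :
  derivable f x v <-> differentiable (fun s : R => f (x + s *: v)) 0.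
Proof.
have := derivable_line f x v 0; rewrite scale0r addr0 => ->.
exact: derivable1_diffP.
Qed.

(** Only derivability along [v] is available, so homogeneity in the direction
    comes from the one-variable chain rule on the line through [x], not from
    the linearity of a differential. *)
Lemma is_derive_dirZ f x v (a : R) : derivable f x v ->
  is_derive x (a *: v) f (a *: 'D_v f x).
Proof.
move=> /derivable_diff_line df.
have [da dE] : is_diff 0 ( *:%R^~ a : R -> R) ( *:%R^~ a : R -> R).
  exact: is_diff_scalel.
have df' : differentiable (fun s : R => f (x + s *: v)) (( *:%R^~ a : R -> R) 0).
  by rewrite /= [_ *: _]mul0r.
have E : (fun s : R => f (x + s *: (a *: v))) =
         (fun s : R => f (x + s *: v)) \o ( *:%R^~ a : R -> R).
  by apply/funext => s /=; rewrite scalerA.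
have D : differentiable (fun s : R => f (x + s *: (a *: v))) 0.
  by rewrite E; apply: differentiable_comp.
split; first by apply/derivable_diff_line.
have := derive_line f x (a *: v) 0; rewrite scale0r addr0 => ->.
rewrite deriveE// E diff_comp// dE.
rewrite /= [1 *: a]mul1r [0 *: a]mul0r.
have := derive_line f x v 0; rewrite scale0r addr0 => ->.
by rewrite deriveE// -[in RHS]linearZ /= [a *: 1]mulr1.
Qed.

End Lines.

Section MeanValue.
Context {R : realType} {V : normedModType R}.

Lemma MVT_line (f : V -> R) x v :
  (forall t, t \in `[0, 1]%R -> derivable f (x + t *: v) v) ->
  exists2 t, t \in `[0, 1]%R & f (x + v) - f x = 'D_v f (x + t *: v).
Proof.
move=> df; pose g t := f (x + t *: v).
have dg t : t \in `[0, 1]%R -> derivable g t 1.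
  by move=> t01; apply/derivable_line; apply: df.
have [||t t01] := @MVT_segment R g (fun t => 'D_1 g t) 0 1 ler01.
- move=> t t01; apply/derivableP/dg.
  by move: t01; rewrite !in_itv /= => /andP[? ?]; rewrite !ltW.
- by apply: derivable_within_continuous => t; exact: dg.
rewrite /g scale1r scale0r addr0 subr0 mulr1 => ->.
by exists t; rewrite // derive_line.
Qed.

(** The base point [y] is free in a ball and not fixed at [x]: this uniformity
    is what allows several coordinates to be changed one after the other. *)
Lemma partial_strict (f : V -> R) x b :
  (\forall y \near x, derivable f y b) -> {for x, continuous ('D_b f)} ->
  forall e : R, 0 < e -> exists2 d : R, 0 < d & forall y a, ball x d y -> `|a| < d ->
    `|f (y + a *: b) - f y - a * 'D_b f x| <= e * `|a|.
Proof.
move=> df cf e e0.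
have : \forall y \near x, derivable f y b /\ `|'D_b f x - 'D_b f y| <= e.
  near=> y; split; first by near: y.
  by near: y; move: e e0; apply/cvgrPdist_le; exact: cf.
move=> /nbhs_ballP[r /= r0 Hr].
pose d := Num.min (r / 2) (r / 2 / (`|b| + 1)).
have b1 : 0 < `|b| + 1 by rewrite ltr_wpDl.
have d0 : 0 < d by rewrite lt_min !divr_gt0.
exists d => // y a; rewrite -ball_normE /= => xy ad.
have H t : t \in `[0, 1]%R -> ball x r (y + t *: (a *: b)).
  rewrite in_itv /= => /andP[t0 t1]; rewrite -ball_normE /=.
  rewrite opprD addrA (le_lt_trans (ler_normB _ _))// (splitr r) ltr_leD//.
    by rewrite (lt_le_trans xy)// ge_min lexx.
  rewrite normrZ normrZ ger0_norm// -[leRHS]mul1r ler_pM//.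
  rewrite (@le_trans _ _ (d * (`|b| + 1)))//.
    by rewrite ler_pM// ?ltW// ltrDl.
  by rewrite -ler_pdivlMr// ge_min lexx orbT.
have Hd t : t \in `[0, 1]%R -> derivable f (y + t *: (a *: b)) (a *: b).
  by move=> /H /Hr[dd _]; have [] := is_derive_dirZ a dd.
have [t t01 ->] := MVT_line Hd.
have [dd le] := Hr _ (H t t01).
have [_ ->] := is_derive_dirZ a dd.
rewrite [X in X - _]/(a * _) -mulrBr normrM mulrC ler_wpM2r// distrC //.
Unshelve. all: by end_near. Qed.

(** The coordinates are changed one at a time, each increment being estimated
    by [partial_strict] at the point reached so far. *)
Lemma partials_strict (I : Type) (b : I -> V) (f : V -> R) x (s : seq I) :
  (forall i, \forall y \near x, derivable f y (b i)) ->
  (forall i, {for x, continuous ('D_(b i) f)}) ->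
  forall e : R, 0 < e -> exists2 d : R, 0 < d & forall y (a : I -> R), ball x d y ->
    (forall i, `|a i| < d) ->
    `|f (y + \sum_(i <- s) a i *: b i) - f y - \sum_(i <- s) a i * 'D_(b i) f x|
      <= e * \sum_(i <- s) `|a i|.
Proof.
move=> df cf e e0; elim: s => [|j s [d d0 IH]].
  by exists 1 => // y a _ _; rewrite !big_nil addr0 !subrr normr0 mulr0.
have [d1 d10 H1] := partial_strict (df j) (cf j) e0.
have b1 : 0 < `|b j| + 1 by rewrite ltr_wpDl.
exists (Num.min d1 (Num.min (d / 2) (d / 2 / (`|b j| + 1)))).
  by rewrite !lt_min d10 !divr_gt0.
move=> y a xy ad; rewrite !big_cons.
have xy1 : ball x d1 y by apply: le_ball xy; rewrite ge_min lexx.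
have ad1 : `|a j| < d1 by apply: lt_le_trans (ad j) _; rewrite ge_min lexx.
have xy2 : ball x d (y + a j *: b j).
  move: xy; rewrite -!ball_normE /= => xy.
  rewrite opprD addrA (le_lt_trans (ler_normB _ _))// (splitr d) ltr_leD//.
    by rewrite (lt_le_trans xy)// !ge_min lexx orbT.
  rewrite normrZ (@le_trans _ _ (`|a j| * (`|b j| + 1)))//.
    by rewrite ler_wpM2l// lerDl.
  by rewrite -ler_pdivlMr// ltW// (lt_le_trans (ad j))// !ge_min lexx !orbT.
have ad2 i : `|a i| < d.
  apply: lt_le_trans (ad i) _; rewrite !ge_min ler_pdivrMr// ler_peMr ?orbT ?ler1n//.
  exact: ltW.
have := lerD (H1 y _ xy1 ad1) (IH _ a xy2 ad2).
rewrite -mulrDr; apply: le_trans; rewrite addrA.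
apply: le_trans (ler_normD _ _); rewrite le_eqVlt; apply/orP; left; apply/eqP.
by congr (`| _ |); ring.
Qed.

End MeanValue.

(** * Spaces with finitely many coordinates *)

(** The coordinates are carried by the space, so that the total differential
    theorem and the chain rule apply alike to the real line, to row vectors and
    to products of such spaces. *)
Class fin_coord (R : realType) (V : normedModType R) := FinCoord {
  fc_idx : finType;
  fc_vec : fc_idx -> V;
  fc_coef : fc_idx -> {linear V -> R};
  fc_continuous : forall i, continuous (fc_coef i);
  fc_sum : forall v, \sum_i fc_coef i v *: fc_vec i = v }.

Arguments fc_idx {R} V {_}.
Arguments fc_vec {R V _}.
Arguments fc_coef {R V _}.

Section FinCoordInstances.
Context {R : realType}.

Section Real.
Let idl : linear (id : R -> R). Proof. by []. Qed.
Let idL : {linear R -> R} := HB.pack (id : R -> R) (GRing.isLinear.Build _ _ _ _ _ idl).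
Let cts (i : unit) : continuous idL. Proof. by move=> x; exact: cvg_id. Qed.
Let sumE (v : R) : \sum_(i : unit) idL v *: (1 : R) = v.
Proof. by rewrite big_const card_unit /= addr0; exact: mulr1. Qed.
#[global] Instance fin_coord_R : fin_coord R := @FinCoord R R unit (fun=> 1) (fun=> idL) cts sumE.
End Real.

Section Row.
Variable n : nat.
Let cl (i : 'I_n) : linear (fun v : 'rV[R]_n => v 0 i).
Proof. by move=> a u v; rewrite !mxE. Qed.
Let cL (i : 'I_n) : {linear 'rV[R]_n -> R} :=
  HB.pack (fun v : 'rV[R]_n => v 0 i) (GRing.isLinear.Build _ _ _ _ _ (cl i)).
Let cts (i : 'I_n) : continuous (cL i). Proof. exact: coord_continuous. Qed.
Let sumE (v : 'rV[R]_n) : \sum_i cL i v *: delta_mx 0 i = v.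
Proof. by rewrite [RHS]row_sum_delta. Qed.
#[global] Instance fin_coord_rV : fin_coord 'rV[R]_n := @FinCoord R 'rV[R]_n _ _ _ cts sumE.
End Row.

Section Prod.
Context (V W : normedModType R) {fV : fin_coord V} {fW : fin_coord W}.
Let vec (i : fc_idx V + fc_idx W) : V * W :=
  match i with inl j => (fc_vec j, 0) | inr j => (0, fc_vec j) end.
Let coef (i : fc_idx V + fc_idx W) : {linear (V * W)%type -> R} :=
  match i with
  | inl j => (fc_coef j \o @fst V W)%FUN
  | inr j => (fc_coef j \o @snd V W)%FUN end.
Let cts i : continuous (coef i).
Proof.
case: i => j /= x.
  by apply: continuous_comp; [exact: cvg_fst | exact: fc_continuous].
by apply: continuous_comp; [exact: cvg_snd | exact: fc_continuous].
Qed.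
Let sumE v : \sum_i coef i v *: vec i = v.
Proof.
rewrite big_sumType /=; case: v => v w /=.
have -> : \sum_i fc_coef i v *: ((fc_vec i, 0) : V * W) = (v, 0).
  rewrite -[in RHS](fc_sum v).
  apply: (big_rec2 (fun (a : V * W) b => a = (b, 0))) => // i y1 y2 _ ->.
  by congr pair; rewrite /= scaler0 addr0.
have -> : \sum_i fc_coef i w *: ((0, fc_vec i) : V * W) = (0, w).
  rewrite -[in RHS](fc_sum w).
  apply: (big_rec2 (fun (a : V * W) b => a = (0, b))) => // i y1 y2 _ ->.
  by congr pair; rewrite /= scaler0 addr0.
by congr pair; rewrite /= ?addr0 ?add0r.
Qed.
#[global] Instance fin_coord_prod : fin_coord (V * W)%type := FinCoord cts sumE.
End Prod.

End FinCoordInstances.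

Section Differentiability.
Context {R : realType}.

Lemma diff_intro (V W : normedModType R) (f : V -> W) (L : {linear V -> W}) x :
  continuous L ->
  (forall e : R, 0 < e -> \forall h \near 0, `|f (h + x) - f x - L h| <= e * `|h|) ->
  differentiable f x /\ 'd f x = L :> (V -> W).
Proof.
move=> cL H.
have E : f \o shift x = cst (f x) + L +o_ 0 id.
  apply/eqaddoP => e e0.
  near do (rewrite opprD addrA /=).
  exact: H.
by split; [apply/diff_locallyP; rewrite (diff_unique cL E) | exact: diff_unique].
Unshelve. all: by end_near. Qed.

Lemma differentiable_intro (V W : normedModType R) (f : V -> W) (L : {linear V -> W}) x :
  continuous L ->
  (forall e : R, 0 < e -> \forall h \near 0, `|f (h + x) - f x - L h| <= e * `|h|) ->
  differentiable f x.
Proof. by move=> cL H; case: (diff_intro cL H). Qed.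

Lemma differentiable_elim (V W : normedModType R) (f : V -> W) x :
  differentiable f x ->
  (forall e : R, 0 < e -> \forall h \near 0, `|f (h + x) - f x - 'd f x h| <= e * `|h|).
Proof.
move=> /diff_locally /eqaddoP H e e0.
have := H e e0; apply: filterS => h.
by rewrite /= opprD addrA.
Qed.

Lemma near_eq_differentiable (V W : normedModType R) (f g : V -> W) x :
  {near x, f =1 g} -> differentiable f x -> differentiable g x.
Proof.
move=> fg df; apply: (@differentiable_intro _ _ _ ('d f x)).
  exact: diff_continuous.
move=> e e0; near=> h.
have <- : f (h + x) = g (h + x).
  near: h.
  have := fg; rewrite (near_shift 0) /=; apply: filterS => h /=.
  by rewrite subr0.
have <- : f x = g x by apply: (nbhs_singleton fg).
by near: h; exact: differentiable_elim.
Unshelve. all: by end_near. Qed.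

Context {V W : normedModType R} {fV : fin_coord V} {fW : fin_coord W}.

Lemma coef_bound : exists2 K : R, 0 < K &
  forall h : V, \sum_i `|fc_coef i h| <= K * `|h|.
Proof.
have H (i : fc_idx V) : exists k : R, 0 <= k /\ forall h : V, `|fc_coef i h| <= k * `|h|.
  have [k k0 Hk] := linear_lipschitz (@fc_continuous _ _ _ i).
  by exists k; split; rewrite ?ltW.
have [k Hk] := choice H.
exists (1 + \sum_i k i).
  by rewrite ltr_wpDr// sumr_ge0// => i _; case: (Hk i).
move=> h; rewrite mulrDl mul1r mulr_suml.
by rewrite ler_wpDl// ler_sum// => i _; case: (Hk i).
Qed.

(** The total differential theorem.  The increments of [partials_strict] add up
    to an error that is small relative to the sum of the coordinates of the
    increment, and [coef_bound] compares this sum with the norm. *)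
Lemma differentiable_partials (f : V -> R) x :
  (forall i : fc_idx V, \forall y \near x, derivable f y (fc_vec i)) ->
  (forall i : fc_idx V, {for x, continuous ('D_(fc_vec i) f)}) ->
  differentiable f x.
Proof.
move=> df cf.
pose L0 (h : V) := \sum_i @fc_coef R V fV i h * 'D_(@fc_vec R V fV i) f x.
have L0l : linear L0.
  move=> a u v; rewrite /L0 scaler_sumr -big_split /=; apply: eq_bigr => i _.
  by rewrite linearP mulrDl -mulrA.
pose L : {linear V -> R} := HB.pack L0 (GRing.isLinear.Build _ _ _ _ _ L0l).
apply: (@differentiable_intro _ _ _ L).
  move=> h; rewrite /L /= /L0; apply: cvg_big; first exact: add_continuous.
  by move=> i _; apply: cvgMl; exact: fc_continuous.
move=> e e0.
have [K K0 HK] := coef_bound.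
have [d d0 Hd] := partials_strict (index_enum _) df cf (divr_gt0 e0 K0).
near=> h.
have hK : \sum_i `|fc_coef i h| < d.
  apply: le_lt_trans (HK h) _; rewrite mulrC -ltr_pdivlMr//.
  by near: h; apply: nbhs0_lt; rewrite divr_gt0.
have hi i : `|fc_coef i h| < d.
  apply: le_lt_trans hK; rewrite (bigD1 i)//= lerDl.
  by rewrite sumr_ge0.
have := Hd x (fun i => fc_coef i h) (ballxx _ d0) hi.
rewrite fc_sum [x + h]addrC => Hh; apply: le_trans Hh _.
rewrite -mulrA; apply: ler_wpM2l; first exact: ltW.
by rewrite mulrC ler_pdivrMr// [leRHS]mulrC.
Unshelve. all: by end_near. Qed.

Lemma differentiable_coefP (f : V -> W) x :
  (forall j : fc_idx W, differentiable (fc_coef j \o f) x) -> differentiable f x.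
Proof.
move=> H.
have -> : f = fun y => \sum_(j : fc_idx W) (fc_coef j (f y)) *: fc_vec j.
  by apply/funext => y; rewrite fc_sum.
rewrite [X in differentiable X _](_ : _ =
   \sum_(j : fc_idx W) (fun y => (fc_coef j (f y)) *: fc_vec j)); last first.
  by apply/funext => y; rewrite fct_sumE.
elim/big_ind : _ => [|g h dg dh|j _].
- exact: differentiable_cst.
- exact: differentiableD.
- by apply: differentiableZl; exact: H.
Qed.

End Differentiability.

Section DeriveRules.
Context {R : realType}.

Section Gen.
Context {U V W : normedModType R}.

Lemma derive_dirD (f : V -> W) x u v : differentiable f x ->
  'D_(u + v) f x = 'D_u f x + 'D_v f x.
Proof. by move=> df; rewrite !deriveE// linearD. Qed.

Lemma derive_dirZ (f : V -> W) x (a : R) v : differentiable f x ->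
  'D_(a *: v) f x = a *: 'D_v f x.
Proof. by move=> df; rewrite !deriveE// linearZ. Qed.

Lemma derive_dirN (f : V -> W) x v : differentiable f x ->
  'D_(- v) f x = - 'D_v f x.
Proof. by move=> df; rewrite !deriveE// linearN. Qed.

Lemma derive_dir_sum (I : Type) (s : seq I) (P : pred I) (f : V -> W) x (v : I -> V) :
  differentiable f x ->
  'D_(\sum_(i <- s | P i) v i) f x = \sum_(i <- s | P i) 'D_(v i) f x.
Proof. by move=> df; rewrite deriveE// linear_sum; apply: eq_bigr => i _; rewrite deriveE. Qed.

Lemma derive_comp (f : U -> V) (g : V -> W) x v :
  differentiable f x -> differentiable g (f x) ->
  'D_v (g \o f) x = 'D_('D_v f x) g (f x).
Proof.
move=> df dg; have dgf := differentiable_comp df dg.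
by rewrite (deriveE _ dgf) diff_comp//= (deriveE _ dg) (deriveE _ df).
Qed.

Lemma derive_lin (L : {linear V -> W}) x v : continuous L -> 'D_v L x = L v.
Proof.
by move=> cL; rewrite (deriveE _ (linear_differentiable _ cL)) diff_lin.
Qed.

Lemma growth_comp_lin (f : U -> V) (L : {linear V -> W}) x v :
  continuous L -> derivable f x v ->
  h^-1 *: (L (f (h *: v + x)) - L (f x)) @[h --> 0^'] --> L ('D_v f x).
Proof.
move=> cL df.
rewrite [X in X @ _ --> _](_ : _ = (fun h => L (h^-1 *: ((f \o shift x) (h *: v) - f x)))); last first.
  by apply/funext => h /=; rewrite -[in LHS]linearB -[LHS]linearZ_LR.
apply: (@cvg_comp _ _ _ _ L _ _ _ df); exact: cL.
Qed.

Lemma derivable_comp_lin (f : U -> V) (L : {linear V -> W}) x v :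
  continuous L -> derivable f x v -> derivable (fun y => L (f y)) x v.
Proof. by move=> cL df; apply/cvg_ex; eexists; exact: growth_comp_lin. Qed.

Lemma derive_comp_lin (f : U -> V) (L : {linear V -> W}) x v :
  continuous L -> derivable f x v -> 'D_v (fun y => L (f y)) x = L ('D_v f x).
Proof. by move=> cL df; apply/cvg_lim => //; exact: growth_comp_lin. Qed.

Lemma derive_pair (f : U -> V) (g : U -> W) x v :
  differentiable f x -> differentiable g x ->
  'D_v (fun y => (f y, g y)) x = ('D_v f x, 'D_v g x).
Proof.
move=> df dg; have dfg := differentiable_pair df dg.
by rewrite (deriveE _ dfg) diff_pair// (deriveE _ df) (deriveE _ dg).
Qed.

Lemma derive_fc {fV : fin_coord V} (f : V -> W) x v : differentiable f x ->
  'D_v f x = \sum_i fc_coef i v *: 'D_(fc_vec i) f x.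
Proof.
move=> df; rewrite -[in LHS](fc_sum v) derive_dir_sum//.
by apply: eq_bigr => i _; exact: derive_dirZ.
Qed.

End Gen.

Section FC.
Context {V W : normedModType R} {fW : fin_coord W}.

Lemma fc_inj (u v : W) : (forall j, fc_coef j u = fc_coef j v) -> u = v.
Proof. by move=> uv; rewrite -(fc_sum u) -(fc_sum v); apply: eq_bigr => j _; rewrite uv. Qed.

Lemma differentiable_coef (f : V -> W) x j :
  differentiable f x -> differentiable (fun y => fc_coef j (f y)) x.
Proof.
move=> df; apply: (@differentiable_comp _ _ _ _ f (fc_coef j)) => //.
exact/linear_differentiable/fc_continuous.
Qed.

Lemma differentiable_scale (a : V -> R) (f : V -> W) x :
  differentiable a x -> differentiable f x ->
  differentiable (fun y => a y *: f y) x.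
Proof.
move=> da df; apply: differentiable_coefP => j.
rewrite (_ : _ \o _ = a * (fun y => fc_coef j (f y))); last first.
  by apply/funext => y /=; rewrite linearZ.
by apply: differentiableM => //; exact: differentiable_coef.
Qed.

Lemma derive_scale (a : V -> R) (f : V -> W) x v :
  differentiable a x -> differentiable f x ->
  'D_v (fun y => a y *: f y) x = 'D_v a x *: f x + a x *: 'D_v f x.
Proof.
move=> da df; apply: fc_inj => j.
have dd := diff_derivable.
rewrite -derive_comp_lin; [|exact: fc_continuous|exact/dd/differentiable_scale].
rewrite (_ : (fun y => _) = a * (fun y => fc_coef j (f y))); last first.
  by apply/funext => y /=; rewrite linearZ.
rewrite deriveM; [|exact: dd|exact/dd/differentiable_coef].
rewrite linearD !linearZ /= derive_comp_lin; [|exact: fc_continuous|exact: dd].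
by rewrite addrC [_ *: 'D_v a x]mulrC.
Qed.

End FC.
End DeriveRules.

(** * Smooth maps at a point *)

Section Smoothness.
Context {R : realType}.

(** Germs of maps of class [C^k].  Differentiability is asked near [x] and not
    only at [x], so that the derivatives are again defined near [x]. *)
Fixpoint ndiff {V W : normedModType R} (k : nat) (f : V -> W) (x : V) : Prop :=
  if k is k'.+1 then
    (\forall y \near x, differentiable f y) /\ forall v, ndiff k' ('D_v f) x
  else \forall y \near x, {for y, continuous f}.

(** Germs at a point compose without any bookkeeping of open domains;
    [smooth_on_smooth] and [smooth_smooth_on] relate them to smoothness on an
    open set. *)
Definition smooth {V W : normedModType R} (f : V -> W) x := forall k, ndiff k f x.

Section Basic.
Context {V W : normedModType R}.

Lemma ndiff_near_eq k (f g : V -> W) x :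
  {near x, f =1 g} -> ndiff k f x -> ndiff k g x.
Proof.
elim: k f g => [|k IH] f g fg /=.
  move=> cf; have : \near x, {near x, f =1 g} by exact/near_join.
  apply: filterS2 cf => y cf /= fg'.
  change (g @ y --> g y); rewrite -(nbhs_singleton fg').
  by apply: cvg_trans cf; exact: near_eq_cvg.
have fgj : \near x, {near x, f =1 g} by exact/near_join.
move=> [df Df]; split; last first.
  move=> v; apply: IH (Df v); apply: filterS fgj => y fgy.
  exact: near_eq_derive.
by apply: filterS2 fgj df => y fgy; apply: near_eq_differentiable.
Qed.

Lemma ndiffS k (f : V -> W) x : ndiff k.+1 f x -> ndiff k f x.
Proof.
elim: k f => [|k IH] f /=.
  by case=> df _; apply: filterS df => y; exact: differentiable_continuous.
by case=> df Df; split => // v; apply: IH (Df v).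
Qed.

Lemma smooth_near_eq (f g : V -> W) x :
  {near x, f =1 g} -> smooth f x -> smooth g x.
Proof. by move=> fg sf k; apply: ndiff_near_eq fg (sf k). Qed.

Lemma smooth_derive (f : V -> W) x v : smooth f x -> smooth ('D_v f) x.
Proof. by move=> sf k; have [_ D] := sf k.+1; exact: D. Qed.

Lemma near_smooth (f : V -> W) x (P : set W) :
  smooth f x -> (\forall y \near f x, P y) -> \forall w \near x, P (f w).
Proof.
move=> sf; have [df _] := sf 1%N.
exact: (differentiable_continuous (nbhs_singleton df)).
Qed.

Lemma smooth_near_differentiable (f : V -> W) x :
  smooth f x -> \forall y \near x, differentiable f y.
Proof. by move=> sf; case: (sf 1). Qed.

Lemma smooth_differentiable (f : V -> W) x : smooth f x -> differentiable f x.
Proof. by move=> sf; exact: nbhs_singleton (smooth_near_differentiable sf). Qed.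

Lemma smooth_continuous (f : V -> W) x : smooth f x -> {for x, continuous f}.
Proof. by move/smooth_differentiable/differentiable_continuous. Qed.

Lemma ndiff_cst k (w : W) x : ndiff k (fun _ : V => w) x.
Proof.
elim: k w => [|k IH] w /=; first by near=> y; exact: cvg_cst.
split; first by near=> y; exact: differentiable_cst.
move=> v; rewrite (_ : 'D_v _ = fun=> 0); first exact: IH.
by apply/funext => y; rewrite derive_cst.
Unshelve. all: by end_near. Qed.

Lemma ndiff_lin k (L : {linear V -> W}) x : continuous L -> ndiff k L x.
Proof.
move=> cL; case: k => [|k] /=; first by near=> y; exact: cL.
split; first by near=> y; exact: linear_differentiable.
move=> v; rewrite (_ : 'D_v _ = fun=> L v); first exact: ndiff_cst.
by apply/funext => y; rewrite derive_lin.
Unshelve. all: by end_near. Qed.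

Lemma ndiffD k (f g : V -> W) x : ndiff k f x -> ndiff k g x -> ndiff k (fun y => f y + g y) x.
Proof.
elim: k f g => [|k IH] f g /=.
  by apply: filterS2 => y cf cg; apply: cvgD.
move=> [df Df] [dg Dg]; split.
  by apply: filterS2 df dg => y dfy dgy; apply: differentiableD.
move=> v; apply: ndiff_near_eq (IH _ _ (Df v) (Dg v)).
apply: filterS2 df dg => y dfy dgy.
by rewrite deriveD//; exact: diff_derivable.
Qed.

Lemma ndiff_sum k (I : Type) (s : seq I) (f : I -> V -> W) x :
  (forall i, ndiff k (f i) x) -> ndiff k (fun y => \sum_(i <- s) f i y) x.
Proof.
move=> H; elim: s => [|i s IH].
  rewrite (_ : (fun y => _) = fun=> 0); first exact: ndiff_cst.
  by apply/funext => y; rewrite big_nil.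
rewrite (_ : (fun y => _) = (fun y => f i y + \sum_(i <- s) f i y)).
  exact: ndiffD.
by apply/funext => y; rewrite big_cons.
Qed.

End Basic.

Section Products.
Context {V W : normedModType R} {fW : fin_coord W}.

Lemma ndiff_scale k (a : V -> R) (f : V -> W) x :
  ndiff k a x -> ndiff k f x -> ndiff k (fun y => a y *: f y) x.
Proof.
elim: k a f => [|k IH] a f /=.
  by apply: filterS2 => y ca cf; apply: cvgZ.
move=> [da Da] [df Df]; split.
  by apply: filterS2 da df => y; exact: differentiable_scale.
move=> v; have ka : ndiff k a x by apply: ndiffS; split.
have kf : ndiff k f x by apply: ndiffS; split.
apply: ndiff_near_eq (ndiffD (IH _ _ (Da v) kf) (IH _ _ ka (Df v))).
by apply: filterS2 da df => y day dfy; rewrite derive_scale.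
Qed.

Lemma ndiff_lin_comp {U : normedModType R} k (L : {linear W -> U}) (f : V -> W) x :
  continuous L -> ndiff k f x -> ndiff k (fun y => L (f y)) x.
Proof.
move=> cL; elim: k f => [|k IH] f /=.
  by apply: filterS => y cf; apply: continuous_comp => //; exact: cL.
move=> [df Df]; split.
  apply: filterS df => y dfy; apply: (@differentiable_comp _ _ _ _ f L) => //.
  exact: linear_differentiable.
move=> v; apply: ndiff_near_eq (IH _ (Df v)).
by apply: filterS df => y dfy; rewrite derive_comp_lin//; exact: diff_derivable.
Qed.

End Products.

Section Comp.
Context {U V W : normedModType R} {fV : fin_coord V} {fW : fin_coord W}.

(** By the chain rule the derivative of [g \o f] is a sum over coordinates of
    products of a derivative of [f] with the composite of [f] and a derivative
    of [g]; the induction hypothesis applies to these composites. *)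
Lemma ndiff_comp k (f : U -> V) (g : V -> W) x :
  ndiff k f x -> ndiff k g (f x) -> ndiff k (g \o f) x.
Proof.
elim: k f g => [|k IH] f g /=.
  move=> cf cg; have cf' := nbhs_singleton cf.
  move/cf' : cg => cg; apply: filterS2 cf cg => y cfy cgy.
  exact: continuous_comp.
move=> kf kg; have kf' : ndiff k f x by apply: ndiffS.
move: kf kg => [df Df] [dg Dg].
have cf := differentiable_continuous (nbhs_singleton df).
move/cf : dg => dg; split.
  by apply: filterS2 df dg => y dfy dgy; exact: differentiable_comp.
move=> v.
apply: (@ndiff_near_eq _ _ k (fun y => \sum_(i <- index_enum (fc_idx V))
    fc_coef i ('D_v f y) *: ('D_(fc_vec i) g \o f) y)).
  apply: filterS2 df dg => y dfy dgy.
  by rewrite derive_comp// [RHS]derive_fc.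
apply: ndiff_sum => i; apply: ndiff_scale; last exact: IH.
by apply: ndiff_lin_comp (Df v); exact: fc_continuous.
Qed.

Lemma smooth_comp (f : U -> V) (g : V -> W) x :
  smooth f x -> smooth g (f x) -> smooth (g \o f) x.
Proof. by move=> sf sg k; exact: ndiff_comp. Qed.

End Comp.

Section Rules.
Context {U V W : normedModType R}.

Lemma ndiff_pair k (f : U -> V) (g : U -> W) x :
  ndiff k f x -> ndiff k g x -> ndiff k (fun y => (f y, g y)) x.
Proof.
elim: k f g => [|k IH] f g /=.
  by apply: filterS2 => y cf cg; apply: cvg_pair.
move=> [df Df] [dg Dg]; split.
  by apply: filterS2 df dg => y; exact: differentiable_pair.
move=> v; apply: ndiff_near_eq (IH _ _ (Df v) (Dg v)).
by apply: filterS2 df dg => y dfy dgy; rewrite derive_pair.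
Qed.

Lemma smooth_pair (f : U -> V) (g : U -> W) x :
  smooth f x -> smooth g x -> smooth (fun y => (f y, g y)) x.
Proof. by move=> sf sg k; exact: ndiff_pair. Qed.

Lemma smooth_cst (w : W) x : smooth (fun _ : V => w) x.
Proof. by move=> k; exact: ndiff_cst. Qed.

Lemma smooth_id (x : U) : smooth (fun y : U => y) x.
Proof. by move=> k; apply: (@ndiff_lin _ _ k idfun) => y; exact: cvg_id. Qed.

Lemma smooth_fst (x : U * V) : smooth (fun p : U * V => p.1) x.
Proof. by move=> k; apply: (@ndiff_lin _ _ k (@fst U V)) => y; exact: cvg_fst. Qed.

Lemma smooth_snd (x : U * V) : smooth (fun p : U * V => p.2) x.
Proof. by move=> k; apply: (@ndiff_lin _ _ k (@snd U V)) => y; exact: cvg_snd. Qed.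

Lemma smoothD (f g : V -> W) x : smooth f x -> smooth g x -> smooth (fun y => f y + g y) x.
Proof. by move=> sf sg k; exact: ndiffD. Qed.

Lemma smooth_lin_comp (L : {linear V -> W}) (f : U -> V) x :
  continuous L -> smooth f x -> smooth (fun y => L (f y)) x.
Proof. by move=> cL sf k; exact: ndiff_lin_comp. Qed.

Lemma smooth_scale {fW : fin_coord W} (a : V -> R) (f : V -> W) x :
  smooth a x -> smooth f x -> smooth (fun y => a y *: f y) x.
Proof. by move=> sf sg k; exact: ndiff_scale. Qed.

End Rules.

End Smoothness.

Section SmoothOn.
Context {R : realType} {V W : normedModType R}.

Lemma iter_derive_rcons vs v (f : V -> W) :
  iter_derive (rcons vs v) f = iter_derive vs ('D_v f).
Proof. by rewrite /iter_derive foldr_rcons. Qed.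

Lemma smooth_on_derive (U : set V) (f : V -> W) v :
  smooth_on U f -> smooth_on U ('D_v f).
Proof. by move=> sf vs x Ux; rewrite -iter_derive_rcons; exact: sf. Qed.

(** On an open set the partial derivatives of each coordinate exist and are
    continuous, hence [differentiable_partials] applies; the same holds for the
    derivatives of all orders. *)
Lemma smooth_on_smooth {fV : fin_coord V} {fW : fin_coord W} (U : set V) (f : V -> W) x :
  smooth_on U f -> nbhs x U -> smooth f x.
Proof.
move=> sf Ux k; elim: k f sf => [|k IH] f sf /=.
  by apply: filterS Ux => y Uy; case: (sf [::] y Uy).
split; last by move=> v; apply: IH; exact: smooth_on_derive.
have : \near x, nbhs x U by exact/near_join.
apply: filterS => y Uy; apply: differentiable_coefP => j.
have df v z : U z -> derivable f z v by move=> Uz; case: (sf [::] z Uz).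
have cL := @fc_continuous _ _ fW j.
have E v z : U z -> 'D_v (fc_coef j \o f) z = fc_coef j ('D_v f z).
  by move=> Uz; rewrite -derive_comp_lin//; exact: df.
apply: differentiable_partials => i.
  by apply: filterS Uy => z Uz; apply: derivable_comp_lin => //; exact: df.
have cD : {for y, continuous (fun z => fc_coef j ('D_(fc_vec i) f z))}.
  apply: continuous_comp; last exact: cL.
  by case: (sf [:: fc_vec i] y (nbhs_singleton Uy)).
change ('D_(fc_vec i) (fc_coef j \o f) @ y --> 'D_(fc_vec i) (fc_coef j \o f) y).
rewrite (E _ _ (nbhs_singleton Uy)); apply: cvg_trans cD.
by apply: near_eq_cvg; apply: filterS Uy => z Uz; rewrite E.
Qed.

Lemma smooth_iter_derive (f : V -> W) vs x : smooth f x -> smooth (iter_derive vs f) x.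
Proof. by move=> sf; elim: vs => // v vs IH; apply: smooth_derive. Qed.

Lemma smooth_smooth_on (U : set V) (f : V -> W) :
  (forall x, U x -> smooth f x) -> smooth_on U f.
Proof.
move=> sf vs x Ux; have /(smooth_iter_derive vs) s := sf x Ux.
by split; [exact: smooth_continuous | move=> v; exact/diff_derivable/smooth_differentiable].
Qed.

End SmoothOn.

Lemma smoothP {R : realType} {V W : normedModType R} (f : V -> W) x :
  smooth f x <-> forall k, ndiff k f x.
Proof. by []. Qed.

#[global] Opaque smooth.

(** * Second-order calculus *)

Section Schwarz.
Context {R : realType} {V : normedModType R}.

Lemma growth_shiftE (f : V -> R) z v w :
  (fun h : R => h^-1 *: (((fun z => f (z + w)) \o shift z) (h *: v) - f (z + w))) =
  (fun h : R => h^-1 *: ((f \o shift (z + w)) (h *: v) - f (z + w))).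
Proof. by apply/funext => h /=; rewrite addrA. Qed.

(** The mean value theorem, applied along [v] and then along [u], evaluates the
    second difference. *)
Lemma schwarz_growth (f : V -> R) x u v :
  (\forall y \near x, derivable f y v) ->
  (\forall y \near x, derivable ('D_v f) y u) ->
  {for x, continuous ('D_u ('D_v f))} ->
  forall e : R, 0 < e -> \forall h \near 0^'+,
    `|f (x + h *: u + h *: v) - f (x + h *: u) - f (x + h *: v) + f x
      - h ^+ 2 * 'D_u ('D_v f) x| <= e * h ^+ 2.
Proof.
set f1 := 'D_v f => df df1 cD e e0.
have : \forall y \near x, [/\ derivable f y v, derivable f1 y u &
    `|'D_u f1 x - 'D_u f1 y| <= e].
  have cle : \forall y \near x, `|'D_u f1 x - 'D_u f1 y| <= e.
    by move: e e0; apply/cvgrPdist_le; exact: cD.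
  by apply: filterS3 df df1 cle.
move=> /nbhs_ballP[r /= r0 Hr].
have uv1 : 0 < `|u| + `|v| + 1 by rewrite ltr_wpDl// addr_ge0.
near=> h.
have h0 : 0 < h by near: h; exact: nbhs_right_gt.
have hr : h * (`|u| + `|v| + 1) < r.
  by rewrite -ltr_pdivlMr//; near: h; apply: nbhs_right_lt; rewrite divr_gt0.
have B s t : s \in `[0, 1]%R -> t \in `[0, 1]%R -> ball x r (x + s *: (h *: u) + t *: (h *: v)).
  rewrite !in_itv /= => /andP[s0 s1] /andP[t0 t1]; rewrite -ball_normE /=.
  rewrite -addrA opprD addrA subrr sub0r normrN.
  rewrite (le_lt_trans (ler_normD _ _))// (le_lt_trans _ hr)//.
  rewrite !normrZ (ger0_norm s0) (ger0_norm t0) (gtr0_norm h0) !mulrDr mulr1.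
  apply: ler_wpDr; first exact: ltW.
  by rewrite lerD// ler_piMl// mulr_ge0// ltW.
have i0 : (0 : R) \in `[0, 1]%R by rewrite in_itv /= lexx ler01.
have i1 : (1 : R) \in `[0, 1]%R by rewrite in_itv /= lexx ler01.
have Bu t : t \in `[0, 1]%R -> ball x r (x + t *: (h *: v) + h *: u).
  by move=> t01; rewrite addrAC; have := B 1 t i1 t01; rewrite scale1r.
have B0 t : t \in `[0, 1]%R -> ball x r (x + t *: (h *: v)).
  by move=> t01; have := B 0 t i0 t01; rewrite scale0r addr0.
pose g z := f (z + h *: u) - f z.
have dg z : ball x r z -> ball x r (z + h *: u) ->
    is_derive z v g (f1 (z + h *: u) - f1 z).
  move=> /Hr[dz _ _] /Hr[dzu _ _].
  have d1 : derivable (fun z => f (z + h *: u)) z v.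
    by rewrite /derivable growth_shiftE.
  have e1 : 'D_v (fun z => f (z + h *: u)) z = 'D_v f (z + h *: u).
    by rewrite /derive growth_shiftE.
  split; first exact: derivableB.
  by rewrite /f1 -e1; exact: deriveB.
have [t t01 Eg] : exists2 t, t \in `[0, 1]%R & g (x + h *: v) - g x = 'D_(h *: v) g (x + t *: (h *: v)).
  apply: MVT_line => t t01.
  have [d1 _] := dg _ (B0 t t01) (Bu t t01).
  by have [] := is_derive_dirZ h d1.
have [d1 e1] := dg _ (B0 t t01) (Bu t t01).
have [_ e2] := is_derive_dirZ h d1.
have [s s01 Es] : exists2 s, s \in `[0, 1]%R &
    f1 (x + t *: (h *: v) + h *: u) - f1 (x + t *: (h *: v))
    = 'D_(h *: u) f1 (x + t *: (h *: v) + s *: (h *: u)).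
  apply: MVT_line => s s01; rewrite [X in derivable _ X _]addrAC.
  have [_ D _] := Hr _ (B s t s01 t01).
  by have [] := is_derive_dirZ h D.
have [_ D le] := Hr _ (B s t s01 t01).
have [_ e3] := is_derive_dirZ h D.
have Eg' : g (x + h *: v) - g x = h ^+ 2 * 'D_u f1 (x + s *: (h *: u) + t *: (h *: v)).
  rewrite Eg e2 e1 Es [x + _ + s *: _]addrAC e3 expr2 -mulrA.
  by [].
have -> : f (x + h *: u + h *: v) - f (x + h *: u) - f (x + h *: v) + f x =
    g (x + h *: v) - g x.
  by rewrite /g [x + h *: v + h *: u]addrAC; ring.
rewrite Eg' -mulrBr normrM ger0_norm ?sqr_ge0// [leRHS]mulrC.
by apply: ler_wpM2l; [exact: sqr_ge0 | rewrite distrC].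
Unshelve. all: by end_near. Qed.

(** Both sides are the limit of the second difference divided by [h ^+ 2], and
    the second difference is symmetric in [u] and [v]. *)
Lemma schwarz_scalar (f : V -> R) x u v : smooth f x -> 'D_u ('D_v f) x = 'D_v ('D_u f) x.
Proof.
move=> sf; apply/eqP; rewrite -subr_eq0 -normr_le0; apply/ler_addgt0Pl => e e0.
rewrite addr0.
have e20 : 0 < e / 2 by rewrite divr_gt0.
have H w w' : \forall h \near 0^'+,
    `|f (x + h *: w + h *: w') - f (x + h *: w) - f (x + h *: w') + f x
      - h ^+ 2 * 'D_w ('D_w' f) x| <= e / 2 * h ^+ 2.
  apply: schwarz_growth e20.
  - by apply: filterS (smooth_near_differentiable sf) => y /diff_derivable.
  - apply: filterS (smooth_near_differentiable (smooth_derive w' sf)) => y dy.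
    exact: diff_derivable.
  - exact: (smooth_continuous (smooth_derive w (smooth_derive w' sf))).
have [h [h0 [H1 H2]]] := filter_ex (filterI (nbhs_right_gt (0 : R)) (filterI (H u v) (H v u))).
have h20 : 0 < h ^+ 2 by rewrite exprn_gt0.
rewrite -(ler_pM2r h20).
have -> : e * h ^+ 2 = e / 2 * h ^+ 2 + e / 2 * h ^+ 2 by field.
apply: le_trans (lerD H2 H1).
rewrite -[X in _ * X](gtr0_norm h20) -normrM.
apply: le_trans (ler_normB _ _); rewrite le_eqVlt; apply/orP; left; apply/eqP.
rewrite [x + h *: v + h *: u]addrAC; congr (`| _ |).
move: (f _) (f _) (f _) (f x) ('D_u _ _) ('D_v _ _) => a1 a2 a3 a4 a5 a6.
by ring.
Qed.

Lemma schwarz {W : normedModType R} {fW : fin_coord W} (f : V -> W) x u v :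
  smooth f x -> 'D_u ('D_v f) x = 'D_v ('D_u f) x.
Proof.
move=> sf; apply: fc_inj => j.
have cL := @fc_continuous _ _ fW j.
have E w w' : fc_coef j ('D_w ('D_w' f) x) = 'D_w ('D_w' (fun y => fc_coef j (f y))) x.
  rewrite -derive_comp_lin//; last first.
    exact/diff_derivable/smooth_differentiable/smooth_derive.
  apply: near_eq_derive; apply: filterS (smooth_near_differentiable sf) => y dy.
  by rewrite derive_comp_lin//; exact: diff_derivable.
by rewrite !E schwarz_scalar//; exact: smooth_lin_comp.
Qed.

End Schwarz.

Section SecondOrder.
Context {R : realType} {V : normedModType R} {fV : fin_coord V}.

Lemma differentiable_lip {W : normedModType R} (f : V -> W) x : differentiable f x ->
  exists2 C : R, 0 < C & \forall y \near x, `|f y - f x| <= C * `|y - x|.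
Proof.
move=> df; have [k k0 Hk] := linear_lipschitz (diff_continuous df).
exists (1 + k); first by rewrite addr_gt0.
have := differentiable_elim df ltr01.
rewrite [X in _ -> X](near_shift 0) /=; apply: filterS => h /=; rewrite subr0 mul1r => Hh.
rewrite addrK mulrDl mul1r -[X in `|X|](subrK ('d f x h)).
by apply: le_trans (ler_normD _ _) _; apply: lerD.
Qed.

(** The mean value theorem between [z] and [y], together with the fact that the
    partial derivatives are Lipschitz at [x]. *)
Lemma taylor1_scalar (f : V -> R) x : smooth f x ->
  exists2 C : R, 0 < C & exists2 r : R, 0 < r & forall y z m, m < r ->
    `|y - x| <= m -> `|z - x| <= m ->
    `|f y - f z - 'D_(y - z) f x| <= C * m * `|y - z|.
Proof.
move=> sf.
have Hi (i : fc_idx V) : exists C : R, 0 < C /\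
    \forall y \near x, `|'D_(fc_vec i) f y - 'D_(fc_vec i) f x| <= C * `|y - x|.
  have [C C0 HC] := differentiable_lip (smooth_differentiable (smooth_derive (fc_vec i) sf)).
  by exists C.
have [c Hc] := choice Hi.
have [K K0 HK] := coef_bound (V := V).
have : \forall y \near x, differentiable f y /\ forall i : fc_idx V,
    `|'D_(fc_vec i) f y - 'D_(fc_vec i) f x| <= c i * `|y - x|.
  apply: filterI; first exact: smooth_near_differentiable.
  by apply: filter_forall => i; case: (Hc i).
move=> /nbhs_ballP[r /= r0 Hr].
pose C := 1 + \sum_i c i.
have ciC i : c i <= C.
  rewrite /C (bigD1 i)//= addrCA lerDl addr_ge0// sumr_ge0// => j _.
  by case: (Hc j) => /ltW.
have C0 : 0 < C.
  by rewrite ltr_wpDr// sumr_ge0// => j _; case: (Hc j) => /ltW.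
exists (C * K); first exact: mulr_gt0.
exists r => // y z m mr ym zm.
have m0 : 0 <= m by apply: le_trans ym.
have xi_m t : t \in `[0, 1]%R -> `|z + t *: (y - z) - x| <= m.
  rewrite in_itv /= => /andP[t0 t1].
  rewrite (_ : z + _ - x = (1 - t) *: (z - x) + t *: (y - x)); last first.
    rewrite scalerBl scale1r -[RHS]addrA [- _ + _]addrC -scalerBr opprB.
    by rewrite addrA subrK addrAC.
  apply: le_trans (ler_normD _ _) _; rewrite !normrZ (ger0_norm t0) ger0_norm ?subr_ge0//.
  apply: (@le_trans _ _ ((1 - t) * m + t * m)); last by rewrite -mulrDl subrK mul1r.
  by apply: lerD; apply: ler_wpM2l; rewrite ?subr_ge0.
have xi_r t : t \in `[0, 1]%R -> ball x r (z + t *: (y - z)).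
  by move=> /xi_m H; rewrite -ball_normE /= distrC; apply: le_lt_trans H mr.
have [t t01] : exists2 t, t \in `[0, 1]%R & f (z + (y - z)) - f z = 'D_(y - z) f (z + t *: (y - z)).
  by apply: MVT_line => t t01; have [/diff_derivable d _] := Hr _ (xi_r t t01).
rewrite [z + (y - z)]addrC subrK => ->.
have [dxi Hxi] := Hr _ (xi_r t t01).
have dx := smooth_differentiable sf.
rewrite (derive_fc _ dxi) (derive_fc _ dx) -sumrB.
apply: le_trans (ler_norm_sum _ _ _) _.
apply: (@le_trans _ _ (\sum_i `|fc_coef i (y - z)| * (C * m))).
  apply: ler_sum => i _; rewrite -scalerBr normrZ.
  apply: ler_wpM2l => //; apply: le_trans (Hxi i) _.
  by apply: ler_pM => //; [case: (Hc i) => /ltW | exact: xi_m].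
rewrite -mulr_suml mulrC.
have -> : C * K * m * `|y - z| = C * m * (K * `|y - z|) by ring.
by apply: ler_wpM2l; rewrite ?mulr_ge0// ltW.
Qed.

(** The error is controlled by the distance from [y] to [z], not only by their
    distances to [x].  This is what makes the iteration of squaring in a group
    tractable. *)
Lemma taylor1 {W : normedModType R} {fW : fin_coord W} (f : V -> W) x : smooth f x ->
  exists2 C : R, 0 < C & exists2 r : R, 0 < r & forall y z m, m < r ->
    `|y - x| <= m -> `|z - x| <= m ->
    `|f y - f z - 'D_(y - z) f x| <= C * m * `|y - z|.
Proof.
move=> sf.
have Hj (j : fc_idx W) : exists Cr : R * R, [/\ 0 < Cr.1, 0 < Cr.2 &
    forall y z m, m < Cr.2 -> `|y - x| <= m -> `|z - x| <= m ->
    `|fc_coef j (f y - f z - 'D_(y - z) f x)| <= Cr.1 * m * `|y - z|].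
  have [|C C0 [r r0 H]] := @taylor1_scalar (fun y => fc_coef j (f y)) x.
    by apply: smooth_lin_comp => //; exact: fc_continuous.
  exists (C, r); split=> //= y z m mr ym zm; rewrite !linearB.
  have -> : fc_coef j ('D_(y - z) f x) = 'D_(y - z) (fun y => fc_coef j (f y)) x.
    rewrite derive_comp_lin//; first exact: fc_continuous.
    exact/diff_derivable/smooth_differentiable.
  exact: H.
have [Cr HCr] := choice Hj.
pose C := 1 + \sum_j (Cr j).1 * `|fc_vec j : W|.
pose r := \big[Num.min/1]_j (Cr j).2.
exists C; first by rewrite ltr_wpDr// sumr_ge0// => j _; rewrite mulr_ge0//; case: (HCr j) => /ltW.
exists r.
  by rewrite /r; apply: lt_bigmin => // j _; case: (HCr j).
move=> y z m mr ym zm; rewrite -[X in `|X|]fc_sum.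
have m0 : 0 <= m by apply: le_trans ym.
apply: le_trans (ler_norm_sum _ _ _) _.
apply: (@le_trans _ _ (\sum_j (Cr j).1 * `|fc_vec j : W| * (m * `|y - z|))).
  apply: ler_sum => j _; rewrite normrZ mulrAC mulrA.
  apply: ler_wpM2r => //; case: (HCr j) => _ _; apply=> //.
  by apply: lt_le_trans mr _; exact: bigmin_le.
rewrite -mulr_suml -mulrA; apply: ler_wpM2r; first exact: mulr_ge0.
by rewrite lerDr.
Qed.

End SecondOrder.

(** * Derivatives on products and in moving directions *)

Section ProductDerivatives.
Context {R : realType} {U V W : normedModType R}.

Lemma derive_fst (f : U * V -> W) x y u :
  'D_(u, 0) f (x, y) = 'D_u (fun p => f (p, y)) x.
Proof.
have E (h : R) : h *: ((u, 0) : U * V) + (x, y) = (h *: u + x, y).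
  by rewrite -[LHS]/(_, _) /= scaler0 add0r.
by rewrite /derive /=; under eq_fun do rewrite E.
Qed.

Lemma derive_snd (f : U * V -> W) x y v :
  'D_(0, v) f (x, y) = 'D_v (fun p => f (x, p)) y.
Proof.
have E (h : R) : h *: ((0, v) : U * V) + (x, y) = (x, h *: v + y).
  by rewrite -[LHS]/(_, _) /= scaler0 add0r.
by rewrite /derive /=; under eq_fun do rewrite E.
Qed.

Lemma derive_proj1 (q w : U * V) : 'D_w (fun p => p.1) q = w.1.
Proof. by rewrite (derive_lin (L := @fst U V))// => y; exact: cvg_fst. Qed.

Lemma is_derive_bigsum (T : normedModType R) (I : Type) (s : seq I) (F : I -> T -> W) x u :
  (forall i, derivable (F i) x u) ->
  is_derive x u (fun q => \sum_(i <- s) F i q) (\sum_(i <- s) 'D_u (F i) x).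
Proof.
move=> dF; elim: s => [|i s IH].
  rewrite big_nil (_ : (fun q => _) = cst 0); first exact: is_derive_cst.
  by apply/funext => q; rewrite big_nil.
rewrite big_cons (_ : (fun q => _) = F i + (fun q => \sum_(i <- s) F i q)); last first.
  by apply/funext => q; rewrite big_cons.
by apply: is_deriveD; apply/derivableP.
Qed.

(** A product rule: in coordinates, ['D_(a q) f (b q)] is the sum of the
    products of the coordinates of [a q] with the partial derivatives of [f] at
    [b q]. *)
Lemma derive_moving {fV : fin_coord V} {fW : fin_coord W}
    (f : V -> W) (a b : U -> V) x u :
  smooth a x -> smooth b x -> smooth f (b x) ->
  'D_u (fun q => 'D_(a q) f (b q)) x =
    'D_('D_u a x) f (b x) + 'D_('D_u b x) ('D_(a x) f) (b x).
Proof.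
move=> sa sb sf.
have nd : \near x, differentiable f (b x).
  exact: (smooth_continuous sb) (smooth_near_differentiable sf).
rewrite (@near_eq_derive _ _ _ _ (fun q => \sum_i fc_coef i (a q) *: 'D_(fc_vec i) f (b q))); last first.
  by apply: filterS nd => q dq; rewrite derive_fc.
have dfb i : differentiable ('D_(fc_vec i) f) (b x).
  exact/smooth_differentiable/smooth_derive.
have dDb i : differentiable (fun q => 'D_(fc_vec i) f (b q)) x.
  exact: (differentiable_comp (smooth_differentiable sb) (dfb i)).
have dca i : differentiable (fun q => fc_coef i (a q)) x.
  exact/differentiable_coef/smooth_differentiable.
have [_ ->] := is_derive_bigsum (index_enum (fc_idx V))
  (fun i => diff_derivable (v := u) (differentiable_scale (dca i) (dDb i))).
under eq_bigr do rewrite derive_scale//.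
rewrite big_split /= [X in _ = X + _]derive_fc; last exact: smooth_differentiable.
congr (_ + _).
  apply: eq_bigr => i _; congr (_ *: _).
  apply: derive_comp_lin; first exact: fc_continuous.
  exact/diff_derivable/smooth_differentiable.
transitivity ('D_('D_u b x) (fun q => \sum_i fc_coef i (a x) *: 'D_(fc_vec i) f q) (b x)); last first.
  apply: near_eq_derive; apply: filterS (smooth_near_differentiable sf) => q dq.
  by rewrite derive_fc.
have dZ i : derivable (fun q => fc_coef i (a x) *: 'D_(fc_vec i) f q) (b x) ('D_u b x).
  exact/derivableZ/diff_derivable.
have [_ ->] := is_derive_bigsum (index_enum (fc_idx V)) dZ.
apply: eq_bigr => i _; rewrite deriveZ; last exact: diff_derivable.
by rewrite -derive_comp//; exact: smooth_differentiable.
Qed.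

End ProductDerivatives.

Section Diagonal.
Context {R : realType} {V : normedModType R}.

Lemma smooth_diagonal (u : V) : smooth (fun u : V => (u, u)) u.
Proof. by apply: smooth_pair; exact: smooth_id. Qed.

Lemma derive_diagonal (u w : V) : 'D_w (fun u : V => (u, u)) u = (w, w).
Proof.
have di := smooth_differentiable (smooth_id u).
apply: (etrans (derive_pair w di di)).
exact: (f_equal2 pair (derive_id u w) (derive_id u w)).
Qed.

Lemma pair_split (a b : V) : (a, b) = (a, 0) + (0, b).
Proof. by rewrite (_ : (a, 0) + (0, b) = (a + 0, 0 + b))// addr0 add0r. Qed.

End Diagonal.

(* Unification would otherwise unfold derivatives to the limits that define
   them whenever two directions or two base points have to be compared. *)
#[global] Opaque derive.

(** * Smooth maps into a Lie group *)

Section Charts.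
Context {R : realType} {n : nat} (G : lieGroupType R n).
Implicit Types (c a b : chart R n G) (x y g : G).

Lemma nbhs_cdom c x : cdom c x -> nbhs x (cdom c).
Proof. by move=> cx; apply: open_nbhs_nbhs; split => //; exact: open_cdom. Qed.

Lemma nbhs_cimg c x : cdom c x -> nbhs (cmap c x) (cmap c @` cdom c).
Proof. by move=> cx; apply: open_nbhs_nbhs; split; [exact: open_cimg | exists x]. Qed.

Lemma cinvK c u : (cmap c @` cdom c) u -> cmap c (cinv c u) = u.
Proof. by case=> x cx <-; rewrite cmapK. Qed.

Lemma cdom_cinv c u : (cmap c @` cdom c) u -> cdom c (cinv c u).
Proof. by case=> x cx <-; rewrite cmapK. Qed.

Lemma continuous_mulg {T : topologicalType} (f h : T -> G) (t : T) :
  {for t, continuous f} -> {for t, continuous h} ->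
  {for t, continuous (fun w => f w * h w)%g}.
Proof.
move=> cf ch.
apply: (@cvg_comp _ _ _ (fun w => (f w, h w)) (fun p => (p.1 * p.2)%g) _ (nbhs (f t, h t))).
  exact: cvg_pair cf ch.
exact: (@mulg_continuous R n G (f t, h t)).
Qed.

(** All charts around [f v] are considered, so that products and inverses of
    group-valued maps can be formed at any point without choosing a chart. *)
Definition gsmooth {V : normedModType R} (f : V -> G) v :=
  {for v, continuous f} /\
  forall c, atlas c -> cdom c (f v) -> smooth (fun w => cmap c (f w)) v.

Section Gsmooth.
Context {U V : normedModType R}.
Implicit Types (f h : V -> G) (v : V).

Lemma gsmooth_near f v A : gsmooth f v -> nbhs (f v) A -> \forall w \near v, A (f w).
Proof. by case=> cf _ fA; exact: cf. Qed.

Lemma gsmooth_cst g v : gsmooth (fun=> g) v.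
Proof. by split => [|c _ _]; [exact: cvg_cst | exact: smooth_cst]. Qed.

Lemma gsmooth_mulg f h v : gsmooth f v -> gsmooth h v -> gsmooth (fun w => f w * h w)%g v.
Proof.
move=> sf sh; split.
  by apply: continuous_mulg; [case: sf | case: sh].
move=> c Ac cfh.
have [a Aa afv] := atlas_cover (f v); have [b Ab bhv] := atlas_cover (h v).
have sm : smooth (fun p => cmap c (cinv a p.1 * cinv b p.2)%g) (cmap a (f v), cmap b (h v)).
  apply: smooth_on_smooth (mulg_smooth _ _ _ Aa Ab Ac) _.
  have n1 : \forall p \near (cmap a (f v), cmap b (h v)), (cmap a @` cdom a) p.1.
    by apply: cvg_fst; exact: nbhs_cimg.
  have n2 : \forall p \near (cmap a (f v), cmap b (h v)), (cmap b @` cdom b) p.2.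
    by apply: cvg_snd; exact: nbhs_cimg.
  have n3 : \forall p \near (cmap a (f v), cmap b (h v)), cdom c (cinv a p.1 * cinv b p.2)%g.
    suff cc : {for (cmap a (f v), cmap b (h v)), continuous (fun p => (cinv a p.1 * cinv b p.2)%g)}.
      by apply: cc; apply: nbhs_cdom; rewrite /= !cmapK.
    apply: (@cvg_comp _ _ _ (fun p => (cinv a p.1, cinv b p.2)) (fun p => (p.1 * p.2)%g) _
       (nbhs (cinv a (cmap a (f v)), cinv b (cmap b (h v))))).
      apply: cvg_pair.
        apply: (@cvg_comp _ _ _ (fun p => p.1) (cinv a) _ (nbhs (cmap a (f v)))); first exact: cvg_fst.
        by apply: continuous_cinv; exists (f v).
      apply: (@cvg_comp _ _ _ (fun p => p.2) (cinv b) _ (nbhs (cmap b (h v)))); first exact: cvg_snd.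
      by apply: continuous_cinv; exists (h v).
    exact: (@mulg_continuous R n G (_, _)).
  by apply: filterS3 n1 n2 n3 => p.
apply: smooth_near_eq (smooth_comp (smooth_pair (sf.2 a Aa afv) (sh.2 b Ab bhv)) sm).
have nf := gsmooth_near sf (nbhs_cdom afv).
have nh := gsmooth_near sh (nbhs_cdom bhv).
by apply: filterS2 nf nh => w fw hw /=; rewrite !cmapK.
Qed.

Lemma gsmooth_invg f v : gsmooth f v -> gsmooth (fun w => (f w)^-1)%g v.
Proof.
move=> sf; split.
  by apply: continuous_comp; [case: sf | exact: (@invg_continuous R n G (f v))].
move=> c Ac cf.
have [a Aa afv] := atlas_cover (f v).
have sm : smooth (fun p => cmap c (cinv a p)^-1%g) (cmap a (f v)).
  apply: smooth_on_smooth (invg_smooth _ _ Aa Ac) _.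
  have n1 := nbhs_cimg afv.
  have n3 : \forall p \near cmap a (f v), cdom c (cinv a p)^-1%g.
    suff cc : {for cmap a (f v), continuous (fun p => (cinv a p)^-1%g)}.
      by apply: cc; apply: nbhs_cdom; rewrite /= cmapK.
    apply: continuous_comp; last exact: (@invg_continuous R n G _).
    by apply: continuous_cinv; exists (f v).
  by apply: filterS2 n1 n3 => p.
apply: smooth_near_eq (smooth_comp (sf.2 a Aa afv) sm).
have nf := gsmooth_near sf (nbhs_cdom afv).
by apply: filterS nf => w fw /=; rewrite !cmapK.
Qed.

Lemma gsmooth_comp {fV : fin_coord V} (h : U -> V) f (x : U) : smooth h x -> gsmooth f (h x) -> gsmooth (fun w => f (h w)) x.
Proof.
move=> sh [cf sf]; split.
  by apply: continuous_comp => //; exact: smooth_continuous.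
by move=> c Ac cx; exact: (smooth_comp sh (sf c Ac cx)).
Qed.

Lemma gsmooth_near_eq f h v : {near v, f =1 h} -> gsmooth f v -> gsmooth h v.
Proof.
move=> fh [cf sf]; have E := nbhs_singleton fh; split.
  change (h @ v --> h v); rewrite -E.
  by apply: cvg_trans cf; exact: near_eq_cvg.
move=> c Ac; rewrite -E => /(sf c Ac); apply: smooth_near_eq.
by apply: filterS fh => w ->.
Qed.

End Gsmooth.

Lemma gsmooth_cinv c u : atlas c -> (cmap c @` cdom c) u -> gsmooth (cinv c) u.
Proof.
move=> Ac cu; split; first exact: continuous_cinv.
move=> c' Ac' c'u; apply: smooth_on_smooth (transition_smooth _ _ Ac Ac') _.
have n1 : \forall w \near u, (cmap c @` cdom c) w.
  by case: cu => x cx <-; exact: nbhs_cimg.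
have n2 : \forall w \near u, cdom c' (cinv c w).
  by apply: (continuous_cinv cu); exact: nbhs_cdom.
apply: filterS2 n1 n2 => w cw c'w; exists (cinv c w); last exact: cinvK.
by split => //; exact: cdom_cinv.
Qed.

End Charts.

(** * The adjoint action *)

Section AdjointAction.
Context {R : realType} {n : nat} (G : lieGroupType R n).
Implicit Types (x y g h : G) (X Y Z : 'rV[R]_n).
Local Notation c1 := (chart1 : chart R n G).
Local Notation phi := (cmap c1).
Local Notation psi := (cinv c1).
Local Notation e := (phi 1%g).

Lemma psi1 : psi e = 1%g. Proof. by rewrite cmapK//; exact: chart1_unit. Qed.

Lemma phiK x : cdom c1 x -> psi (phi x) = x. Proof. exact: cmapK. Qed.

Lemma nbhs1_cdom : nbhs 1%g (cdom c1). Proof. exact/nbhs_cdom/chart1_unit. Qed.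

Lemma near_psiK : \forall p \near e, phi (psi p) = p.
Proof. by apply: filterS (nbhs_cimg chart1_unit) => p; exact: cinvK. Qed.

Lemma gsmooth_psi : gsmooth psi e.
Proof. by apply: gsmooth_cinv; [exact: chart1_atlas | exists 1%g => //; exact: chart1_unit]. Qed.

Lemma gsmooth_phi {V : normedModType R} (f : V -> G) v :
  gsmooth f v -> f v = 1%g -> smooth (fun w => phi (f w)) v.
Proof. by move=> [_ sf] fv; apply: sf; [exact: chart1_atlas | rewrite fv; exact: chart1_unit]. Qed.

(** The group law read in the chart at the unit. *)
Definition mu (p : 'rV[R]_n * 'rV[R]_n) := phi (psi p.1 * psi p.2)%g.

Lemma gsmooth_psi_comp {V : normedModType R} (f : V -> 'rV[R]_n) v :
  smooth f v -> f v = e -> gsmooth (fun w => psi (f w)) v.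
Proof. by move=> sf fv; apply: gsmooth_comp sf _; rewrite fv; exact: gsmooth_psi. Qed.

Lemma gsmooth_psi_fst : gsmooth (fun p : 'rV[R]_n * 'rV[R]_n => psi p.1) (e, e).
Proof. exact: (@gsmooth_comp R n G _ _ _ fst psi (e, e) (smooth_fst _) gsmooth_psi). Qed.

Lemma gsmooth_psi_snd : gsmooth (fun p : 'rV[R]_n * 'rV[R]_n => psi p.2) (e, e).
Proof. exact: (@gsmooth_comp R n G _ _ _ snd psi (e, e) (smooth_snd _) gsmooth_psi). Qed.

Lemma smooth_mu : smooth mu (e, e).
Proof.
apply: (gsmooth_phi (gsmooth_mulg gsmooth_psi_fst gsmooth_psi_snd)).
by rewrite /= psi1 mul1g.
Qed.

(** Conjugation of the second point by the first, read in the chart at the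
    unit: [Ad] is its derivative in the second argument. *)
Definition conj_mu (p : 'rV[R]_n * 'rV[R]_n) := phi (psi p.1 * psi p.2 * (psi p.1)^-1)%g.

Lemma gsmooth_conj_psi : gsmooth (fun p : 'rV[R]_n * 'rV[R]_n =>
  (psi p.1 * psi p.2 * (psi p.1)^-1)%g) (e, e).
Proof.
exact: (gsmooth_mulg (gsmooth_mulg gsmooth_psi_fst gsmooth_psi_snd)
  (gsmooth_invg gsmooth_psi_fst)).
Qed.

Lemma smooth_conj_mu : smooth conj_mu (e, e).
Proof.
by apply: (gsmooth_phi gsmooth_conj_psi); rewrite /= psi1 mul1g mulgV.
Qed.

Lemma gsmooth_conjg g : gsmooth (fun v => g * psi v * g^-1)%g e.
Proof.
exact: (gsmooth_mulg (gsmooth_mulg (gsmooth_cst g e) gsmooth_psi) (gsmooth_cst g^-1%g e)).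
Qed.

Lemma conjg_psi1 g : (g * psi e * g^-1)%g = 1%g.
Proof. by rewrite psi1 mulg1 mulgV. Qed.

Lemma smooth_conjg g : smooth (fun v => phi (g * psi v * g^-1)%g) e.
Proof. exact: (gsmooth_phi (gsmooth_conjg g) (conjg_psi1 g)). Qed.

Lemma Ad1 X : Ad (1%g : G) X = X.
Proof.
rewrite /Ad (@near_eq_derive _ _ _ _ id) ?derive_id//.
by apply: filterS near_psiK => p; rewrite mul1g invg1 mulg1.
Qed.

Lemma AdM g h X : Ad (g * h)%g X = Ad g (Ad h X).
Proof.
have E : phi (h * psi e * h^-1)%g = e by rewrite conjg_psi1.
have sg : smooth (fun v => phi (g * psi v * g^-1)%g) (phi (h * psi e * h^-1)%g).
  by rewrite E; exact: smooth_conjg.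
have := derive_comp X (smooth_differentiable (smooth_conjg h)) (smooth_differentiable sg).
rewrite E => EC; rewrite [RHS]/Ad [X in 'D_X _ _]/Ad -EC.
apply: near_eq_derive.
have nh : \forall v \near e, cdom c1 (h * psi v * h^-1)%g.
  apply: (gsmooth_near (gsmooth_conjg h)).
  by rewrite conjg_psi1; exact: nbhs1_cdom.
apply: filterS nh => v dv /=.
by rewrite phiK// invgM !mulgA.
Qed.

Lemma AdZ g (a : R) X : Ad g (a *: X) = a *: Ad g X.
Proof. by rewrite /Ad derive_dirZ//; exact/smooth_differentiable/smooth_conjg. Qed.

Lemma Ad_neq0 g X : X != 0 -> Ad g X != 0.
Proof.
apply: contra_neq => E.
by rewrite -[X]Ad1 -(mulVg g) AdM E /Ad derive0.
Qed.

Lemma Ad_psiE p X : Ad (psi p) X = 'D_(0, X) conj_mu (p, e).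
Proof. by rewrite derive_snd. Qed.

(** Near the unit [Ad g X] is a derivative of the smooth map [conj_mu]; the
    formula [Ad g X = Ad (g * g0^-1) (Ad g0 X)] carries continuity to [g0]. *)
Lemma continuous_Ad X : continuous (fun g : G => Ad g X).
Proof.
have c1X Y : {for 1%g, continuous (fun g : G => Ad g Y)}.
  have cD : {for 1%g, continuous (fun g : G => 'D_(0, Y) conj_mu (phi g, e))}.
    apply: (@cvg_comp _ _ _ (fun g => (phi g, e)) ('D_(0, Y) conj_mu) _ (nbhs (e, e))).
      exact: (cvg_pair (continuous_cmap chart1_unit) (cvg_cst e)).
    exact: (smooth_continuous (smooth_derive (0, Y) smooth_conj_mu)).
  change ((fun g : G => Ad g Y) @ (1%g : G) --> Ad (1%g : G) Y).
  have -> : Ad (1%g : G) Y = 'D_(0, Y) conj_mu (e, e) by rewrite -Ad_psiE psi1.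
  apply: cvg_trans cD; apply: near_eq_cvg.
  by apply: filterS nbhs1_cdom => g dg; rewrite -Ad_psiE phiK.
move=> g0.
have E : (fun g : G => Ad g X) = (fun g => Ad (g * g0^-1)%g (Ad g0 X)).
  by apply/funext => g; rewrite -AdM -mulgA mulVg mulg1.
rewrite E; apply: (@cvg_comp _ _ _ (fun g => g * g0^-1)%g (fun g => Ad g (Ad g0 X)) _ (nbhs 1%g)).
  rewrite -(mulgV g0).
  apply: (@cvg_comp _ _ _ (fun g => (g, g0^-1)%g) (fun p => (p.1 * p.2)%g) _ (nbhs (g0, g0^-1)%g)).
    exact: (cvg_pair cvg_id (cvg_cst _)).
  exact: (@mulg_continuous R n G (g0, g0^-1)%g).
by rewrite mulgV; exact: c1X.
Qed.

Lemma mu_l : \forall p \near e, mu (p, e) = p.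
Proof. by apply: filterS near_psiK => q; rewrite /mu /= psi1 mulg1. Qed.

Lemma mu_r : \forall p \near e, mu (e, p) = p.
Proof. by apply: filterS near_psiK => q; rewrite /mu /= psi1 mul1g. Qed.

Lemma derive_mu_l X : 'D_(X, 0) mu (e, e) = X.
Proof. by rewrite derive_fst (near_eq_derive _ mu_l) derive_id. Qed.

Lemma derive_mu_r X : 'D_(0, X) mu (e, e) = X.
Proof. by rewrite derive_snd (near_eq_derive _ mu_r) derive_id. Qed.

Lemma left_invariant_fieldE X u : left_invariant_field G X u = 'D_(0, X) mu (u, e).
Proof. by rewrite derive_snd. Qed.

Lemma lie_bracketE X Y : lie_bracket G X Y =
  'D_(X, 0) ('D_(0, Y) mu) (e, e) - 'D_(Y, 0) ('D_(0, X) mu) (e, e).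
Proof.
have E Z : left_invariant_field G Z = (fun u => 'D_(0, Z) mu (u, e)).
  by apply/funext => u; exact: left_invariant_fieldE.
have H Z T : 'D_Z (left_invariant_field G T) e = 'D_(Z, 0) ('D_(0, T) mu) (e, e).
  by rewrite E; exact: esym (derive_fst _ _ _ _).
by rewrite /lie_bracket !H.
Qed.

Lemma conj_mu1 p : conj_mu (p, e) = e.
Proof. by rewrite /conj_mu /= psi1 mulg1 mulgV. Qed.

Lemma conj_mu_1 : conj_mu (e, e) = e. Proof. exact: conj_mu1. Qed.

Lemma mu_conj_mu : {near (e, e), (fun q => mu (conj_mu q, q.1)) =1 mu}.
Proof.
have : \forall p \near (e, e), cdom c1 (psi p.1 * psi p.2 * (psi p.1)^-1)%g.
  apply: (gsmooth_near gsmooth_conj_psi).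
  by rewrite /= psi1 mul1g mulgV; exact: nbhs1_cdom.
apply: filterS => q dq.
by rewrite /mu /= /conj_mu phiK// -mulgA mulVg mulg1.
Qed.

Opaque mu conj_mu.

Lemma derive_Ad_conj_mu Z Y :
  'D_(Z, 0) ('D_(0, Y) conj_mu) (e, e) = 'D_Z (fun p => Ad (psi p) Y) e.
Proof.
have -> : (fun p => Ad (psi p) Y) = (fun p => 'D_(0, Y) conj_mu (p, e)).
  by apply/funext => p; exact: Ad_psiE.
exact: (derive_fst ('D_(0, Y) conj_mu) e e Z).
Qed.

(** The identity [(p v p^-1) p = p v], which is [mu_conj_mu], is differentiated
    in [v] and then in [p].  It expresses the derivative of [Ad] as the
    difference of the two mixed second derivatives of [mu] at the unit, and this
    difference is the bracket. *)
Lemma derive_Ad Z Y : 'D_Z (fun p => Ad (psi p) Y) e = lie_bracket G Z Y.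
Proof.
have sK := smooth_conj_mu; have sm := smooth_mu.
pose b (q : 'rV[R]_n * 'rV[R]_n) := (conj_mu q, q.1).
have sb : smooth b (e, e) by apply: smooth_pair => //; exact: smooth_fst.
have bee : b (e, e) = (e, e) by rewrite /b conj_mu_1.
have ED : \forall q \near (e, e), 'D_(0, Y) mu q = 'D_('D_(0, Y) conj_mu q, 0) mu (b q).
  have n1 := smooth_near_differentiable sK.
  have n2 : \forall q \near (e, e), differentiable mu (b q).
    have H : \forall q \near b (e, e), differentiable mu q.
      by rewrite bee; exact: smooth_near_differentiable.
    exact: (near_smooth sb H).
  have n3 : \forall q \near (e, e), {near q, mu \o b =1 mu}.
    exact/near_join/mu_conj_mu.
  apply: filterS3 n1 n2 n3 => q dK dmu Eq.
  have dfst : differentiable (fun q : 'rV[R]_n * 'rV[R]_n => q.1) q.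
    exact/smooth_differentiable/smooth_fst.
  have db : differentiable b q := differentiable_pair dK dfst.
  have Eb : 'D_(0, Y) b q = ('D_(0, Y) conj_mu q, 0).
    apply: (etrans (derive_pair (0, Y) dK dfst)).
    exact: (f_equal2 pair erefl (derive_proj1 q (0, Y))).
  apply: (etrans (esym (near_eq_derive (0, Y) Eq))).
  by apply: (etrans (derive_comp (0, Y) db dmu)); rewrite Eb.
pose a q : 'rV[R]_n * 'rV[R]_n := ('D_(0, Y) conj_mu q, 0).
have sa : smooth a (e, e).
  by apply: smooth_pair; [exact: smooth_derive | exact: smooth_cst].
have aee : a (e, e) = (Y, 0) by rewrite /a -Ad_psiE psi1 Ad1.
have Da : 'D_(Z, 0) a (e, e) = ('D_Z (fun p => Ad (psi p) Y) e, 0).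
  have dD := smooth_differentiable (smooth_derive (0, Y) sK).
  apply: (etrans (derive_pair (Z, 0) dD (differentiable_cst 0 (e, e)))).
  exact: (f_equal2 pair (derive_Ad_conj_mu Z Y) (derive_cst 0 (e, e) (Z, 0))).
have Db : 'D_(Z, 0) b (e, e) = (0, Z).
  have dK := smooth_differentiable sK.
  apply: (etrans (derive_pair (Z, 0) dK (smooth_differentiable (smooth_fst (e, e))))).
  have Ke : (fun p => conj_mu (p, e)) = cst e by apply/funext => p; exact: conj_mu1.
  have Kd : 'D_(Z, 0) conj_mu (e, e) = 0.
    by apply: (etrans (derive_fst conj_mu e e Z)); rewrite Ke; exact: (derive_cst e e Z).
  exact: (f_equal2 pair Kd (derive_proj1 (e, e) (Z, 0))).
have sm' : smooth mu (b (e, e)) by rewrite bee.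
have A0 := near_eq_derive (Z, 0) ED.
pose proof (derive_moving (Z, 0) sa sb sm') as A1.
have step D da db a0 b0 : da = (D, 0) -> db = (0, Z) -> a0 = (Y, 0) -> b0 = (e, e) ->
    'D_da mu b0 + 'D_db ('D_a0 mu) b0 = D + 'D_(0, Z) ('D_(Y, 0) mu) (e, e).
  by move=> -> -> -> ->; congr (_ + _); exact: derive_mu_l.
have A := etrans A0 (etrans A1 (step _ _ _ _ _ Da Db aee bee)).
have fin (x y z w : 'rV[R]_n) : y = x + z -> z = w -> x = y - w.
  by move=> -> ->; rewrite addrK.
apply: (etrans _ (esym (lie_bracketE Z Y))).
apply: (fin _ _ _ _ A); exact: (schwarz (0, Z) (Y, 0) sm).
Qed.

(** By [derive_Ad] a vector fixed by [Ad] has zero bracket with every vector, so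
    that it spans an abelian ideal. *)
Lemma semisimple_Ad_moves X : semisimple G -> X != 0 -> exists g : G, Ad g X != X.
Proof.
move=> ss X0; apply: contrapT => /forallNP nex.
have fixX g : Ad g X = X by apply/eqP; apply: contrapT => /negP; exact: nex.
have bX Z (k : R) : lie_bracket G Z (k *: X) = 0.
  rewrite -derive_Ad (_ : (fun p => _) = cst (k *: X)) ?derive_cst//.
  by apply/funext => p; rewrite AdZ fixX.
have : <[X]>%VS = 0%VS.
  apply: ss.
    by move=> Z Y /vlineP[k ->]; rewrite bX mem0v.
  exists 1%N; rewrite /= /derived_algebra; apply/eqP; rewrite -subv0.
  apply/span_subvP => v /allpairsP[[x y] /= [xI yI ->]].
  have /vlineP[k ->] : y \in <[X]>%VS by exact: vbasis_mem.
  by rewrite bX mem0v.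
move=> X00; have := memv_line X; rewrite X00 memv0; exact/negP.
Qed.

End AdjointAction.

(** * Iterated squaring near the unit *)

Section Squaring.
Context {R : realType} {n : nat} (G : lieGroupType R n).
Implicit Types (p q : 'rV[R]_n).
Local Notation c1 := (chart1 : chart R n G).
Local Notation phi := (cmap c1).
Local Notation psi := (cinv c1).
Local Notation e := (phi 1%g).

(** Squaring read in the chart at the unit; [dbl] is squaring in the group. *)
Definition sq p := mu G (p, p).

Definition dbl (x : G) : G := (x * x)%g.

Lemma sq1 : sq e = e. Proof. by rewrite /sq /mu /= psi1 mulg1. Qed.

Lemma smooth_sq : smooth sq e.
Proof. exact: (smooth_comp (smooth_diagonal e) (smooth_mu G)). Qed.

Lemma derive_sq v : 'D_v sq e = v + v.
Proof.
have dd := smooth_differentiable (smooth_diagonal e).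
apply: (etrans (derive_comp v dd (smooth_differentiable (smooth_mu G)))).
rewrite derive_diagonal (pair_split v v).
rewrite derive_dirD; last exact: smooth_differentiable (smooth_mu G).
by congr (_ + _); [exact: derive_mu_l | exact: derive_mu_r].
Qed.

(** The derivative of [sq] at the unit is doubling, and [taylor1] turns this
    into an estimate on differences. *)
Lemma sq_local : exists C r : R, [/\ 0 < C, 0 < r,
  forall p, `|p - e| < r ->
    [/\ phi (psi p) = p, cdom c1 (psi p) & psi (sq p) = (psi p * psi p)%g] &
  forall y z m, m < r -> `|y - e| <= m -> `|z - e| <= m ->
    `|sq y - sq z - (y - z + (y - z))| <= C * m * `|y - z| ].
Proof.
have [C C0 [r r0 H]] := taylor1 smooth_sq.
have : \forall p \near e, [/\ phi (psi p) = p, cdom c1 (psi p) & psi (sq p) = (psi p * psi p)%g].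
  have n1 : \forall p \near e, cdom c1 (psi p * psi p)%g.
    apply: (gsmooth_near (gsmooth_mulg (gsmooth_psi G) (gsmooth_psi G))).
    by rewrite psi1 mulg1; exact: nbhs1_cdom.
  have n2 : \forall p \near e, (phi @` cdom c1) p by exact/nbhs_cimg/chart1_unit.
  apply: filterS2 n1 n2 => p d i; split; [exact: cinvK|exact: cdom_cinv|].
  by rewrite /sq /mu phiK.
move=> /nbhs_ballP[s /= s0 Hs].
exists C, (Num.min r s); split => //; first by rewrite lt_min r0.
  by move=> p pe; apply: Hs; rewrite -ball_normE /= distrC (lt_le_trans pe)// ge_min lexx orbT.
move=> y z m mr ym zm; rewrite -derive_sq; apply: H => //.
by rewrite (lt_le_trans mr)// ge_min lexx.
Qed.

(** The arithmetic of one squaring: a bound [T / (1 - x)] on a distance [t]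
    becomes [2 * T / (1 - 2 * x)], in which both [T] and [x] have doubled. *)
Lemma iter_growth (x t T : R) : 0 <= x -> x <= 4^-1 -> 0 <= t -> t * (1 - x) <= T ->
  (t + t + 2 * (x / (1 - x)) * t) * (1 - 2 * x) <= 2 * T.
Proof.
move=> x0 x4 t0 tT.
have x1 : 0 < 1 - x by lra.
have -> : t + t + 2 * (x / (1 - x)) * t = 2 * t / (1 - x).
  by field; rewrite gt_eqF.
rewrite mulrAC ler_pdivrMr//.
apply: (@le_trans _ _ (2 * t * (1 - x) * (1 - x))); last first.
  by rewrite -[2 * t * _]mulrA; apply: ler_wpM2r; [exact: ltW | apply: ler_wpM2l].
rewrite -mulrA; apply: ler_wpM2l; first exact: mulr_ge0.
nra.
Qed.

(** The relative error of the [j]-th squaring is of order [2 ^ j * m].  These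
    errors form a geometric progression whose sum is of the order of its last
    term, which is bounded by [rho]; hence [k] squarings expand distances by at
    most [2 * 2 ^ k], whatever [k] is. *)
Lemma iter_sq : exists2 rho : R, 0 < rho & forall k m, 2 ^+ k * m <= rho ->
  forall p q, `|p - e| <= m -> `|q - e| <= m ->
  [/\ `|iter k sq p - e| <= 2 * (2 ^+ k * m),
      `|iter k sq p - iter k sq q| <= 2 * (2 ^+ k * `|p - q|),
      phi (psi (iter k sq p)) = iter k sq p,
      cdom c1 (psi (iter k sq p)) &
      psi (iter k sq p) = iter k dbl (psi p)].
Proof.
have [C [r [C0 r0 H1 H2]]] := sq_local.
pose rho := Num.min (r / 4) (1 / (2 * C)).
have rho0 : 0 < rho by rewrite lt_min !divr_gt0// mulr_gt0.
have rhor : 2 * rho < r.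
  have : rho <= r / 4 by rewrite ge_min lexx.
  by move=> ?; lra.
have rhoC : C * rho <= 2^-1.
  have : rho <= 1 / (2 * C) by rewrite ge_min lexx orbT.
  rewrite ler_pdivlMr ?mulr_gt0// => ?; lra.
exists rho => // k m km p q pm qm.
have m0 : 0 <= m by apply: le_trans pm.
(* The induction goes through with the factor [1 - C / 2 * (2 ^+ k * m)], which
   stays above 3/4, in place of the constant 2. *)
suff [A1 A2 A3 A4 A5] : [/\ `|iter k sq p - e| * (1 - C / 2 * (2 ^+ k * m)) <= 2 ^+ k * m,
    `|iter k sq q - e| * (1 - C / 2 * (2 ^+ k * m)) <= 2 ^+ k * m,
    `|iter k sq p - iter k sq q| * (1 - C / 2 * (2 ^+ k * m)) <= 2 ^+ k * `|p - q|,
    [/\ phi (psi (iter k sq p)) = iter k sq p & cdom c1 (psi (iter k sq p))] &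
      psi (iter k sq p) = iter k dbl (psi p)].
  have B0 : 0 <= 2 ^+ k * m by rewrite mulr_ge0// exprn_ge0.
  have B4 : C / 2 * (2 ^+ k * m) <= 4^-1.
    have : C * (2 ^+ k * m) <= C * rho by apply: ler_wpM2l => //; exact: ltW.
    by move=> ?; lra.
  case: A4 => A4 A4'; split => //.
    have := normr_ge0 (iter k sq p - e); move: A1 B4; set a := `|_|; set b := C / 2 * _; nra.
  have := normr_ge0 (iter k sq p - iter k sq q); move: A3 B4; set a := `|_|; set b := C / 2 * _; nra.
elim: k km => [|k IH] km.
  rewrite expr0 !mul1r in km *.
  have cm0 : 0 <= C / 2 * m by rewrite mulr_ge0// divr_ge0// ltW.
  have shrink (a b : R) : 0 <= a -> a <= b -> a * (1 - C / 2 * m) <= b.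
    by move=> a0 ab; apply: le_trans ab; rewrite ler_piMr// gerBl.
  have pr : `|p - e| < r by apply: le_lt_trans pm _; apply: le_lt_trans km _; lra.
  have [? ? _] := H1 _ pr.
  by split => //; exact: shrink.
have B0 : 0 <= 2 ^+ k * m by rewrite mulr_ge0// exprn_ge0.
have kmE : 2 ^+ k.+1 * m = 2 * (2 ^+ k * m) by rewrite exprS mulrA.
have km' : 2 ^+ k * m <= rho by rewrite kmE in km; lra.
have [A1 A2 A3 [A4 A4'] A5] := IH km'.
rewrite kmE in km *.
move: A1 A2 A3; set B := 2 ^+ k * m in B0 km km' *.
set x := C / 2 * B => A1 A2 A3.
have x0 : 0 <= x by rewrite mulr_ge0// divr_ge0// ltW.
have x4 : x <= 4^-1.
  have : C * (2 * B) <= C * rho by apply: ler_wpM2l => //; exact: ltW.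
  by rewrite /x => ?; lra.
have x1 : 0 < 1 - x by lra.
pose M := B / (1 - x).
have MB : M <= 2 * B by rewrite ler_pdivrMr//; nra.
have Mr : M < r by lra.
have pM : `|iter k sq p - e| <= M by rewrite ler_pdivlMr.
have qM : `|iter k sq q - e| <= M by rewrite ler_pdivlMr.
have eM : `|e - e| <= M by rewrite subrr normr0 divr_ge0// ltW.
have CM : C * M = 2 * (x / (1 - x)) by rewrite /M !mulrA; congr (_ / _); rewrite /x; field.
have step y z T : `|y - e| <= M -> `|z - e| <= M -> `|y - z| * (1 - x) <= T ->
    `|sq y - sq z| * (1 - C / 2 * (2 * B)) <= 2 * T.
  move=> yM zM yzT.
  have -> : C / 2 * (2 * B) = 2 * x by rewrite /x; ring.
  apply: le_trans (iter_growth x0 x4 (normr_ge0 (y - z)) yzT).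
  apply: ler_wpM2r; first lra.
  rewrite -CM -[X in `|X|](subrK (y - z + (y - z))).
  apply: le_trans (ler_normD _ _) _; rewrite addrC; apply: lerD; last exact: H2.
  exact: ler_normD.
have pkr := le_lt_trans pM Mr.
have [_ _ E1] := H1 _ pkr.
have S1 : `|sq (iter k sq p) - e| * (1 - C / 2 * (2 * B)) <= 2 * B.
  by rewrite -[X in _ - X]sq1; apply: step.
split => //.
- by rewrite -[X in _ - X]sq1 /=; apply: step.
- by rewrite exprS -[leRHS]mulrA /=; apply: step.
- have S1' : `|sq (iter k sq p) - e| < r.
    have : C / 2 * (2 * B) <= 2^-1.
      have : C * (2 * B) <= C * rho by apply: ler_wpM2l => //; exact: ltW.
      by move=> ?; lra.
    move: S1; have := normr_ge0 (sq (iter k sq p) - e); set a := `|_|; set b := C / 2 * _ => ? ? ?; nra.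
  by have [] := H1 _ S1'.
- by rewrite /= E1 A5.
Qed.

End Squaring.

Lemma cvg_half_pow {R : realType} (t : R) : (t / 2 ^+ k) @[k --> \oo] --> (0 : R).
Proof.
rewrite -[0 in X in _ --> X](mulr0 t); apply: cvgMr.
under eq_fun do rewrite -exprVn.
by apply: cvg_expr; rewrite ger0_norm// invf_lt1// ltr1n.
Qed.

(** * Curves through the unit *)

Section Tangent.
Context {R : realType} {n : nat} (G : lieGroupType R n).
Implicit Types (p q X Y Z W : 'rV[R]_n) (s : R -> G).
Local Notation c1 := (chart1 : chart R n G).
Local Notation phi := (cmap c1).
Local Notation psi := (cinv c1).
Local Notation e := (phi 1%g).

(** Continuity in the group is required besides derivability in the chart,
    because the chart map carries no information outside the domain of the
    chart. *)
Definition tangent_at1 s W :=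
  [/\ s 0 = 1%g, {for 0, continuous s} & is_derive (0 : R) (1 : R) (fun t => phi (s t)) W].

Lemma tangent_near s W : tangent_at1 s W -> \forall t \near 0, cdom c1 (s t).
Proof. by case=> s0 cs _; apply: cs; rewrite s0; exact: nbhs1_cdom. Qed.

Lemma tangent_differentiable s W : tangent_at1 s W -> differentiable (fun t => phi (s t)) 0.
Proof. by case=> _ _ [d _]; exact/derivable1_diffP. Qed.

Lemma tangent_derive s W : tangent_at1 s W -> 'D_1 (fun t => phi (s t)) 0 = W.
Proof. by case=> _ _ [_ d]. Qed.

Lemma tangent_map s W (Q : G -> G) : tangent_at1 s W -> Q 1%g = 1%g ->
  gsmooth (fun p => Q (psi p)) e ->
  tangent_at1 (fun t => Q (s t)) ('D_W (fun p => phi (Q (psi p))) e).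
Proof.
move=> ts Q1 sQ; have [s0 cs ds] := ts.
have sQ' : smooth (fun p => phi (Q (psi p))) e by apply: gsmooth_phi sQ _; rewrite psi1.
have dQ : differentiable (fun p => phi (Q (psi p))) (phi (s 0)).
  by rewrite s0; exact: smooth_differentiable.
have dts := tangent_differentiable ts.
have En : \forall t \near 0, (fun p => phi (Q (psi p))) (phi (s t)) = phi (Q (s t)).
  by apply: filterS (tangent_near ts) => t dt; rewrite phiK.
have EQ : \forall t \near 0, Q (psi (phi (s t))) = Q (s t).
  by apply: filterS (tangent_near ts) => t dt; rewrite phiK.
split; first by rewrite s0.
  change ((fun t => Q (s t)) @ (0 : R) --> Q (s 0)).
  have cp : {for 0, continuous (fun t => phi (s t))} by exact: differentiable_continuous.
  have cc : {for 0, continuous (fun t => Q (psi (phi (s t))))}.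
    apply: (@continuous_comp _ _ _ (fun t => phi (s t)) (fun p => Q (psi p))) => //.
    by rewrite s0; case: sQ.
  rewrite -(nbhs_singleton EQ).
  by apply: cvg_trans cc; apply: near_eq_cvg.
apply: (near_eq_is_derive En).
have dc : differentiable ((fun p => phi (Q (psi p))) \o (fun t => phi (s t))) 0.
  exact: differentiable_comp.
split; first exact: diff_derivable.
apply: (etrans (derive_comp (1 : R) dts dQ)).
by rewrite (tangent_derive ts) s0.
Qed.

Lemma tangent_mul s1 s2 W1 W2 : tangent_at1 s1 W1 -> tangent_at1 s2 W2 ->
  tangent_at1 (fun t => s1 t * s2 t)%g (W1 + W2).
Proof.
move=> t1 t2; have [s10 cs1 ds1] := t1; have [s20 cs2 ds2] := t2.
have dmu : differentiable (mu G) (phi (s1 0), phi (s2 0)).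
  by rewrite s10 s20; exact/smooth_differentiable/smooth_mu.
have d1 := tangent_differentiable t1; have d2 := tangent_differentiable t2.
have En : \forall t \near 0, mu G (phi (s1 t), phi (s2 t)) = phi (s1 t * s2 t)%g.
  apply: filterS2 (tangent_near t1) (tangent_near t2) => t dt1 dt2.
  by rewrite /mu /= !phiK.
split; first by rewrite s10 s20 mulg1.
  exact: continuous_mulg.
apply: (near_eq_is_derive En).
have dp := differentiable_pair d1 d2.
have dc : differentiable (mu G \o (fun t => (phi (s1 t), phi (s2 t)))) 0.
  exact: differentiable_comp.
split; first exact: diff_derivable.
apply: (etrans (derive_comp (1 : R) dp dmu)).
have -> : 'D_1 (fun t => (phi (s1 t), phi (s2 t))) 0 = (W1, 0) + (0, W2).
  apply: (etrans (derive_pair (1 : R) d1 d2)).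
  rewrite (_ : (W1, 0) + (0, W2) = (W1 + 0, 0 + W2))// addr0 add0r.
  exact: (f_equal2 pair (tangent_derive t1) (tangent_derive t2)).
rewrite s10 s20 derive_dirD; last exact/smooth_differentiable/smooth_mu.
exact: (f_equal2 +%R (derive_mu_l _ _) (derive_mu_r _ _)).
Qed.

(** The values at [t] are obtained by squaring [k] times the values at
    [t / 2 ^ k].  Since the velocities agree, the latter differ by [o (2 ^ - k)],
    and by [iter_sq] the [k] squarings multiply this difference by [O (2 ^ k)];
    letting [k] grow gives equality for small [t].  Any other [t] is reached
    from a small one by squaring. *)
Lemma doubling_unique s1 s2 W :
  (forall t, s1 (t + t) = s1 t * s1 t)%g -> (forall t, s2 (t + t) = s2 t * s2 t)%g ->
  tangent_at1 s1 W -> tangent_at1 s2 W -> s1 =1 s2.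
Proof.
move=> dbl1 dbl2 t1 t2.
have [rho rho0 Hrho] := iter_sq G.
have pow (s : R -> G) : (forall t, s (t + t) = s t * s t)%g ->
    forall k t, s t = iter k (@dbl R n G) (s (t / 2 ^+ k)).
  move=> dbls; elim=> [|k IH] t; first by rewrite expr0 divr1.
  rewrite (IH t) iterSr /dbl -dbls; congr (iter _ _ (s _)).
  by rewrite exprS; field; rewrite expf_neq0.
have small t : `|t| * (`|W| + 1) <= rho -> s1 t = s2 t.
  move=> tr.
  have close (ep : R) : 0 < ep -> ep <= 1 -> exists p1 p2,
    [/\ psi p1 = s1 t, psi p2 = s2 t, phi (psi p1) = p1 /\ phi (psi p2) = p2,
       cdom c1 (psi p1) /\ cdom c1 (psi p2) & `|p1 - p2| <= 4 * (ep * `|t|)].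
    move=> ep0 ep1.
    have lin s : tangent_at1 s W -> \forall u \near 0, `|phi (s u) - e - u *: W| <= ep * `|u|.
      move=> ts; have [s0 _ _] := ts.
      have := differentiable_elim (tangent_differentiable ts) ep0.
      apply: filterS => u; rewrite addr0 s0.
      have -> : 'd (fun t => phi (s t)) 0 u = u *: W.
        rewrite -(deriveE _ (tangent_differentiable ts)) -(tangent_derive ts).
        rewrite -derive_dirZ; last exact: tangent_differentiable ts.
        by congr ('D_ _ _ _); rewrite [RHS]mulr1.
      by [].
    have near0 : \forall u \near (0 : R), [/\ `|phi (s1 u) - e - u *: W| <= ep * `|u|,
        `|phi (s2 u) - e - u *: W| <= ep * `|u|, cdom c1 (s1 u) & cdom c1 (s2 u)].
      by apply: filterS2 (filterI (lin _ t1) (lin _ t2)) (filterI (tangent_near t1) (tangent_near t2)) => u [? ?] [? ?].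
    have [k _ Hk] := cvg_half_pow t near0.
    have [L1 L2 D1 D2] := Hk k (leqnn _).
    move: L1 L2 D1 D2; set u := t / 2 ^+ k => L1 L2 D1 D2.
    have k0 : 0 < 2 ^+ k :> R by rewrite exprn_gt0.
    have uE : `|u| = `|t| / 2 ^+ k by rewrite normrM normfV (gtr0_norm k0).
    pose m := `|u| * (`|W| + 1).
    have km : 2 ^+ k * m <= rho.
      by rewrite /m uE mulrA [2 ^+ k * _]mulrC divfK ?gt_eqF.
    have bnd x : `|x - e - u *: W| <= ep * `|u| -> `|x - e| <= m.
      move=> H; rewrite -[x - e](subrK (u *: W)) (le_trans (ler_normD _ _))//.
      rewrite /m mulrDr mulr1 addrC normrZ lerD// (le_trans H)//.
      by rewrite ler_piMl.
    have [A1 A2 A3 A4 A5] := Hrho k m km _ _ (bnd _ L1) (bnd _ L2).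
    have [_ _ B3 B4 B5] := Hrho k m km _ _ (bnd _ L2) (bnd _ L1).
    exists (iter k (sq G) (phi (s1 u))), (iter k (sq G) (phi (s2 u))); split => //.
    - by rewrite A5 phiK// -pow.
    - by rewrite B5 phiK// -pow.
    - apply: le_trans A2 _.
      have dd : `|phi (s1 u) - phi (s2 u)| <= 2 * (ep * `|u|).
        have -> : phi (s1 u) - phi (s2 u) = (phi (s1 u) - e - u *: W) - (phi (s2 u) - e - u *: W).
          by rewrite opprB addrA subrK opprB addrA subrK.
        by rewrite (le_trans (ler_normB _ _))// mulrDl mul1r lerD.
      apply: (@le_trans _ _ (2 * (2 ^+ k * (2 * (ep * `|u|))))).
        by apply: ler_wpM2l => //; apply: ler_wpM2l => //; exact: ltW.
      rewrite uE le_eqVlt; apply/orP; left; apply/eqP; field.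
      by rewrite gt_eqF.
  have [q1 [q2 [E1 E2 [F1 F2] [D1 D2] _]]] := close 1 ltr01 (lexx 1).
  have : phi (s1 t) = phi (s2 t).
    apply/eqP; rewrite -subr_eq0 -normr_le0; apply/ler_addgt0Pl => ee ee0; rewrite addr0.
    pose ep := Num.min 1 (ee / (4 * (`|t| + 1))).
    have t4 : 0 < 4 * (`|t| + 1) by rewrite mulr_gt0// ltr_wpDl.
    have ep0 : 0 < ep by rewrite lt_min ltr01 divr_gt0.
    have ep1 : ep <= 1 by rewrite ge_min lexx.
    have [p1 [p2 [<- <- [-> ->] _ /le_trans]]] := close ep ep0 ep1; apply.
    have : ep <= ee / (4 * (`|t| + 1)) by rewrite ge_min lexx orbT.
    rewrite ler_pdivlMr// => H; apply: le_trans H.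
    rewrite mulrCA; apply: ler_wpM2l; first exact: ltW.
    by apply: ler_wpM2l => //; rewrite lerDl.
  by rewrite E1 in D1; rewrite E2 in D2 => E; rewrite -(phiK D1) -(phiK D2) E.
move=> t.
have W1 : 0 < `|W| + 1 by rewrite ltr_wpDl.
have nr : \forall u \near (0 : R), `|u| < rho / (`|W| + 1).
  by apply: nbhs0_lt; exact: divr_gt0.
have [k _ /(_ k (leqnn _)) kr] := cvg_half_pow t nr.
rewrite (pow _ dbl1 k) (pow _ dbl2 k) small//.
by rewrite -ler_pdivlMr//; exact: ltW.
Qed.

End Tangent.

Lemma cvg_unshift (T : topologicalType) (u : nat -> T) N (l : T) :
  u (k + N)%N @[k --> \oo] --> l -> u k @[k --> \oo] --> l.
Proof.
move=> ul A /ul[M _ MA]; exists (M + N)%N => // k /= Mk.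
have Nk : (N <= k)%N by apply: leq_trans Mk; exact: leq_addl.
by rewrite -(subnK Nk); apply: (MA (k - N)%N); rewrite /= leq_subRL // addnC.
Qed.

(** * The exponential map *)

Section Exponential.
Context {R : realType} {n : nat} (G : lieGroupType R n).
Implicit Types (p q X Y Z W : 'rV[R]_n) (s : R -> G) (g : G).
Local Notation c1 := (chart1 : chart R n G).
Local Notation phi := (cmap c1).
Local Notation psi := (cinv c1).
Local Notation e := (phi 1%g).

(** A polygonal approximation of the exponential curve with [2 ^ k] equal steps.
    The number of steps is a power of two so that only squarings occur. *)
Definition exp_seq Z (k : nat) : G := iter k (@dbl R n G) (psi (e + (2 ^+ k)^-1 *: Z)).

Definition gexp Z : G := xget 1%g [set g | exp_seq Z k @[k --> \oo] --> g].

(** Passing from [2 ^ k] to [2 ^ k.+1] steps replaces [e + w k] by the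
    square of [e + w k.+1], where [w k.+1] is half of [w k]; the error is of
    second order, and [iter_sq] shows that
    the [k] squarings leave a difference [O (`|Z| ^+ 2 / 2 ^ k)].  Hence the
    sequence is Cauchy in the chart, with limit at distance [O (`|Z| ^+ 2)] from
    [e + Z]. *)
Lemma exp_seq_local : exists rho C : R, [/\ 0 < rho, 0 < C & forall Z, `|Z| <= rho ->
  exists p, [/\ exp_seq Z k @[k --> \oo] --> psi p, phi (psi p) = p, cdom c1 (psi p) &
    `|p - e - Z| <= C * `|Z| ^+ 2]].
Proof.
have [C [r [C0 r0 H1 H2]]] := sq_local G.
have [rho1 rho10 H3] := iter_sq G.
pose rho := Num.min (rho1 / 4) (r / 4).
have rho0 : 0 < rho by rewrite lt_min !divr_gt0.
have rhor : rho <= r / 4 by rewrite ge_min lexx orbT.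
have rhor1 : rho <= rho1 / 4 by rewrite ge_min lexx.
exists rho, C; split => // Z Zrho.
have Z0 := normr_ge0 Z.
pose w k := (2 ^+ k)^-1 *: Z.
have p2 k : 0 < 2 ^+ k :> R by rewrite exprn_gt0.
have wE k : `|w k| = `|Z| / 2 ^+ k.
  by rewrite normrZ normfV gtr0_norm// mulrC.
have w2 k : w k = w k.+1 + w k.+1.
  rewrite /w -scalerDl; congr (_ *: _); rewrite exprS; field.
  by rewrite expf_neq0.
have kw k : 2 ^+ k * `|w k| = `|Z| by rewrite wE mulrCA divff ?mulr1// gt_eqF.
have ew k : `|e + w k - e| <= `|w k| by rewrite addrAC subrr add0r.
pose y k := iter k (sq G) (e + w k).
have Zr1 : `|Z| <= rho1 by lra.
have Y k : [/\ `|y k - e| <= 2 * `|Z|, phi (psi (y k)) = y k & psi (y k) = exp_seq Z k].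
  have km : 2 ^+ k * `|w k| <= rho1 by rewrite kw.
  have [A1 A2 A3 A4 A5] := H3 k _ km _ _ (ew k) (ew k).
  by split => //; rewrite -(kw k).
pose K := C * `|Z| ^+ 2 / 2.
have K0 : 0 <= K by rewrite divr_ge0// mulr_ge0// ?sqr_ge0// ltW.
have step k : `|y k.+1 - y k| <= K / 2 ^+ k.
  rewrite /y iterSr.
  have m1 : 2 ^+ 1 * `|w k.+1| <= rho1.
    rewrite expr1; have : 2 ^+ k.+1 * `|w k.+1| <= rho1 by rewrite kw.
    apply: le_trans; apply: ler_wpM2r => //.
    by rewrite exprS ler_peMr// exprn_ege1// ler1n.
  have [B1 _ _ _ _] := H3 1%N _ m1 _ _ (ew k.+1) (ew k.+1).
  have {B1} B1 : `|sq G (e + w k.+1) - e| <= 4 * `|w k.+1|.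
    by move: B1; rewrite /= expr1 mulrA -natrM.
  have B2 : `|e + w k - e| <= 4 * `|w k.+1|.
    by rewrite (le_trans (ew k))// w2 (le_trans (ler_normD _ _))//; have := normr_ge0 (w k.+1); lra.
  have km : 2 ^+ k * (4 * `|w k.+1|) <= rho1.
    have := kw k.+1; rewrite exprS; lra.
  have [_ A2 _ _ _] := H3 k _ km _ _ B1 B2.
  apply: le_trans A2 _.
  have wr : `|w k.+1| < r.
    have : `|w k.+1| <= `|Z| by rewrite wE ler_pdivrMr// ler_peMr// exprn_ege1// ler1n.
    lra.
  have ee : `|e - e| <= `|w k.+1| by rewrite subrr normr0.
  have := H2 _ _ _ wr (ew k.+1) ee.
  rewrite sq1 (_ : e + w k.+1 - e = w k.+1) -?w2 => [A3|]; last by rewrite addrAC subrr add0r.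
  have -> : sq G (e + w k.+1) - (e + w k) = sq G (e + w k.+1) - e - w k by rewrite opprD addrA.
  apply: (@le_trans _ _ (2 * (2 ^+ k * (C * `|w k.+1| * `|w k.+1|)))).
    by apply: ler_wpM2l => //; apply: ler_wpM2l => //; exact: ltW.
  rewrite wE /K exprS le_eqVlt; apply/orP; left; apply/eqP; field.
  by rewrite expf_neq0.
have tele k j : `|y (k + j)%N - y k| <= 2 * K / 2 ^+ k * (1 - (2 ^+ j)^-1).
  elim: j => [|j IH]; first by rewrite addn0 subrr normr0 expr0 invr1 subrr mulr0.
  rewrite addnS.
  have -> : y (k + j).+1 - y k = (y (k + j).+1 - y (k + j)%N) + (y (k + j)%N - y k).
    by rewrite addrA subrK.
  apply: le_trans (ler_normD _ _) _; apply: le_trans (lerD (step (k + j)%N) IH) _.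
  rewrite le_eqVlt; apply/orP; left; apply/eqP; rewrite exprD exprS; field.
  by rewrite !expf_neq0.
have tail k l : (k <= l)%N -> `|y l - y k| <= 2 * K / 2 ^+ k.
  move=> /subnKC <-; apply: le_trans (tele _ _) _.
  have l1 : 1 - (2 ^+ (l - k))^-1 <= 1 :> R by rewrite gerBl invr_ge0 ltW.
  by rewrite ler_piMr// divr_ge0// ?mulr_ge0// ltW.
have cy : cauchy (y @ \oo).
  apply: cauchy_exP => ep ep0.
  have nr : \forall u \near (0 : R), `|u| < ep by exact: nbhs0_lt.
  have [k _ /(_ k (leqnn _)) /= kr] := cvg_half_pow (2 * K) nr.
  exists (y k); exists k => // l /= kl; rewrite -ball_normE /= distrC.
  apply: le_lt_trans (tail _ _ kl) _; apply: le_lt_trans kr; exact: ler_norm.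
have /cvg_ex[p yp] : cvg (y @ \oo) by exact: cauchy_cvg.
have lim_le (a : 'rV[R]_n) (b : R) : (forall k, `|y k - a| <= b) -> `|p - a| <= b.
  move=> H; apply/ler_addgt0Pl => ep ep0.
  move/cvgrPdist_le : yp => /(_ ep ep0) [k _ /(_ k (leqnn _)) kp].
  have -> : p - a = (p - y k) + (y k - a) by rewrite addrA subrK.
  by rewrite (le_trans (ler_normD _ _))// lerD.
have pr : `|p - e| < r.
  apply: (@le_lt_trans _ _ (2 * `|Z|)); last by lra.
  by apply: lim_le => k; case: (Y k).
have [P1 P2 _] := H1 _ pr.
exists p; split => //.
- have -> : exp_seq Z = psi \o y by apply/funext => k; case: (Y k).
  apply: (cvg_comp _ _ yp); apply: continuous_cinv.
  by exists (psi p).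
- rewrite -addrA -opprD; apply: lim_le => k.
  have -> : e + Z = y 0%N by rewrite /y /w /= expr0 invr1 scale1r.
  apply: le_trans (tail 0%N k (leq0n _)) _.
  by rewrite expr0 divr1 /K mulrCA divff ?mulr1// pnatr_eq0.
Qed.

Lemma exp_seqD Z K k : exp_seq Z (k + K) = iter K (@dbl R n G) (exp_seq ((2 ^+ K)^-1 *: Z) k).
Proof.
by rewrite /exp_seq addnC iterD scalerA -invfM -exprD addnC.
Qed.

Lemma continuous_iter_dbl K : continuous (iter K (@dbl R n G)).
Proof.
elim: K => [|K IH] g; first exact: cvg_id.
by apply: continuous_mulg; exact: IH.
Qed.

Lemma scaled_small Z (rho : R) : 0 < rho -> exists K, `|(2 ^+ K)^-1 *: Z| <= rho.
Proof.
move=> rho0.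
have nr : \forall u \near (0 : R), `|u| < rho by exact: nbhs0_lt.
have [k _ /(_ k (leqnn _)) /= kr] := cvg_half_pow `|Z| nr.
exists k; rewrite normrZ normfV mulrC; apply: ltW; apply: le_lt_trans kr.
by rewrite normrM normr_id normfV.
Qed.

(** For small vectors this is [exp_seq_local]; any vector is a multiple by
    [2 ^ K] of a small one, and its sequence is that of the small one, squared
    [K] times. *)
Lemma gexp_cvg Z : exp_seq Z k @[k --> \oo] --> gexp Z.
Proof.
suff /(xgetPex 1%g) : exists g, exp_seq Z k @[k --> \oo] --> g by [].
have [rho [C [rho0 _ H]]] := exp_seq_local.
have [K Kr] := scaled_small Z rho0.
have [p [Hp _ _ _]] := H _ Kr.
exists (iter K (@dbl R n G) (psi p)).
apply: (cvg_unshift (N := K)).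
under eq_fun do rewrite exp_seqD.
exact: (cvg_comp _ _ Hp (@continuous_iter_dbl K _)).
Qed.

Lemma gexp_unique Z g : exp_seq Z k @[k --> \oo] --> g -> gexp Z = g.
Proof. move=> H; apply: (@cvg_unique _ (@lie_hausdorff R n G) (exp_seq Z @ \oo)).
  exact: gexp_cvg.
exact: H. Qed.

Lemma gexp_double Z : gexp (Z + Z) = (gexp Z * gexp Z)%g.
Proof.
apply: gexp_unique; apply: (cvg_unshift (N := 1)).
have -> : (fun k => exp_seq (Z + Z) (k + 1)) = (@dbl R n G) \o exp_seq Z.
  apply/funext => k; rewrite exp_seqD /= expr1; congr (dbl (exp_seq _ _)).
  rewrite -[X in _ *: (X + X)]scale1r -scalerDl scalerA (_ : 2^-1 * (1 + 1) = 1) ?scale1r//.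
  by field.
have c : {for gexp Z, continuous (@dbl R n G)} by exact: (continuous_mulg cvg_id cvg_id).
apply: (@cvg_comp _ _ _ (exp_seq Z) (@dbl R n G) _ (nbhs (gexp Z))); first exact: gexp_cvg.
exact: c.
Qed.

Lemma gexp0 : gexp 0 = 1%g.
Proof.
have := gexp_double 0; rewrite addr0 => /(congr1 (fun x => (gexp 0)^-1 * x)%g).
by rewrite mulgA mulVg mul1g.
Qed.

Lemma gexp_local : exists rho C : R, [/\ 0 < rho, 0 < C & forall Z, `|Z| <= rho ->
  [/\ psi (phi (gexp Z)) = gexp Z, cdom c1 (gexp Z) & `|phi (gexp Z) - e - Z| <= C * `|Z| ^+ 2]].
Proof.
have [rho [C [rho0 C0 H]]] := exp_seq_local.
exists rho, C; split => // Z /H[p [Hp pK dp le]].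
by rewrite (gexp_unique Hp) pK.
Qed.

Lemma tangent_gexp Z : tangent_at1 (fun t : R => gexp (t *: Z)) Z.
Proof.
have [rho [C [rho0 C0 H]]] := gexp_local.
have Z1 : 0 < `|Z| + 1 by rewrite ltr_wpDl.
have nZ : \forall t \near (0 : R), `|t *: Z| <= rho.
  have : \forall t \near (0 : R), `|t| < rho / (`|Z| + 1) by apply: nbhs0_lt; exact: divr_gt0.
  apply: filterS => t; rewrite ltr_pdivlMr// => /ltW; apply: le_trans.
  by rewrite normrZ; apply: ler_wpM2l => //; rewrite lerDl.
pose x (t : R) := phi (gexp (t *: Z)).
have x0 : x 0 = e by rewrite /x scale0r gexp0.
have cL : continuous ( *:%R^~ Z : R -> 'rV[R]_n) by exact: scalel_continuous.
have lL : linear ( *:%R^~ Z : R -> 'rV[R]_n).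
  by move=> a u v; rewrite scalerDl -scalerA.
pose L : {linear R -> 'rV[R]_n} := HB.pack ( *:%R^~ Z : R -> 'rV[R]_n) (GRing.isLinear.Build _ _ _ _ _ lL).
have [dx xE] : differentiable x 0 /\ 'd x 0 = L :> (R -> 'rV[R]_n).
  apply: diff_intro => // ep ep0.
  have ns : \forall t \near (0 : R), `|t| < ep / (C * (`|Z| + 1) ^+ 2).
    by apply: nbhs0_lt; rewrite divr_gt0// mulr_gt0// exprn_gt0.
  apply: filterS2 nZ ns => t /H[_ _ Ht] ts; rewrite addr0 x0 /L /=.
  apply: le_trans Ht _; rewrite normrZ exprMn expr2.
  have c0 : 0 < C * (`|Z| + 1) ^+ 2 by rewrite mulr_gt0// exprn_gt0.
  move: ts; rewrite ltr_pdivlMr// => /ltW ts.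
  have zz : C * `|Z| ^+ 2 <= C * (`|Z| + 1) ^+ 2.
    apply: ler_wpM2l; first exact: ltW.
    by rewrite lerXn2r// ?nnegrE// ?lerDl// ltW.
  have -> : C * (`|t| * `|t| * `|Z| ^+ 2) = `|t| * (C * `|Z| ^+ 2) * `|t| by ring.
  apply: ler_wpM2r => //; apply: le_trans ts; exact: ler_wpM2l.
split; first by rewrite scale0r gexp0.
- have cx : {for 0, continuous x} by exact: differentiable_continuous.
  change ((fun t : R => gexp (t *: Z)) @ (0 : R) --> gexp ((0 : R) *: Z)).
  have cc : {for 0, continuous (psi \o x)}.
    apply: continuous_comp => //; rewrite x0; apply: continuous_cinv.
    by exists 1%g => //; exact: chart1_unit.
  have En : \forall t \near 0, psi (x t) = gexp (t *: Z).
    by apply: filterS nZ => t /H[].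
  rewrite -(nbhs_singleton En); apply: cvg_trans cc; exact: near_eq_cvg.
- split; first exact: diff_derivable.
  by rewrite (deriveE _ dx) xE /L /= scale1r.
Qed.

Lemma gexp_doubles Z (t : R) : gexp ((t + t) *: Z) = (gexp (t *: Z) * gexp (t *: Z))%g.
Proof. by rewrite scalerDl gexp_double. Qed.

(** As functions of the multiple of [Z], both sides satisfy [s (2 t) = s t * s t]
    and have velocity [Ad g Z]. *)
Lemma gexp_conj g Z : (g * gexp Z * g^-1)%g = gexp (Ad g Z).
Proof.
have tZ := tangent_gexp Z.
have t2 : tangent_at1 (fun t : R => g * gexp (t *: Z) * g^-1)%g (Ad g Z).
  apply: (tangent_map (Q := fun x => (g * x * g^-1)%g) tZ); last exact: gsmooth_conjg.
  by rewrite mulg1 mulgV.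
have d2 (t : R) : (g * gexp ((t + t) *: Z) * g^-1)%g =
    ((g * gexp (t *: Z) * g^-1) * (g * gexp (t *: Z) * g^-1))%g.
  by rewrite gexp_doubles -!mulgA mulKg.
have := doubling_unique d2 (gexp_doubles (Ad g Z)) t2 (tangent_gexp (Ad g Z)) 1.
by rewrite !scale1r.
Qed.

(** The values at the vectors [X / 2 ^ k] determine the velocity of
    [t |-> gexp (t X)] at the unit, which is [X]. *)
Lemma gexp_inj_germ X Y : (forall k, gexp ((2 ^+ k)^-1 *: X) = gexp ((2 ^+ k)^-1 *: Y)) -> X = Y.
Proof.
move=> XY; apply/eqP; rewrite -subr_eq0 -normr_le0; apply/ler_addgt0Pl => ep ep0; rewrite addr0.
have ep2 : 0 < ep / 2 by rewrite divr_gt0.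
have lin Z : \forall u \near 0, `|phi (gexp (u *: Z)) - e - u *: Z| <= ep / 2 * `|u|.
  have tZ := tangent_gexp Z; have [s0 _ _] := tZ.
  have := differentiable_elim (tangent_differentiable tZ) ep2.
  apply: filterS => u; rewrite addr0 s0.
  have -> // : 'd (fun t : R => phi (gexp (t *: Z))) 0 u = u *: Z.
  rewrite -(deriveE _ (tangent_differentiable tZ)) -[in RHS](tangent_derive tZ).
  rewrite -derive_dirZ; last exact: tangent_differentiable tZ.
  by congr ('D_ _ _ _); rewrite [RHS]mulr1.
have [k _ /(_ k (leqnn _)) /= [kX kY]] := cvg_half_pow 1 (filterI (lin X) (lin Y)).
move: kX kY; rewrite div1r XY; set u := (2 ^+ k)^-1 => kX kY.
have u0 : 0 < u by rewrite invr_gt0 exprn_gt0.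
rewrite -(ler_pM2l u0) -[X in X * `|_|](gtr0_norm u0) -normrZ.
have -> : u *: (X - Y) = (phi (gexp (u *: Y)) - e - u *: Y) - (phi (gexp (u *: Y)) - e - u *: X).
  by move: (phi _ - e) => d; rewrite opprB [RHS]addrC addrA subrK scalerBr.
apply: le_trans (ler_normB _ _) _; apply: le_trans (lerD kY kX) _.
by rewrite (gtr0_norm u0) -mulrDl -splitr mulrC.
Qed.

Lemma gexp_half Z k : gexp Z = iter k (@dbl R n G) (gexp ((2 ^+ k)^-1 *: Z)).
Proof.
elim: k => [|k IH]; first by rewrite expr0 invr1 scale1r.
rewrite {1}IH iterSr; congr (iter k _ _).
have E : (2 ^+ k)^-1 *: Z = (2 ^+ k.+1)^-1 *: Z + (2 ^+ k.+1)^-1 *: Z.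
  rewrite -scalerDl; congr (_ *: _).
  by rewrite exprS; field; rewrite expf_neq0.
by rewrite E; exact: gexp_double.
Qed.

Lemma iter_dbl_comm g k : (iter k (@dbl R n G) g * g = g * iter k (@dbl R n G) g)%g.
Proof. by elim: k => [//|k IH] /=; rewrite /dbl -mulgA IH mulgA IH mulgA. Qed.

(** [gexp Z] is a power of each [gexp (Z / 2 ^ k)] and commutes with it.  By
    [gexp_conj] the vectors [Ad (gexp Z) Z] and [Z] therefore have the same
    exponentials at all scales [2 ^ - k]. *)
Lemma Ad_gexp Z : Ad (gexp Z) Z = Z.
Proof.
apply: gexp_inj_germ => k; rewrite -AdZ -gexp_conj.
set h := gexp (_ *: _).
have -> : (gexp Z * h = h * gexp Z)%g.
  by rewrite (gexp_half Z k); exact: iter_dbl_comm.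
by rewrite mulgK.
Qed.

Lemma gexp_comm X (a b : R) : (gexp (a *: X) * gexp (b *: X) = gexp (b *: X) * gexp (a *: X))%g.
Proof.
have [->|a0] := eqVneq a 0; first by rewrite scale0r gexp0 mul1g mulg1.
have AX : Ad (gexp (a *: X)) X = X.
  have := Ad_gexp (a *: X); rewrite AdZ => /(congr1 (fun v => a^-1 *: v)).
  by rewrite !scalerA mulVf// !scale1r.
have := gexp_conj (gexp (a *: X)) (b *: X); rewrite AdZ AX => {2}<-.
by rewrite mulgVK.
Qed.

(** [t |-> gexp (t a X) * gexp (t b X)] satisfies [s (2 t) = s t * s t] because
    the factors commute, and its velocity is [(a + b) X]. *)
Lemma gexp_hom X (a b : R) : gexp ((a + b) *: X) = (gexp (a *: X) * gexp (b *: X))%g.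
Proof.
have t1 := tangent_gexp ((a + b) *: X).
have t2 := tangent_mul (tangent_gexp (a *: X)) (tangent_gexp (b *: X)).
rewrite -scalerDl in t2.
have d2 (t : R) : (gexp ((t + t) *: (a *: X)) * gexp ((t + t) *: (b *: X)) =
   (gexp (t *: (a *: X)) * gexp (t *: (b *: X))) * (gexp (t *: (a *: X)) * gexp (t *: (b *: X))))%g.
  rewrite !gexp_doubles !scalerA -!mulgA; congr (_ * _)%g.
  by rewrite !mulgA; congr (_ * _)%g; exact: gexp_comm.
have := doubling_unique (gexp_doubles ((a + b) *: X)) d2 t1 t2 1.
by rewrite !scale1r.
Qed.

End Exponential.

(** * One-parameter subgroups *)

Section OneParameter.
Context {R : realType} {n : nat} (G : lieGroupType R n).
Implicit Types (X : 'rV[R]_n) (g : G).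
Local Notation c1 := (chart1 : chart R n G).
Local Notation phi := (cmap c1).
Local Notation psi := (cinv c1).
Local Notation e := (phi 1%g).

Variables (s : R -> G) (X : 'rV[R]_n).
Hypothesis hom : forall a b, s (a + b) = (s a * s b)%g.
Hypothesis tan : tangent_at1 s X.

Let x (t : R) := phi (s t).

Lemma hom_continuous : continuous s.
Proof.
have [s0 cs _] := tan.
move=> t0.
have E : s = (fun t => s t0 * s (t - t0))%g.
  by apply/funext => t; rewrite -hom addrC subrK.
have c : {for t0, continuous (fun t => s (t - t0))}.
  apply: (@continuous_comp _ _ _ (fun t => t - t0) s); last by rewrite subrr.
  by apply: cvgB; [exact: cvg_id | exact: cvg_cst].
rewrite E; apply: (continuous_mulg _ c); exact: cvg_cst.
Qed.

Lemma hom_near_cdom : \forall t \near 0, cdom c1 (s t).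
Proof. exact: tangent_near tan. Qed.

Lemma hom_x0 : x 0 = e. Proof. by have [s0 _ _] := tan; rewrite /x s0. Qed.

Lemma hom_x_continuous : {for 0, continuous x}.
Proof. exact/differentiable_continuous/(tangent_differentiable tan). Qed.

(** The identity [s t = s t0 * s (t - t0)] is differentiated at [t = t0] in its
    second factor; this gives the equation of the integral curves of the
    left-invariant field of [X]. *)
Lemma hom_ode : \forall t \near 0,
  differentiable x t /\ 'D_1 x t = 'D_(0, X) (mu G) (x t, e).
Proof.
have dtan := tangent_differentiable tan.
have n1 : \forall t \near 0, differentiable (mu G) (x t, e).
  have nm : \forall p \near (e, e), differentiable (mu G) p.
    exact/smooth_near_differentiable/smooth_mu.
  have cp : {for 0, continuous (fun t : R => (x t, e))}.
    exact: (cvg_pair hom_x_continuous (cvg_cst e)).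
  have H : \forall p \near (x 0, e), differentiable (mu G) p by rewrite hom_x0.
  exact: (cp _ H).
apply: filterS2 n1 hom_near_cdom => t0 dmu dt0.
pose m q := mu G (x t0, q).
have pd : differentiable (fun q : 'rV[R]_n => (x t0, q)) e.
  exact: (differentiable_pair (differentiable_cst (x t0) e) (smooth_differentiable (smooth_id e))).
have dm : differentiable m e by exact: (differentiable_comp pd dmu).
have E : \forall t \near t0, m (x (t - t0)) = x t.
  have : \forall u \near t0, cdom c1 (s (u - t0)).
    have c : {for t0, continuous (fun t : R => t - t0)}.
      by apply: cvgB; [exact: cvg_id | exact: cvg_cst].
    have H : \forall u \near t0 - t0, cdom c1 (s u) by rewrite subrr; exact: hom_near_cdom.
    exact: (c _ H).
  apply: filterS => t dt; rewrite /m /mu /= /x !phiK// -hom.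
  by rewrite addrC subrK.
have dsh : differentiable (fun t : R => t - t0) t0 by exact: differentiableB.
have dx0 : differentiable x (t0 - t0) by rewrite subrr.
have dxs : differentiable (x \o (fun t : R => t - t0)) t0 by exact: differentiable_comp.
have dm' : differentiable m ((x \o (fun t : R => t - t0)) t0) by rewrite /= subrr hom_x0.
have dall : differentiable (m \o (x \o (fun t : R => t - t0))) t0.
  exact: differentiable_comp.
split; first exact: near_eq_differentiable E dall.
apply: (etrans (esym (near_eq_derive (1 : R) E))).
apply: (etrans (derive_comp (1 : R) dxs dm')).
have D1 : 'D_(1 : R) (x \o (fun t : R => t - t0)) t0 = X.
  apply: (etrans (derive_comp (1 : R) dsh dx0)).
  have -> : 'D_(1 : R) (fun t : R => t - t0) t0 = 1.
    have [_ ->] := is_deriveB (is_derive_id t0 (1 : R)) (is_derive_cst t0 t0 (1 : R)).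
    by rewrite subr0.
  by rewrite subrr; exact: tangent_derive tan.
rewrite D1 /= subrr hom_x0; exact: esym (derive_snd _ _ _ _).
Qed.

(** Bootstrapping: the right-hand side of the equation of [hom_ode] is smooth, so
    a solution of class [C^k] is of class [C^(k+1)]. *)
Lemma hom_smooth0 : smooth x 0.
Proof.
apply/smoothP; elim=> [|k IH] /=.
  apply: filterS hom_near_cdom => t dt.
  by apply: (@continuous_comp _ _ _ s phi); [exact: hom_continuous | exact: continuous_cmap].
split; first by apply: filterS hom_ode => t [].
move=> v.
apply: (@ndiff_near_eq _ _ _ _ (fun t => v *: ('D_(0, X) (mu G) \o (fun t : R => (x t, e))) t)).
  apply: filterS hom_ode => t [dt Dt] /=; rewrite -Dt.
  apply: (etrans (esym (derive_dirZ v (1 : R) dt))).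
  by rewrite [v *: 1]mulr1.
apply: ndiff_scale; first exact: ndiff_cst.
apply: ndiff_comp; first by apply: ndiff_pair => //; exact: ndiff_cst.
rewrite hom_x0; move: k {IH}; apply/smoothP.
exact/smooth_derive/smooth_mu.
Qed.

Lemma hom_gsmooth t0 : gsmooth s t0.
Proof.
have sh : smooth (fun t : R => t - t0) t0.
  exact: (smoothD (smooth_id t0) (smooth_cst (- t0) t0)).
have sx : smooth (fun t => x (t - t0)) t0.
  by apply: (smooth_comp sh); rewrite subrr; exact: hom_smooth0.
have gx : gsmooth (fun t => psi (x (t - t0))) t0.
  by apply: gsmooth_psi_comp => //; rewrite subrr hom_x0.
apply: gsmooth_near_eq (gsmooth_mulg (gsmooth_cst (s t0) t0) gx).
have : \forall u \near t0, cdom c1 (s (u - t0)).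
  have H : \forall u \near t0 - t0, cdom c1 (s u) by rewrite subrr; exact: hom_near_cdom.
  exact: (near_smooth sh H).
by apply: filterS => t dt; rewrite /x phiK// -hom addrC subrK.
Qed.

Lemma hom_one_parameter : one_parameter_subgroup X s.
Proof.
split => //; last by rewrite derive1E; exact: tangent_derive tan.
split; first exact: hom_continuous.
move=> c Ac; apply: smooth_smooth_on => t ct.
by have [_] := hom_gsmooth t; apply.
Qed.

End OneParameter.

Section LieExp.
Context {R : realType} {n : nat} (G : lieGroupType R n).
Implicit Types (X : 'rV[R]_n).
Local Notation c1 := (chart1 : chart R n G).
Local Notation phi := (cmap c1).

Lemma one_parameter_tangent X (s : R -> G) : one_parameter_subgroup X s -> tangent_at1 s X.
Proof.
case=> [[cs ss]] hom dX.
have s0 : s 0 = 1%g.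
  have := hom 0 0; rewrite addr0 => /(congr1 (fun x => (s 0)^-1 * x)%g).
  by rewrite mulgA mulVg mul1g.
split => //; first exact: cs.
split; last by rewrite -dX derive1E.
have [|_] := ss c1 chart1_atlas [::] 0; first by rewrite /= s0; exact: chart1_unit.
exact.
Qed.

(** [lie_exp] chooses a one-parameter subgroup of velocity [X]: one exists by
    [hom_one_parameter], and it is unique by [doubling_unique]. *)
Lemma lie_expE X : lie_exp G X = gexp G X.
Proof.
have hX : one_parameter_subgroup X (fun t : R => gexp G (t *: X)).
  apply: hom_one_parameter; [exact: gexp_hom | exact: tangent_gexp].
rewrite /lie_exp; set s := xget _ _.
have hs : one_parameter_subgroup X s.
  by apply: (xgetPex (fun=> 1%g)); exists (fun t : R => gexp G (t *: X)).
have [_ homs _] := hs.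
have := doubling_unique (fun t => homs t t) (gexp_doubles G X)
  (one_parameter_tangent hs) (tangent_gexp G X) 1.
by rewrite scale1r.
Qed.

End LieExp.

(** * Further rules for derivatives *)

Section MoreCalculus.
Context {R : realType}.

Lemma fc_linear_continuous {V W : normedModType R} {fV : fin_coord V} (L : {linear V -> W}) :
  continuous L.
Proof.
have -> : (L : V -> W) = fun v => \sum_i fc_coef i v *: L (fc_vec i).
  by apply/funext => v; rewrite -[in LHS](fc_sum v) linear_sum; apply: eq_bigr => i _; rewrite linearZ.
move=> v; apply: cvg_big; first exact: add_continuous.
by move=> i _; apply: cvgZl; exact: fc_continuous.
Qed.

Lemma smooth_sum {V W : normedModType R} (I : Type) (s : seq I) (f : I -> V -> W) x :
  (forall i, smooth (f i) x) -> smooth (fun y => \sum_(i <- s) f i y) x.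
Proof. by move=> H; apply/smoothP => k; apply: ndiff_sum => i; exact: (proj1 (smoothP (f i) x) (H i) k). Qed.

Lemma smooth_coef {V W : normedModType R} {fW : fin_coord W} (f : V -> W) x j :
  smooth f x -> smooth (fun y => fc_coef j (f y)) x.
Proof. by move=> sf; apply: smooth_lin_comp => //; exact: fc_continuous. Qed.

Lemma smooth_moving {U V W : normedModType R} {fV : fin_coord V} {fW : fin_coord W}
    (f : V -> W) (a b : U -> V) x :
  smooth a x -> smooth b x -> smooth f (b x) -> smooth (fun q => 'D_(a q) f (b q)) x.
Proof.
move=> sa sb sf.
apply: (@smooth_near_eq _ _ _ (fun q => \sum_i fc_coef i (a q) *: 'D_(fc_vec i) f (b q))).
  have nd := near_smooth sb (smooth_near_differentiable sf).
  by apply: filterS nd => q dq; rewrite derive_fc.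
apply: smooth_sum => i; apply: smooth_scale; first exact: smooth_coef.
exact: (smooth_comp sb (smooth_derive _ sf)).
Qed.

Lemma sum_partials {n : nat} {W : normedModType R} (f : 'rV[R]_n -> W) x (y : 'rV[R]_n) :
  differentiable f x -> \sum_k y 0 k *: 'D_(delta_mx 0 k) f x = 'D_y f x.
Proof. by move=> df; rewrite (derive_fc y df). Qed.

Lemma derive2_sum {V : normedModType R} (I : Type) (s : seq I) (f : V -> R) x v
    (a : I -> R) (w : I -> V) : smooth f x ->
  'D_v ('D_(\sum_(i <- s) a i *: w i) f) x = \sum_(i <- s) a i * 'D_v ('D_(w i) f) x.
Proof.
move=> sf; rewrite schwarz// derive_dir_sum; last exact/smooth_differentiable/smooth_derive.
apply: eq_bigr => i _; rewrite derive_dirZ; last exact/smooth_differentiable/smooth_derive.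
by rewrite schwarz.
Qed.

Lemma posdef_unitmx {n : nat} (g : 'M[R]_n) :
  (forall v : 'rV[R]_n, v != 0 -> 0 < (v *m g *m v^T) 0 0) -> g \in unitmx.
Proof.
move=> H; rewrite -row_free_unit -kermx_eq0; apply/rowV0P => v.
rewrite sub_kermx => /eqP vg; apply/eqP; apply: contrapT => /negP /H.
by rewrite vg mul0mx mxE ltxx.
Qed.

Lemma smooth_moving2 {U V : normedModType R} {fV : fin_coord V}
    (f : V -> R) (a b c : U -> V) x :
  smooth a x -> smooth b x -> smooth c x -> (\forall z \near c x, smooth f z) ->
  smooth (fun q => 'D_(a q) ('D_(b q) f) (c q)) x.
Proof.
move=> sa sb sc sf.
apply: (@smooth_near_eq _ _ _ (fun q => \sum_i fc_coef i (b q) *: 'D_(a q) ('D_(fc_vec i) f) (c q))).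
  apply: filterS (near_smooth sc sf) => q fq.
  rewrite -[in RHS](fc_sum (b q)); exact: esym (derive2_sum _ _ _ _ fq).
apply: smooth_sum => i; apply: smooth_scale; first exact: smooth_coef.
by apply: smooth_moving => //; exact/smooth_derive/(nbhs_singleton sf).
Qed.

Lemma derive_sumZ {V : normedModType R} (I : Type) (s : seq I) (c : I -> R) (f : I -> V -> R) x v :
  (forall i, differentiable (f i) x) ->
  'D_v (fun q => \sum_(i <- s) c i *: f i q) x = \sum_(i <- s) c i * 'D_v (f i) x.
Proof.
move=> df; have dc i : derivable (fun q => c i *: f i q) x v.
  exact/derivableZ/diff_derivable.
have [_ E] := is_derive_bigsum s dc.
apply: (etrans E); apply: eq_bigr => i _; apply: deriveZ; exact: diff_derivable.
Qed.

End MoreCalculus.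

(** * Minkowski norms and the Euler relations *)

Section MinkowskiNorm.
Context {R : realType} {n : nat} (F : 'rV[R]_n -> R).
Hypothesis mF : minkowski_norm F.
Implicit Types (y z u v w : 'rV[R]_n).

Definition sqnorm y : R := F y ^+ 2.

Lemma fundamental_tensorE (F' : 'rV[R]_n -> R) y u v :
  fundamental_tensor F' y u v = 2^-1 * 'D_u ('D_v (fun z => F' z ^+ 2)) y.
Proof.
have E z w (f : 'rV[R]_n -> R) : derive1 (fun t : R => f (z + t *: w)) 0 = 'D_w f z.
  rewrite derive1E; have := derive_line f z w 0; rewrite scale0r addr0 => ->//.
have E2 : (fun s : R => derive1 (fun t : R => F' (y + s *: u + t *: v) ^+ 2) 0) =
    (fun s : R => 'D_v (fun z => F' z ^+ 2) (y + s *: u)).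
  by apply/funext => s; exact: (E (y + s *: u) v (fun z => F' z ^+ 2)).
by rewrite /fundamental_tensor E2 (E y u ('D_v (fun z => F' z ^+ 2))).
Qed.

Lemma nbhs_neq0 y : y != 0 -> \forall z \near y, z != 0.
Proof.
move=> y0; apply/nbhs_ballP; exists `|y|; first by rewrite /= normr_gt0.
move=> z; rewrite -ball_normE /= => yz; apply: contraTneq yz => ->.
by rewrite subr0 ltxx.
Qed.

Lemma smooth_norm y : y != 0 -> smooth F y.
Proof. by case: mF => _ _ sF _ _ y0; apply: smooth_on_smooth sF _; exact: nbhs_neq0. Qed.

Lemma smooth_sqnorm y : y != 0 -> smooth sqnorm y.
Proof.
move=> y0; have sF := smooth_norm y0.
by have := smooth_scale sF sF; apply.
Qed.

Lemma derive_sqnorm y v : y != 0 -> 'D_v sqnorm y = 2 * F y * 'D_v F y.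
Proof.
move=> y0; have dF := smooth_differentiable (smooth_norm y0).
rewrite (_ : sqnorm = fun y => F y *: F y)//.
by rewrite (derive_scale v dF dF) -[_ *: F y]/(_ * _) -[F y *: _]/(_ * _); ring.
Qed.

(** Homogeneity of degree two, differentiated along the ray of [y]. *)
Lemma euler1 y : y != 0 -> 'D_y sqnorm y = 2 * sqnorm y.
Proof.
case: mF => _ _ _ hF _ y0.
have := derive_line sqnorm y y 0; rewrite scale0r addr0 => ->.
have E : \forall t \near (0 : R), (1 + t) ^+ 2 * sqnorm y = sqnorm (y + t *: y).
  have : \forall t \near (0 : R), `|t| < 1 by apply: nbhs0_lt.
  apply: filterS => t; rewrite ltr_norml => /andP[t1 _].
  rewrite -[X in sqnorm (X + _)]scale1r -scalerDl /sqnorm hF ?exprMn//.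
  by rewrite -lerBlDl sub0r ltW.
rewrite -(near_eq_derive (1 : R) E).
have d1 : is_derive (0 : R) (1 : R) (fun t : R => 1 + t) 1.
  have := is_deriveD (is_derive_cst (1 : R) (0 : R) (1 : R)) (is_derive_id (0 : R) (1 : R)).
  by rewrite add0r.
have [_] := is_deriveZ (sqnorm y) (is_deriveX 2 d1).
rewrite (_ : (_ \*: _) = fun t : R => (1 + t) ^+ 2 * sqnorm y); last first.
  by apply/funext => t; exact: mulrC.
by move=> ->; rewrite addr0 expr1n mulr1 [LHS]mulrC -[_ *: 1]/(_ * 1) mulr1.
Qed.

Lemma derive_moving_id (f : 'rV[R]_n -> R) y u : smooth f y ->
  'D_u (fun q => 'D_q f q) y = 'D_u f y + 'D_u ('D_y f) y.
Proof.
move=> sf; have si := @smooth_id R 'rV[R]_n y.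
apply: (etrans (derive_moving u si si sf)).
by rewrite (derive_id y u).
Qed.

(** The relation [euler1] holds near [y] and can be differentiated; the base
    point of the derivative is also its direction, hence the extra first-order
    term that [derive_moving_id] brings. *)
Lemma euler2 y v : y != 0 -> 'D_v ('D_y sqnorm) y = 'D_v sqnorm y.
Proof.
move=> y0; have sQ := smooth_sqnorm y0.
have E : \forall q \near y, 'D_q sqnorm q = 2 *: sqnorm q.
  by apply: filterS (nbhs_neq0 y0) => q; exact: euler1.
have D1 := near_eq_derive v E.
have D2 := deriveZ 2 (diff_derivable (v := v) (smooth_differentiable sQ)).
have := etrans (esym (derive_moving_id v sQ)) (etrans D1 D2).
by rewrite -[2 *: _]/(2 * _) mulr2n mulrDl !mul1r; exact: addrI.
Qed.

(** The relation [euler2], differentiated once more in the same way. *)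
Lemma euler3 y u v : y != 0 -> 'D_u ('D_v ('D_y sqnorm)) y = 0.
Proof.
move=> y0; have sQ := smooth_sqnorm y0.
have E : \forall q \near y, 'D_q ('D_v sqnorm) q = 'D_v sqnorm q.
  apply: filterS (nbhs_neq0 y0) => q q0.
  apply: (etrans (schwarz q v (smooth_sqnorm q0))).
  exact: euler2.
have H := etrans (esym (derive_moving_id u (smooth_derive v sQ))) (near_eq_derive u E).
have E' : \forall q \near y, 'D_v ('D_y sqnorm) q = 'D_y ('D_v sqnorm) q.
  by apply: filterS (nbhs_neq0 y0) => q q0; apply: schwarz; exact: smooth_sqnorm.
apply: (etrans (near_eq_derive u E')).
by move: H; rewrite -[X in _ = X]addr0 => /addrI.
Qed.

End MinkowskiNorm.

(** * Geodesic coefficients of a metric given by a moving coframe *)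

Section EulerLagrange.
Context {R : realType} {n : nat} (F : 'rV[R]_n -> R).
Hypothesis mF : minkowski_norm F.
Local Notation Q := (sqnorm F).
Local Notation d k := (delta_mx 0 k : 'rV[R]_n).

(* [A u] reads the tangent vectors at the point [u] in a fixed vector space.
   The vector [y] is the velocity of a curve and [z] the opposite of its
   acceleration: [A_z] says that [A] takes a constant value on the velocity, to
   first order at [x0].  The hypothesis [critical] is the vanishing of the terms
   of the Euler-Lagrange equation that do not contain the acceleration. *)
Variables (A : 'rV[R]_n -> 'rV[R]_n -> 'rV[R]_n) (x0 y z : 'rV[R]_n).
Hypothesis A_linear : \forall u \near x0, linear (A u).
Hypothesis A_smooth : forall w, smooth (fun u => A u w) x0.
Hypothesis A_inj : forall w, A x0 w = 0 -> w = 0.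
Hypothesis y_neq0 : y != 0.
Hypothesis A_z : A x0 z = 'D_y (fun u => A u y) x0.
Hypothesis critical : forall w,
  'D_('D_y (fun u => A u w) x0 - 'D_w (fun u => A u y) x0) Q (A x0 y) = 0.

Local Notation Fm := (fun u w => F (A u w)).

Lemma Ay_neq0 : A x0 y != 0.
Proof. by apply: contra_neq y_neq0; exact: A_inj. Qed.

Lemma metric_mxE u w i j : linear (A u) ->
  metric_mx Fm u w i j = 2^-1 * 'D_(A u (d i)) ('D_(A u (d j)) Q) (A u w).
Proof.
move=> lA; rewrite /metric_mx mxE.
have AE v v' (s t : R) : A u (w + s *: v + t *: v') = A u w + s *: A u v + t *: A u v'.
  by rewrite addrC lA addrC [w + _]addrC lA [_ + A u w]addrC.
apply: (etrans _ (fundamental_tensorE F (A u w) (A u (d i)) (A u (d j)))).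
rewrite /fundamental_tensor.
by under eq_fun => s do under eq_fun => t do rewrite AE.
Qed.

Lemma A_sum u w : linear (A u) -> A u w = \sum_k w 0 k *: A u (d k).
Proof.
move=> lA; pose L : {linear 'rV[R]_n -> 'rV[R]_n} :=
  HB.pack (A u) (GRing.isLinear.Build _ _ _ _ _ lA).
rewrite -[LHS]/(L w) [in LHS](row_sum_delta w) linear_sum.
by apply: eq_bigr => k _; rewrite linearZ.
Qed.

Lemma smooth_A_neq0 : \forall u \near x0, A u y != 0.
Proof. exact: (near_smooth (A_smooth y) (nbhs_neq0 Ay_neq0)). Qed.

Lemma sQ : smooth Q (A x0 y). Proof. exact: (smooth_sqnorm mF Ay_neq0). Qed.

Let lin0 : linear (A x0) := nbhs_singleton A_linear.

Lemma metric_unitmx : metric_mx Fm x0 y \in unitmx.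
Proof.
apply: posdef_unitmx => v v0.
have -> : (v *m metric_mx Fm x0 y *m v^T) 0 0 = fundamental_tensor F (A x0 y) (A x0 v) (A x0 v).
  rewrite fundamental_tensorE -/Q mxE.
  transitivity (2^-1 * 'D_(A x0 v) ('D_(\sum_k v 0 k *: A x0 (d k)) Q) (A x0 y)); last by rewrite -(A_sum v lin0).
  rewrite (derive2_sum _ _ _ _ sQ) mulr_sumr; apply: eq_bigr => j _.
  rewrite !mxE mulrCA mulrC; congr (_ * _).
  rewrite (schwarz (A x0 v) (A x0 (d j)) sQ) (A_sum v lin0).
  rewrite (derive2_sum _ _ _ _ sQ) mulr_sumr; apply: eq_bigr => i _.
  by rewrite (metric_mxE y i j lin0) (schwarz (A x0 (d j)) (A x0 (d i)) sQ) mulrCA.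
case: mF => _ _ _ _; apply; first exact: Ay_neq0.
by apply: contra_neq v0; exact: A_inj.
Qed.

Lemma metric_sym i j : metric_mx Fm x0 y i j = metric_mx Fm x0 y j i.
Proof.
by rewrite (metric_mxE y i j lin0) (metric_mxE y j i lin0) (schwarz (A x0 (d i)) (A x0 (d j)) sQ).
Qed.

Lemma derive_A w v : differentiable (A x0) w /\ 'D_v (A x0) w = A x0 v.
Proof.
pose L : {linear 'rV[R]_n -> 'rV[R]_n} :=
  HB.pack (A x0) (GRing.isLinear.Build _ _ _ _ _ lin0).
have cL : continuous L by exact: fc_linear_continuous.
by split; [exact: (linear_differentiable w cL) | exact: (derive_lin w v cL)].
Qed.

Lemma metric_dyE s i j : metric_dy Fm x0 y s i j =
  2^-1 * 'D_(A x0 (d s)) ('D_(A x0 (d i)) ('D_(A x0 (d j)) Q)) (A x0 y).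
Proof.
pose H := 'D_(A x0 (d i)) ('D_(A x0 (d j)) Q).
have dH : differentiable H (A x0 y) by exact/smooth_differentiable/smooth_derive/smooth_derive/sQ.
have [dA EA] := derive_A y (d s).
have E : (fun y' => metric_mx Fm x0 y' i j : R) = (fun y' => 2^-1 *: (H \o A x0) y').
  by apply/funext => y'; exact: (metric_mxE y' i j lin0).
rewrite /metric_dy E.
have dHA : differentiable (H \o A x0) y by exact: differentiable_comp.
apply: (etrans (deriveZ 2^-1 (diff_derivable (v := d s) dHA))).
apply: (f_equal (fun r => 2^-1 * r)); apply: (etrans (derive_comp (d s) dA dH)).
exact: (f_equal (fun w => 'D_w H (A x0 y)) EA).
Qed.

(** This is [euler3] read through [A x0].  It makes the corrections by the
    nonlinear connection disappear in contractions with [y]. *)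
Lemma metric_dy_kernel s i : \sum_j y 0 j * metric_dy Fm x0 y s i j = 0.
Proof.
pose H j := 'D_(A x0 (d i)) ('D_(A x0 (d j)) Q).
have dH j : differentiable (H j) (A x0 y) by exact/smooth_differentiable/smooth_derive/smooth_derive/sQ.
transitivity (2^-1 * \sum_j y 0 j * 'D_(A x0 (d s)) (H j) (A x0 y)).
  by rewrite mulr_sumr; apply: eq_bigr => j _; rewrite metric_dyE mulrCA.
rewrite -(derive_sumZ _ _ _ dH).
have E : \forall q \near A x0 y, \sum_j y 0 j *: H j q = 'D_(A x0 (d i)) ('D_(A x0 y) Q) q.
  apply: filterS (nbhs_neq0 Ay_neq0) => q q0.
  apply: (etrans (esym (derive2_sum _ _ _ _ (smooth_sqnorm mF q0)))).
  by rewrite -(A_sum y lin0).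
by rewrite (near_eq_derive _ E) (euler3 mF _ _ Ay_neq0) mulr0.
Qed.

Lemma metric_delta_sum k l : \sum_j y 0 j * metric_delta Fm x0 y k l j =
  \sum_j y 0 j * metric_dx Fm x0 y k l j.
Proof.
rewrite /metric_delta.
under eq_bigr do rewrite mulrBr mulr_sumr.
rewrite sumrB exchange_big /= [X in _ - X]big1 ?subr0// => s _.
under eq_bigr do rewrite mulrCA.
by rewrite -mulr_sumr metric_dy_kernel mulr0.
Qed.

Let m i j u : R := metric_mx Fm u y i j.
(* The momentum of [y], that is the derivative of the squared norm in the
   vertical direction [l]. *)
Let p l u : R := 'D_(A u (d l)) Q (A u y).

Lemma smooth_m i j : smooth (m i j) x0.
Proof.
apply: (@smooth_near_eq _ _ _ (fun u => 2^-1 *: 'D_(A u (d i)) ('D_(A u (d j)) Q) (A u y))).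
  by apply: filterS A_linear => u lA; rewrite /m (metric_mxE y i j lA).
apply: smooth_scale; first exact: smooth_cst.
apply: smooth_moving2 => //.
by apply: filterS (nbhs_neq0 Ay_neq0) => q; exact: smooth_sqnorm.
Qed.

Lemma smooth_p l : smooth (p l) x0.
Proof. by apply: smooth_moving => //; exact: sQ. Qed.

Lemma sum_m l : \forall u \near x0, \sum_j y 0 j *: m l j u = 2^-1 *: p l u.
Proof.
apply: filterS2 A_linear smooth_A_neq0 => u lA Ay0.
have sQu := smooth_sqnorm mF Ay0.
transitivity (2^-1 * \sum_j y 0 j * 'D_(A u (d l)) ('D_(A u (d j)) Q) (A u y)).
  rewrite mulr_sumr; apply: eq_bigr => j _.
  by rewrite /m (metric_mxE y l j lA) -[_ *: _]/(_ * _) mulrCA.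
rewrite -(derive2_sum _ _ _ _ sQu) -(A_sum y lA).
by rewrite (euler2 mF (A u (d l)) Ay0).
Qed.

Lemma sum_p : \forall u \near x0, \sum_j y 0 j *: (2^-1 *: p j u) = Q (A u y).
Proof.
apply: filterS2 A_linear smooth_A_neq0 => u lA Ay0.
have dQu := smooth_differentiable (smooth_sqnorm mF Ay0).
transitivity (2^-1 * 'D_(\sum_j y 0 j *: A u (d j)) Q (A u y)).
  rewrite (derive_dir_sum _ _ _ dQu) mulr_sumr; apply: eq_bigr => j _.
  by rewrite (derive_dirZ _ _ dQu) -[_ *: (2^-1 *: _)]/(_ * (2^-1 * _)) mulrCA.
by rewrite -(A_sum y lA) (euler1 mF Ay0) mulrA mulVf ?mul1r.
Qed.

Lemma sum_dx l : \sum_a y 0 a * \sum_b y 0 b * metric_dx Fm x0 y a l b = 2^-1 * 'D_y (p l) x0.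
Proof.
have dm j := smooth_differentiable (smooth_m l j).
under eq_bigr do rewrite mulr_sumr.
rewrite exchange_big /=.
transitivity (\sum_b y 0 b * 'D_y (m l b) x0).
  apply: eq_bigr => b _; rewrite -(sum_partials y (dm b)) mulr_sumr.
  by apply: eq_bigr => a _; rewrite mulrCA.
rewrite -(derive_sumZ _ _ _ dm) (near_eq_derive _ (sum_m l)).
exact: (deriveZ 2^-1 (diff_derivable (v := y) (smooth_differentiable (smooth_p l)))).
Qed.

Lemma sum_dx' l : \sum_a y 0 a * \sum_b y 0 b * metric_dx Fm x0 y l a b =
  'D_('D_(d l) (fun u => A u y) x0) Q (A x0 y).
Proof.
have dp j : differentiable (fun u => 2^-1 *: p j u) x0.
  exact/differentiableZ/smooth_differentiable/smooth_p.
transitivity (\sum_a y 0 a * 'D_(d l) (fun u => 2^-1 *: p a u) x0).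
  apply: eq_bigr => a _; congr (_ * _).
  rewrite -(near_eq_derive (d l) (sum_m a)).
  by rewrite (derive_sumZ _ _ _ (fun b => smooth_differentiable (smooth_m a b))).
rewrite -(derive_sumZ _ _ _ dp) (near_eq_derive _ sum_p).
exact: (derive_comp (d l) (smooth_differentiable (A_smooth y)) (smooth_differentiable sQ)).
Qed.

(** The derivative of the momentum along [y] has a term for the variation of
    the frame and one for the variation of the velocity.  By [critical] the first
    one cancels the derivative of the energy with respect to the position, and
    [A_z] expresses the second one by the acceleration. *)
Lemma geodesic_covector l :
  2 * (2^-1 * 'D_y (p l) x0) - 'D_('D_(d l) (fun u => A u y) x0) Q (A x0 y) =
  2 * \sum_k z 0 k * metric_mx Fm x0 y k l.
Proof.
rewrite mulrA divff// mul1r.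
have dQ := smooth_differentiable sQ.
have Dp : 'D_y (p l) x0 = 'D_('D_y (fun u => A u (d l)) x0) Q (A x0 y) +
   'D_('D_y (fun u => A u y) x0) ('D_(A x0 (d l)) Q) (A x0 y).
  exact: (derive_moving y (A_smooth (d l)) (A_smooth y) sQ).
have := critical (d l); rewrite (derive_dirD _ _ dQ) (derive_dirN _ dQ) => /eqP.
rewrite subr_eq0 => /eqP C.
rewrite Dp C addrC addKr -A_z (A_sum z lin0).
rewrite derive_dir_sum; last exact/smooth_differentiable/smooth_derive/sQ.
rewrite mulr_sumr; apply: eq_bigr => k _.
rewrite (metric_mxE y k l lin0) derive_dirZ; last exact/smooth_differentiable/smooth_derive/sQ.
by rewrite -[_ *: _]/(_ * _); field.
Qed.

(** In the contraction with [y] twice, [metric_delta] can be replaced with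
    [metric_dx]; the sum is then the Euler-Lagrange covector of
    [geodesic_covector], with its index raised by the inverse of the metric. *)
Lemma chern_contraction i :
  \sum_j \sum_k y 0 j * y 0 k * chern_connection Fm x0 y i j k = z 0 i.
Proof.
pose gi := invmx (metric_mx Fm x0 y).
transitivity (\sum_l gi i l * (2^-1 *
   (\sum_j \sum_k y 0 j * y 0 k * (metric_delta Fm x0 y k l j + metric_delta Fm x0 y j l k
      - metric_delta Fm x0 y l j k)))).
  rewrite /chern_connection -/gi.
  under eq_bigr => j _ do under eq_bigr => k _ do rewrite mulrCA mulr_sumr mulr_sumr.
  under eq_bigr => j _ do rewrite exchange_big /=.
  rewrite exchange_big /=; apply: eq_bigr => l _.
  rewrite mulrA mulr_sumr; apply: eq_bigr => j _.
  rewrite mulr_sumr; apply: eq_bigr => k _.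
  move: (gi i l) (y 0 j) (y 0 k) (_ + _ - _) => a b c T; by field.
transitivity (\sum_l gi i l * \sum_k z 0 k * metric_mx Fm x0 y k l).
  apply: eq_bigr => l _; congr (_ * _).
  have -> : \sum_j \sum_k y 0 j * y 0 k * (metric_delta Fm x0 y k l j + metric_delta Fm x0 y j l k
      - metric_delta Fm x0 y l j k) =
     2 * (\sum_a y 0 a * \sum_b y 0 b * metric_dx Fm x0 y a l b) -
       \sum_a y 0 a * \sum_b y 0 b * metric_dx Fm x0 y l a b.
    under eq_bigr => j _ do under eq_bigr => k _ do rewrite mulrBr mulrDr.
    under eq_bigr => j _ do rewrite sumrB big_split /=.
    rewrite sumrB big_split /=; congr (_ - _); last first.
      apply: eq_bigr => a _; rewrite -metric_delta_sum mulr_sumr.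
      by apply: eq_bigr => b _; rewrite mulrA.
    have E : \sum_j \sum_k y 0 j * y 0 k * metric_delta Fm x0 y j l k =
      \sum_a y 0 a * \sum_b y 0 b * metric_dx Fm x0 y a l b.
      apply: eq_bigr => a _; rewrite -metric_delta_sum mulr_sumr.
      by apply: eq_bigr => b _; rewrite mulrA.
    rewrite mulr2n mulrDl !mul1r -E; congr (_ + _).
    rewrite exchange_big /=; apply: eq_bigr => a _; apply: eq_bigr => b _.
    by rewrite [y 0 b * _]mulrC.
  rewrite sum_dx sum_dx' geodesic_covector mulrA mulVf ?mul1r//.
under eq_bigr => l _ do rewrite mulr_sumr.
rewrite exchange_big /=.
transitivity (\sum_k z 0 k * (gi *m metric_mx Fm x0 y) i k).
  apply: eq_bigr => k _; rewrite mxE mulr_sumr; apply: eq_bigr => l _.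
  by rewrite mulrCA (metric_sym k l).
rewrite mulVmx; last exact: metric_unitmx.
rewrite (bigD1 i)//= mxE eqxx mulr1 big1 ?addr0// => k ki.
by rewrite mxE eq_sym (negbTE ki) mulr0.
Qed.

End EulerLagrange.

(** * The Maurer-Cartan form *)

Section MaurerCartan.
Context {R : realType} {n : nat} (G : lieGroupType R n).
Local Notation c1 := (chart1 : chart R n G).
Local Notation phi := (cmap c1).
Local Notation psi := (cinv c1).
Local Notation e := (phi 1%g).
Local Notation V := 'rV[R]_n.

Variables (c : chart R n G) (g0 : G).
Hypotheses (Ac : atlas c) (cg0 : cdom c g0).
Let u0 := cmap c g0.

(** Left division [g^-1 * h], from the chart [c] to the chart at the unit. *)
Definition ldiv (q : V * V) : V := phi ((cinv c q.1)^-1 * cinv c q.2)%g.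

(** The left Maurer-Cartan form [g^-1 dg] in the chart [c]; the left-invariant
    metric of [F] is [F] applied to it. *)
Definition mc_form (u w : V) : V := 'D_w (fun v => phi ((cinv c u)^-1 * cinv c v)%g) u.

Lemma mc_formE u w : mc_form u w = 'D_(0, w) ldiv (u, u).
Proof. exact: esym (derive_snd ldiv u u w). Qed.

Lemma ldiv_diag u : ldiv (u, u) = e. Proof. by rewrite /ldiv /= mulVg. Qed.

Lemma gsmooth_ldiv u : (cmap c @` cdom c) u ->
  gsmooth (fun q : V * V => (cinv c q.1)^-1 * cinv c q.2)%g (u, u).
Proof.
move=> cu; have gc := gsmooth_cinv Ac cu.
have g1 : gsmooth (fun q : V * V => cinv c q.1) (u, u).
  exact: (@gsmooth_comp R n G _ _ _ fst (cinv c) (u, u) (smooth_fst _) gc).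
have g2 : gsmooth (fun q : V * V => cinv c q.2) (u, u).
  exact: (@gsmooth_comp R n G _ _ _ snd (cinv c) (u, u) (smooth_snd _) gc).
exact: (gsmooth_mulg (gsmooth_invg g1) g2).
Qed.

Lemma smooth_ldiv u : (cmap c @` cdom c) u -> smooth ldiv (u, u).
Proof. by move=> cu; apply: (gsmooth_phi (gsmooth_ldiv cu)); rewrite /= mulVg. Qed.

Lemma cu0 : (cmap c @` cdom c) u0. Proof. by exists g0. Qed.

Lemma near_u0 : \forall u \near u0, (cmap c @` cdom c) u.
Proof. exact: nbhs_cimg. Qed.

Lemma mc_linear : \forall u \near u0, linear (mc_form u).
Proof.
apply: filterS near_u0 => u cu a v w.
have dl := smooth_differentiable (smooth_ldiv cu).
have E : ((0, a *: v + w) : V * V) = a *: (0, v) + (0, w).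
  by rewrite -[RHS]/(a *: 0 + 0, a *: v + w) scaler0 addr0.
rewrite !mc_formE; apply: (etrans (f_equal (fun d => 'D_d ldiv (u, u)) E)).
apply: (etrans (derive_dirD _ _ dl)).
exact: (f_equal (fun r => r + 'D_(0, w) ldiv (u, u)) (derive_dirZ a (0, v) dl)).
Qed.

Lemma mc_smooth w : smooth (fun u => mc_form u w) u0.
Proof.
have -> : (fun u => mc_form u w) = 'D_(0, w) ldiv \o (fun u : V => (u, u)).
  by apply/funext => u; exact: mc_formE.
exact: (smooth_comp (smooth_diagonal u0) (smooth_derive (0, w) (smooth_ldiv cu0))).
Qed.

Lemma derive_mc xi eta : 'D_xi (fun u => mc_form u eta) u0 =
  'D_(xi, xi) ('D_(0, eta) ldiv) (u0, u0).
Proof.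
have -> : (fun u => mc_form u eta) = 'D_(0, eta) ldiv \o (fun u : V => (u, u)).
  by apply/funext => u; exact: mc_formE.
have dD := smooth_differentiable (smooth_derive (0, eta) (smooth_ldiv cu0)).
apply: (etrans (derive_comp xi (smooth_differentiable (smooth_diagonal u0)) dD)).
exact: (f_equal (fun w => 'D_w ('D_(0, eta) ldiv) (u0, u0)) (derive_diagonal u0 xi)).
Qed.

(** [ldiv] is constant on the diagonal. *)
Lemma derive_ldiv_fst xi : 'D_(xi, 0) ldiv (u0, u0) = - mc_form u0 xi.
Proof.
have dl := smooth_differentiable (smooth_ldiv cu0).
have E : 'D_(xi, xi) ldiv (u0, u0) = 0.
  have -> : 'D_(xi, xi) ldiv (u0, u0) = 'D_xi (ldiv \o (fun u : V => (u, u))) u0.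
    apply: esym; apply: (etrans (derive_comp xi (smooth_differentiable (smooth_diagonal u0)) dl)).
    exact: (f_equal (fun w => 'D_w ldiv (u0, u0)) (derive_diagonal u0 xi)).
  have -> : ldiv \o (fun u : V => (u, u)) = cst e.
    by apply/funext => u; exact: ldiv_diag.
  exact: derive_cst.
move: E; rewrite (pair_split xi xi) (derive_dirD _ _ dl) -mc_formE => /eqP.
by rewrite addr_eq0 => /eqP.
Qed.

(** The identity [(g^-1 * g0) * (g0^-1 * h) = g^-1 * h] separates the two
    variables of [ldiv]. *)
Lemma ldiv_mu : \forall u \near u0, \forall v \near u0,
  mu G (ldiv (u, u0), ldiv (u0, v)) = ldiv (u, v).
Proof.
have gl := gsmooth_ldiv cu0.
have nl : \forall q \near (u0, u0), cdom c1 ((cinv c q.1)^-1 * cinv c q.2)%g.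
  by apply: (gsmooth_near gl); rewrite /= mulVg; exact: nbhs1_cdom.
have s_l : smooth (fun u : V => (u, u0)) u0.
  exact: (smooth_pair (smooth_id u0) (smooth_cst u0 u0)).
have s_r : smooth (fun u : V => (u0, u)) u0.
  exact: (smooth_pair (smooth_cst u0 u0) (smooth_id u0)).
have n1 : \forall u \near u0, cdom c1 ((cinv c u)^-1 * cinv c u0)%g := near_smooth s_l nl.
have n2 : \forall v \near u0, cdom c1 ((cinv c u0)^-1 * cinv c v)%g := near_smooth s_r nl.
apply: filterS n1 => u du; apply: filterS n2 => v dv.
by rewrite /mu /ldiv /= !phiK// mulgA mulgK.
Qed.

(** By [ldiv_mu] the mixed second derivatives of [ldiv] are those of [mu] at the
    unit; the sign is that of [derive_ldiv_fst]. *)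
Lemma derive_ldiv_mixed xi eta : 'D_(xi, 0) ('D_(0, eta) ldiv) (u0, u0) =
  - 'D_(mc_form u0 xi, 0) ('D_(0, mc_form u0 eta) (mu G)) (e, e).
Proof.
set B := mc_form u0 eta.
pose L u := ldiv (u, u0).
have Lu0 : L u0 = e by exact: ldiv_diag.
have sl := smooth_ldiv cu0.
have s_l : smooth (fun u : V => (u, u0)) u0.
  exact: (smooth_pair (smooth_id u0) (smooth_cst u0 u0)).
have s_r : smooth (fun u : V => (u0, u)) u0.
  exact: (smooth_pair (smooth_cst u0 u0) (smooth_id u0)).
have sL : smooth L u0 by exact: (smooth_comp s_l sl).
have dr : differentiable (fun v => ldiv (u0, v)) u0.
  exact: (smooth_differentiable (smooth_comp s_r sl)).
have sLe : smooth (fun u => (L u, e)) u0 by exact: (smooth_pair sL (smooth_cst e u0)).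
have nmu : \forall u \near u0, differentiable (mu G) (L u, e).
  have H : \forall q \near (L u0, e), differentiable (mu G) q.
    by rewrite Lu0; exact/smooth_near_differentiable/smooth_mu.
  exact: (near_smooth sLe H).
have E : \forall u \near u0, 'D_(0, eta) ldiv (u, u0) = 'D_(0, B) (mu G) (L u, e).
  apply: filterS2 nmu ldiv_mu => u dmu Emu.
  apply: (etrans (derive_snd ldiv u u0 eta)).
  apply: (etrans (esym (near_eq_derive eta Emu))).
  have dp : differentiable (fun v => (L u, ldiv (u0, v))) u0.
    exact: (differentiable_pair (differentiable_cst (L u) u0) dr).
  have dmu' : differentiable (mu G) (L u, ldiv (u0, u0)) by rewrite ldiv_diag.
  apply: (etrans (derive_comp eta dp dmu')).
  have Dp : 'D_eta (fun v => (L u, ldiv (u0, v))) u0 = (0, B).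
    apply: (etrans (derive_pair eta (differentiable_cst (L u) u0) dr)).
    exact: (f_equal2 pair (derive_cst (L u) u0 eta) erefl).
  by rewrite Dp ldiv_diag.
apply: (etrans (derive_fst ('D_(0, eta) ldiv) u0 u0 xi)).
apply: (etrans (near_eq_derive xi E)).
have dmB : differentiable ('D_(0, B) (mu G)) (L u0, e).
  by rewrite Lu0; exact/smooth_differentiable/smooth_derive/smooth_mu.
apply: (etrans (derive_comp xi (smooth_differentiable sLe) dmB)).
have DL : 'D_xi (fun u => (L u, e)) u0 = - (mc_form u0 xi, 0).
  apply: (etrans (derive_pair xi (smooth_differentiable sL) (differentiable_cst e u0))).
  have E1 : 'D_xi L u0 = - mc_form u0 xi.
    by apply: (etrans (esym (derive_fst ldiv u0 u0 xi))); exact: derive_ldiv_fst.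
  apply: (etrans (f_equal2 pair E1 (derive_cst e u0 xi))).
  by rewrite -[RHS]/(_, _) /= oppr0.
apply: (etrans (f_equal (fun w => 'D_w ('D_(0, B) (mu G)) (L u0, e)) DL)).
apply: (etrans (derive_dirN _ dmB)).
exact: (f_equal (fun q => - 'D_(mc_form u0 xi, 0) ('D_(0, B) (mu G)) (q, e)) Lu0).
Qed.

(** The structure equation of Maurer and Cartan.  By [derive_mc] each term on the
    left is the sum of a mixed second derivative of [ldiv] and of a second
    derivative in its second argument only.  The latter are symmetric and cancel;
    the former are second derivatives of [mu] by [derive_ldiv_mixed], whose
    difference is the bracket. *)
Lemma maurer_cartan xi eta :
  'D_xi (fun u => mc_form u eta) u0 - 'D_eta (fun u => mc_form u xi) u0 =
  lie_bracket G (mc_form u0 eta) (mc_form u0 xi).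
Proof.
have sl := smooth_ldiv cu0.
have S x y : 'D_x (fun u => mc_form u y) u0 =
    - 'D_(mc_form u0 x, 0) ('D_(0, mc_form u0 y) (mu G)) (e, e)
    + 'D_(0, x) ('D_(0, y) ldiv) (u0, u0).
  have dD := smooth_differentiable (smooth_derive (0, y) sl).
  apply: (etrans (derive_mc x y)); rewrite (pair_split x x).
  apply: (etrans (derive_dirD _ _ dD)).
  exact: (f_equal (fun v => v + _) (derive_ldiv_mixed x y)).
have fin (a b a1 b1 s t : V) : a = - a1 + s -> b = - b1 + t -> s = t -> a - b = b1 - a1.
  by move=> -> -> ->; rewrite opprD opprK addrACA subrr addr0 addrC.
apply: (etrans _ (esym (lie_bracketE G _ _))).
exact: (fin _ _ _ _ _ _ (S xi eta) (S eta xi) (schwarz (0, xi) (0, eta) sl)).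
Qed.

(** Division by [g0] on the left has a differentiable inverse, multiplication by
    [g0]. *)
Lemma mc_inj w : mc_form u0 w = 0 -> w = 0.
Proof.
move=> w0.
pose N p := cmap c (g0 * psi p)%g.
have sN : smooth N e.
  have [_ H] := gsmooth_mulg (gsmooth_cst g0 e) (gsmooth_psi G).
  by apply: H => //; rewrite psi1 mulg1.
have s_r : smooth (fun u : V => (u0, u)) u0.
  exact: (smooth_pair (smooth_cst u0 u0) (smooth_id u0)).
have sr : smooth (fun v => ldiv (u0, v)) u0 by exact: (smooth_comp s_r (smooth_ldiv cu0)).
have E : \forall v \near u0, N (ldiv (u0, v)) = v.
  have n1 : \forall v \near u0, cdom c1 ((cinv c u0)^-1 * cinv c v)%g.
    have nl : \forall q \near (u0, u0), cdom c1 ((cinv c q.1)^-1 * cinv c q.2)%g.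
      by apply: (gsmooth_near (gsmooth_ldiv cu0)); rewrite /= mulVg; exact: nbhs1_cdom.
    exact: (near_smooth s_r nl).
  apply: filterS2 n1 near_u0 => v dv cv.
  rewrite /N /ldiv /= phiK// {1}/u0 (cmapK cg0) mulVKg; exact: cinvK.
have dN : differentiable N (ldiv (u0, u0)) by rewrite ldiv_diag; exact: smooth_differentiable.
have := etrans (esym (derive_comp w (smooth_differentiable sr) dN)) (near_eq_derive w E).
rewrite derive_id => <-.
have -> : 'D_w (fun v => ldiv (u0, v)) u0 = 0 by exact: w0.
exact: derive0.
Qed.

End MaurerCartan.

(** * Extrema on adjoint orbits *)

Lemma derive_max {R : realType} {V : normedModType R} (f : V -> R) x v :
  differentiable f x -> (forall w, f w <= f x) -> 'D_v f x = 0.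
Proof.
move=> df fx.
suff H w : 'd f x w <= 0.
  rewrite deriveE//; apply/eqP; rewrite eq_le H /=.
  by rewrite -oppr_le0 -linearN.
apply/ler_addgt0Pl => ep ep0; rewrite addr0.
have w1 : 0 < `|w| + 1 by rewrite ltr_wpDl.
have cw : {for 0, continuous (fun t : R => t *: w)} by exact: scalel_continuous.
have Hw : \forall h \near 0 *: w, `|f (h + x) - f x - 'd f x h| <= ep / (`|w| + 1) * `|h|.
  by rewrite scale0r; exact: (differentiable_elim df (divr_gt0 ep0 w1)).
have nw : \forall t \near 0^'+, `|f (t *: w + x) - f x - 'd f x (t *: w)| <=
    ep / (`|w| + 1) * `|t *: w|.
  by apply: cvg_within; exact: (cw _ Hw).
have [t [t0]] := filter_ex (filterI (nbhs_right_gt (0 : R)) nw).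
have -> : 'd f x (t *: w) = t * 'd f x w by exact: linearZ.
rewrite normrZ gtr0_norm// => /ler_normlP[+ _].
have := fx (t *: w + x); rewrite -subr_le0.
move: (f _ - f x) => d d0; rewrite opprB lerBlDr => le.
rewrite -(ler_pM2l t0); apply: le_trans le _.
rewrite mulrCA -[leRHS]addr0; apply: lerD => //; rewrite ler_pM2l// -mulrA.
by rewrite -[leRHS]mulr1 ler_pM2l// mulrC ler_pdivrMr// mul1r lerDl.
Qed.

Section Extremum.
Context {R : realType} {n : nat} (G : lieGroupType R n).
Local Notation phi := (cmap (chart1 : chart R n G)).
Local Notation psi := (cinv (chart1 : chart R n G)).
Local Notation e := (phi 1%g).

Lemma smooth_Ad_psi Y : smooth (fun p => Ad (psi p : G) Y) e.
Proof.
have -> : (fun p => Ad (psi p) Y) = 'D_(0, Y) (conj_mu G) \o (fun p => (p, e)).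
  by apply/funext => p; exact: Ad_psiE.
apply: (smooth_comp (smooth_pair (smooth_id e) (smooth_cst e e))).
exact: (smooth_derive (0, Y) (smooth_conj_mu G)).
Qed.

(** The function [p |-> f (Ad (psi p) Y)] is maximal at the unit, and by
    [derive_Ad] its derivative there in the direction [Z] is that of [f] along
    [lie_bracket G Z Y]. *)
Lemma orbit_max (f : 'rV[R]_n -> R) Y Z : differentiable f Y ->
  (forall g : G, f (Ad g Y) <= f Y) -> 'D_(lie_bracket G Z Y) f Y = 0.
Proof.
move=> df fmax.
have A1 : Ad (psi e : G) Y = Y by rewrite psi1 Ad1.
have dA := smooth_differentiable (smooth_Ad_psi Y).
have df1 : differentiable f (Ad (psi e : G) Y) by rewrite A1.
have E := derive_comp Z dA df1.
rewrite -(derive_Ad G Z Y) -[in X in 'D_ _ _ X]A1 -E.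
apply: derive_max; first exact: differentiable_comp.
by move=> w /=; rewrite A1; exact: fmax.
Qed.

Lemma orbit_min (f : 'rV[R]_n -> R) Y Z : differentiable f Y ->
  (forall g : G, f Y <= f (Ad g Y)) -> 'D_(lie_bracket G Z Y) f Y = 0.
Proof.
move=> df fmin; apply: oppr_inj; rewrite oppr0.
apply: (etrans (esym (deriveN (diff_derivable df)))).
apply: orbit_max; first exact: differentiableN.
by move=> g; rewrite /= lerN2; exact: fmin.
Qed.

End Extremum.

(** * One-parameter subgroups as geodesics *)

Section GeodesicSubgroup.
Context {R : realType} {n : nat} (G : lieGroupType R n).
Local Notation c1 := (chart1 : chart R n G).
Local Notation phi := (cmap c1).
Local Notation psi := (cinv c1).
Local Notation e := (phi 1%g).
Local Notation V := 'rV[R]_n.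

Variables (F : V -> R) (Y : V).
Hypothesis mF : minkowski_norm F.
Hypothesis Y_neq0 : Y != 0.
Hypothesis Y_critical : forall Z, 'D_(lie_bracket G Z Y) F Y = 0.

Let s (t : R) : G := gexp G (t *: Y).
Let hom : forall a b, s (a + b) = (s a * s b)%g := gexp_hom G Y.
Let tan : tangent_at1 s Y := tangent_gexp G Y.

Section InChart.
Variables (c : chart R n G) (t0 : R).
Hypotheses (Ac : atlas c) (ct0 : cdom c (s t0)).
Let x (t : R) : V := cmap c (s t).
Let y := 'D_1 x t0.

Lemma smooth_x t : cdom c (s t) -> smooth x t.
Proof. by move=> ct; exact: ((hom_gsmooth hom tan t).2 c Ac ct). Qed.

Lemma near_cdom t : cdom c (s t) -> \forall t' \near t, cdom c (s t').
Proof. by move=> ct; exact: (hom_continuous hom tan (nbhs_cdom ct)). Qed.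

(** [(s t)^-1 * s t' = s (t' - t)], and the derivative of the right-hand side at
    [t' = t] is [Y]. *)
Lemma mc_velocity t : cdom c (s t) -> mc_form c (x t) ('D_1 x t) = Y.
Proof.
move=> ct; have cxt : (cmap c @` cdom c) (x t) by exists (s t).
have E : \forall t' \near t, phi (s (t' - t)) = ldiv c (x t, x t').
  apply: filterS (near_cdom ct) => t' ct'; rewrite /ldiv /= !cmapK//.
  by rewrite -[in RHS](subrK t t') [in RHS]addrC (hom t (t' - t)) mulKg.
have sx := smooth_x ct.
have sp : smooth (fun t' => (x t, x t')) t by exact: (smooth_pair (smooth_cst (x t) t) sx).
have dsh : is_derive t (1 : R) (fun t' : R => t' - t) 1.
  have := is_deriveB (is_derive_id t (1 : R)) (is_derive_cst t t (1 : R)).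
  by rewrite subr0.
have dt : differentiable (fun t' : R => phi (s t')) (t - t).
  by rewrite subrr; exact: (tangent_differentiable tan).
have D1 : 'D_1 (fun t' => phi (s (t' - t))) t = Y.
  have ddsh : differentiable (fun t' : R => t' - t) t by apply/derivable1_diffP; case: dsh.
  apply: (etrans (derive_comp (1 : R) ddsh dt)).
  by have [_ ->] := dsh; rewrite subrr; exact: (tangent_derive tan).
apply: (etrans (mc_formE c (x t) _)).
apply: (etrans _ (etrans (esym (near_eq_derive (1 : R) E)) D1)).
have dl := smooth_differentiable (smooth_ldiv Ac cxt).
apply: (etrans _ (esym (derive_comp (1 : R) (smooth_differentiable sp) dl))).
apply: (f_equal (fun w => 'D_w (ldiv c) (x t, x t))); apply: esym.
apply: (etrans (derive_pair (1 : R) (differentiable_cst (x t) t) (smooth_differentiable sx))).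
exact: (f_equal2 pair (derive_cst (x t) t (1 : R)) erefl).
Qed.

(** The identity [mc_velocity] is differentiated in [t] at [t0]. *)
Lemma mc_acceleration :
  mc_form c (x t0) (- 'D_1 ('D_1 x) t0) = 'D_y (fun u => mc_form c u y) (x t0).
Proof.
have sx := smooth_x ct0; have sx' := smooth_derive (1 : R) sx.
have cxt : (cmap c @` cdom c) (x t0) by exists (s t0).
have sl := smooth_ldiv Ac cxt.
have E : \forall t \near t0, 'D_(0, 'D_1 x t) (ldiv c) (x t, x t) = Y.
  apply: filterS (near_cdom ct0) => t ct.
  by apply: (etrans (esym (mc_formE c (x t) _))); exact: mc_velocity.
have sa : smooth (fun t => ((0, 'D_1 x t) : V * V)) t0.
  exact: (smooth_pair (smooth_cst 0 t0) sx').
have sb : smooth (fun t => (x t, x t)) t0 by exact: smooth_pair.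
have Da : 'D_1 (fun t => ((0, 'D_1 x t) : V * V)) t0 = (0, 'D_1 ('D_1 x) t0).
  apply: (etrans (derive_pair (1 : R) (differentiable_cst 0 t0) (smooth_differentiable sx'))).
  exact: (f_equal2 pair (derive_cst 0 t0 (1 : R)) erefl).
have dx := smooth_differentiable sx.
have Db : 'D_1 (fun t => (x t, x t)) t0 = (y, y) := derive_pair (1 : R) dx dx.
pose proof (etrans (esym (derive_moving (1 : R) sa sb sl))
  (etrans (near_eq_derive (1 : R) E) (derive_cst Y t0 (1 : R)))) as H0.
have step a b : a = (0, 'D_1 ('D_1 x) t0) -> b = (y, y) ->
   'D_a (ldiv c) (x t0, x t0) + 'D_b ('D_(0, y) (ldiv c)) (x t0, x t0) = 0 ->
   - 'D_(0, 'D_1 ('D_1 x) t0) (ldiv c) (x t0, x t0) = 'D_(y, y) ('D_(0, y) (ldiv c)) (x t0, x t0).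
  by move=> -> -> /eqP; rewrite addrC addr_eq0 => /eqP ->.
have H := step _ _ Da Db H0.
apply: (etrans _ (esym (derive_mc Ac ct0 y y))).
apply: (etrans _ H); apply: (etrans (mc_formE c (x t0) _)).
have Nw : ((0, - 'D_1 ('D_1 x) t0) : V * V) = - (0, 'D_1 ('D_1 x) t0).
  by rewrite -[RHS]/(- 0, - 'D_1 ('D_1 x) t0) oppr0.
apply: (etrans (f_equal (fun w => 'D_w (ldiv c) (x t0, x t0)) Nw)).
exact: (derive_dirN _ (smooth_differentiable sl)).
Qed.

Lemma velocity_neq0 : y != 0.
Proof.
apply: contra_neq Y_neq0 => y0.
rewrite -(mc_velocity ct0) -/y y0.
by rewrite mc_formE; exact: derive0.
Qed.

(** The condition of criticality in [chern_contraction] concerns the directions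
    given by the structure equation, and these are brackets with
    [mc_form c (x t0) y], which is [Y]. *)
Lemma geodesic_equation i : 'D_1 ('D_1 x) t0 0 i
  + \sum_j \sum_k y 0 j * y 0 k *
      chern_connection (left_invariant_metric F c) (x t0) y i j k = 0.
Proof.
have crit w : 'D_('D_y (fun u => mc_form c u w) (x t0) - 'D_w (fun u => mc_form c u y) (x t0))
    (sqnorm F) (mc_form c (x t0) y) = 0.
  apply: (etrans (f_equal (fun v => 'D_v (sqnorm F) _) (maurer_cartan Ac ct0 y w))).
  rewrite [mc_form c _ y](mc_velocity ct0) (derive_sqnorm mF _ Y_neq0).
  by rewrite Y_critical mulr0.
pose proof (chern_contraction mF (mc_linear Ac ct0) (mc_smooth Ac ct0) (fun w => mc_inj Ac ct0 (w:=w))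
  velocity_neq0 mc_acceleration crit i) as H.
apply: (etrans (f_equal (fun r => 'D_1 ('D_1 x) t0 0 i + r) H)).
by rewrite mxE subrr.
Qed.

End InChart.

Lemma critical_geodesic_vector : geodesic_vector G F Y.
Proof.
split=> //; rewrite (_ : (fun t : R => lie_exp G (t *: Y)) = s); last first.
  by apply/funext => t; exact: lie_expE.
move=> t _; split; first exact: (hom_continuous hom tan (x := t)).
move=> c Ac ct x y.
have Dx : derive1 x = 'D_1 x by apply/funext => t'; exact: derive1E.
rewrite /y Dx.
have sx := smooth_x Ac ct.
split.
- apply: filterS (smooth_near_differentiable sx) => t' dx; exact: diff_derivable.
- exact/diff_derivable/smooth_differentiable/smooth_derive.
- exact: velocity_neq0.
- by move=> i; rewrite derive1E; exact: geodesic_equation.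
Qed.

End GeodesicSubgroup.

(** * Geodesic vectors on an adjoint orbit *)

Theorem corollary4p2 (R : realType) (n : nat) (G : lieGroupType R n)
    (G_compact : compact [set: G]) (G_connected : connected [set: G])
    (G_semisimple : semisimple G)
    (F : 'rV[R]_n -> R) (F_minkowski : minkowski_norm F)
    (X : 'rV[R]_n) (X_neq0 : X != 0) :
  exists Y1 Y2 : 'rV[R]_n,
    [/\ Y1 != Y2, adjoint_orbit G X Y1, adjoint_orbit G X Y2,
        geodesic_vector G F Y1 & geodesic_vector G F Y2].
Proof.
have orbit (g : G) : adjoint_orbit G X (Ad g X) by exists g.
have cF : continuous (fun g : G => F (Ad g X)).
  move=> g; have [cF _ _ _ _] := F_minkowski.
  apply: (@continuous_comp _ _ _ (fun h : G => Ad h X) F g); last exact: cF.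
  exact: continuous_Ad.
have dF (g : G) : differentiable F (Ad g X).
  exact/smooth_differentiable/(smooth_norm F_minkowski)/Ad_neq0.
have cF' : {within [set: G], continuous (fun g : G => F (Ad g X))}.
  exact: continuous_subspaceT.
have G0 : [set: G] !=set0 by exists 1%g.
have [a _ amax] := compact_EVT_max G0 G_compact cF'.
have [b _ bmin] := compact_EVT_min G0 G_compact cF'.
have gmax (g : G) : (forall h : G, F (Ad h X) <= F (Ad g X)) -> geodesic_vector G F (Ad g X).
  move=> g_max; apply: (critical_geodesic_vector F_minkowski (Ad_neq0 g X_neq0)) => Z.
  by apply: (orbit_max Z (dF g)) => h; rewrite -AdM; exact: g_max.
have gmin (g : G) : (forall h : G, F (Ad g X) <= F (Ad h X)) -> geodesic_vector G F (Ad g X).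
  move=> g_min; apply: (critical_geodesic_vector F_minkowski (Ad_neq0 g X_neq0)) => Z.
  by apply: (orbit_min Z (dF g)) => h; rewrite -AdM; exact: g_min.
have {}amax (h : G) : F (Ad h X) <= F (Ad a X) by apply: amax; rewrite inE.
have {}bmin (h : G) : F (Ad b X) <= F (Ad h X) by apply: bmin; rewrite inE.
have [ab|ab] := eqVneq (Ad a X) (Ad b X); last first.
  by exists (Ad a X), (Ad b X); exact: And5 ab (orbit a) (orbit b) (gmax a amax) (gmin b bmin).
(* The maximum equals the minimum, so that every vector of the orbit is a
   maximum. *)
have [g gX] := semisimple_Ad_moves G_semisimple X_neq0.
have allmax (h h' : G) : F (Ad h' X) <= F (Ad h X).
  by apply: le_trans (amax h') _; rewrite ab; exact: bmin.
rewrite -[X in _ != X](@Ad1 R n G) in gX.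
exists (Ad g X), (Ad (1%g : G) X).
exact: And5 gX (orbit g) (orbit 1%g) (gmax g (allmax g)) (gmax 1%g (allmax 1%g)).
Qed.
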